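(* Let $f(q)\in\mathbb{C}[[q]]$. If $f(q)$, $f(q)^2$, and $f(q)^4$ are all multiplicative, then $f(q)$ is a constant multiple of one of $\vartheta_{\mathbb{Z}}(q)$, $\vartheta_{\mathbb{Z}}(-q)$, $\vartheta_{\mathbb{Z}[i]}(q)$, $\vartheta_{\mathbb{Z}[i]}(-q)$, $\vartheta_{\mathbb{Z}[\zeta_3]}(q)$, $\vartheta_{\mathbb{Z}[\zeta_3]}(-q)$.
   Context: A power series $g(q)\in\mathbb{C}[[q]]$ is called normalized multiplicative if $g(q)=\frac{1}{2a_0}+\sum_{n\ge1}a_nq^n$ with $a_0\in\mathbb{C}\setminus\{0\}$, $a_1=1$, and $a_{mn}=a_ma_n$ for all relatively prime positive integers $m,n$. A power series $g$ is called multiplicative if $\lambda g$ is normalized multiplicative for some $\lambda\in\mathbb{C}$. For a ring $R\in\{\mathbb{Z},\mathbb{Z}[i],\mathbb{Z}[\zeta_3]\}$ (with $\zeta_3=e^{2\pi i/3}$) viewed inside $\mathbb{C}$, $\vartheta_R(q)=\frac{1}{|R^\times|}\sum_{\lambda\in R}q^{|\lambda|^2}$; so the normalizing factors are $1/2$, $1/4$, $1/6$ respectively. *)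

(* Defs.v *)
From HB Require Import structures.
From mathcomp Require Import all_boot all_order all_algebra finmap.
From mathcomp Require Import mathcomp_extra boolp classical_sets functions.
From mathcomp Require Import cardinality fsbigop reals trigo.
From mathcomp Require Import complex.

Set Implicit Arguments.
Unset Strict Implicit.
Unset Printing Implicit Defensive.

Import Order.TTheory GRing.Theory Num.Theory.
Local Open Scope classical_set_scope.
Local Open Scope complex_scope.
Local Open Scope ring_scope.

(* The formal power series \sum_n g_n q^n is encoded by its coefficients. *)
Definition pseries (K : Type) := nat -> K.

Section PowerSeries.
Variable K : fieldType.
Implicit Types f g : pseries K.

Definition ps_one : pseries K := fun n => (n == 0%N)%:R.

Definition ps_mul f g : pseries K :=
  fun n => \sum_(i < n.+1) f i * g (n - i)%N.

Definition ps_exp f (k : nat) : pseries K := iter k (ps_mul f) ps_one.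

Definition ps_scale (c : K) f : pseries K := fun n => c * f n.

(* g(-q) *)
Definition ps_alt g : pseries K := fun n => (-1) ^+ n * g n.

(* The constant coefficient is 1 / (2 a_0), so a_0 is not g 0. *)
Definition normalized_multiplicative g : Prop :=
  [/\ exists2 a0 : K, a0 != 0 & g 0%N = 1 / (2 * a0),
      g 1%N = 1 &
      forall m n : nat, (0 < m)%N -> (0 < n)%N -> coprime m n ->
        g (m * n)%N = g m * g n].

Definition multiplicative g : Prop :=
  exists lambda : K, normalized_multiplicative (ps_scale lambda g).

Definition constant_multiple f g : Prop :=
  exists c : K, forall n : nat, f n = c * g n.

End PowerSeries.

Section Theta.
Variable R : realType.
Local Notation C := R[i].

Definition zeta3 : C := cos (2 * pi / 3) +i* sin (2 * pi / 3).

Definition Zint : set C := [set a%:~R | a in [set: int]].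

(* Z[alpha], the image of Z[X] under evaluation at alpha. *)
Definition Zadjoin (alpha : C) : set C :=
  [set (map_poly intr p).[alpha] | p in [set: {poly int}]].

Definition units_of (A : set C) : set C :=
  [set z | A z /\ exists2 w, A w & z * w = 1].

(* (1 / |A^x|) \sum_(z in A) q^(|z|^2): the coefficient of q^n adds up 1 over
   the z in A with |z|^2 = n.  Both fset_set and \sum_(_ \in _) take a default
   value on infinite sets; for the rings Z, Z[i] and Z[zeta3] the unit group
   and the set of elements of a given norm are finite. *)
Definition theta (A : set C) : pseries C := fun n =>
  (#|` fset_set (units_of A)|%:R)^-1 *
  \sum_(z \in A) ((`|z| ^+ 2 == n%:R)%:R : C).

Definition theta_Z : pseries C := theta Zint.
Definition theta_Zi : pseries C := theta (Zadjoin (0 +i* 1)).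
Definition theta_Zzeta3 : pseries C := theta (Zadjoin zeta3).

End Theta.

Arguments zeta3 {R}.
Arguments theta_Z {R}.
Arguments theta_Zi {R}.
Arguments theta_Zzeta3 {R}.

(* Main.v *)
(* Scale f so that f = 1 / (2 T) + q + a_2 q^2 + ...  Then f^2 and f^4 have, up
   to scaling, the coefficients b_n = a_n + T sum a_i a_(n-i) and
   d_n = b_n + 2 T sum b_i b_(n-i), sums over 0 < i < n.  Multiplicativity of
   a, b, d at n = 6, 10, 12, 14, 15, 18, 20, 21, 22 expresses a_n, n < 23, by
   polynomials in T, a_2, a_3, a_7 and leaves nine equations between these.
   The equations are solved inside a valuation ring of residue characteristic
   7: each point at infinity, and each neighbourhood of a would-be extra
   solution, is excluded by a weighted blow-up and an identity modulo 7 in the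
   leading forms, checked by computation.  The solutions are T = +-1, +-2,
   +-3, with the coefficients of the three theta functions; q -> -q changes
   the sign of T.  Beyond n = 22 the relations at the non prime powers n
   between q and q + 6 determine a_q.

   The theta functions do solve the equations: f^2 (and f^4 for Z) count
   elements of given norm in a quadratic order or in its Cayley-Dickson double,
   and the numbers r(n) of elements of norm n satisfy
   r(m) r(n) = r(1) r(m n) for coprime m, n because an element z of norm m n
   factors as (z, m) times an element of norm n, uniquely up to units. *)
From Stdlib Require Ring_polynom InitialRing ZArith BinNums BinNat.
From HB Require Import structures.
From mathcomp Require finmap mathcomp_extra boolp classical_sets functions cardinality fsbigop trigo.
From mathcomp Require ring zify lra.
From Pilot Require Import Defs.
From mathcomp Require Import all_boot all_order all_algebra.
From mathcomp Require Import reals complex.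
Set Implicit Arguments.
Unset Strict Implicit.
Unset Printing Implicit Defensive.

(** A complex solution has no reduction modulo 7 by itself. Zorn's lemma supplies a valuation ring
    of the field in which 7 is not invertible; polynomial identities are then needed only modulo 7.
    A solution need not be integral for this ring. Rescaling q by e gives a_n the weight n - 1 and T
    the weight 1; an extra unknown C of weight 2, equal to 1/2 for an actual series, records the
    scaling, and a solution can be rescaled until T, a_2/6, a_3/6, a_7/6, C are integral and not all
    in the maximal ideal. The factor 6 and the form 2 C of the homogenizing unknown keep the
    elimination integral over Z. The price is spurious points: points at infinity, with C = 0, and a
    point with T = 0 that remains after division by powers of T. The theta points are simple modulo
    7, so a solution with the same residue equals them. The two residues with C = 0 also occur for T
    = 1, and only iterated blow-ups show that no solution with C nonzero lies above them. *)

Module Elimination.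
Import all_boot all_order all_algebra zify.
Import GRing.Theory.
Local Open Scope ring_scope.

(** * Computable integer polynomials, in the sparse Horner form of the [ring] tactic, and their
    evaluation *)

Notation Z := BinNums.Z.
Notation pol := (Ring_polynom.Pol Z).
Notation PC := (@Ring_polynom.Pc Z).
Notation padd := (Ring_polynom.Padd BinNums.Z0 BinInt.Z.add BinInt.Z.eqb).
Notation pmul := (Ring_polynom.Pmul BinNums.Z0 (BinNums.Zpos BinNums.xH) BinInt.Z.add BinInt.Z.mul BinInt.Z.eqb).
Notation popp := (Ring_polynom.Popp BinInt.Z.opp).
Notation peq := (Ring_polynom.Peq BinInt.Z.eqb).
Notation mkPX := (Ring_polynom.mkPX BinNums.Z0 BinInt.Z.eqb).
Notation mkPinj := Ring_polynom.mkPinj.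
Notation p0 := (PC BinNums.Z0).
Notation p1 := (PC (BinNums.Zpos BinNums.xH)).

Section Evaluation.
Variable K : comNzRingType.

Definition zv : Z -> K := InitialRing.gen_phiZ 0 1 +%R *%R -%R.
Definition ev (e : seq K) (P : pol) : K := Ring_polynom.Pphi 0 +%R *%R zv e P.

Lemma ring_th : Ring_theory.ring_theory (0 : K) 1 +%R *%R (fun x y => x - y) -%R eq.
Proof.
split; [exact: add0r|exact: addrC|exact: addrA|exact: mul1r|exact: mulrC|exact: mulrA|exact: mulrDl|by []|exact: subrr].
Qed.

Lemma ring_ext : Ring_theory.ring_eq_ext +%R *%R -%R (@eq K).
Proof. by split=> [x _ <- y _ <-|x _ <- y _ <-|x _ <-]. Qed.

Let eqK : RelationClasses.Equivalence (@eq K) := RelationClasses.eq_equivalence.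
Let ARth := Ring_theory.Rth_ARth eqK ring_ext ring_th.
Let morphZ := InitialRing.gen_phiZ_morph eqK ring_ext ring_th.

Lemma evC e c : ev e (PC c) = zv c. Proof. by []. Qed.
Lemma evD e P Q : ev e (padd P Q) = ev e P + ev e Q.
Proof. exact: (Ring_polynom.Padd_ok eqK ring_ext ARth morphZ Q P e). Qed.
Lemma evM e P Q : ev e (pmul P Q) = ev e P * ev e Q.
Proof. exact: (Ring_polynom.Pmul_ok eqK ring_ext ARth morphZ P Q e). Qed.
Lemma evN e P : ev e (popp P) = - ev e P.
Proof. exact: (Ring_polynom.Popp_ok eqK ring_ext ARth morphZ P e). Qed.
Lemma ev_eq e P Q : peq P Q -> ev e P = ev e Q.
Proof. by move=> PQ; exact: (Ring_polynom.Peq_ok eqK ring_ext morphZ P Q PQ e). Qed.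

Lemma pow_posE (x : K) p : Ring_theory.pow_pos *%R x p = x ^+ BinPos.Pos.to_nat p.
Proof.
elim: p => [p /= ->|p /= ->|] //; rewrite -?exprD -?exprS.
  by rewrite Pnat.Pos2Nat.inj_xI addnn -mul2n.
by rewrite Pnat.Pos2Nat.inj_xO addnn -mul2n.
Qed.

Lemma ev_Pinj e j P : ev e (Ring_polynom.Pinj j P) = ev (BinList.jump j e) P.
Proof. by []. Qed.
Lemma ev_PX e P i Q : ev e (Ring_polynom.PX P i Q) =
  ev e P * head 0 e ^+ BinPos.Pos.to_nat i + ev (behead e) Q.
Proof. by rewrite -pow_posE; case: e. Qed.
Lemma ev_mkPX e P i Q : ev e (mkPX P i Q) =
  ev e P * head 0 e ^+ BinPos.Pos.to_nat i + ev (behead e) Q.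
Proof.
rewrite /ev (Ring_polynom.mkPX_ok eqK ring_ext ARth morphZ) -pow_posE.
by case: e.
Qed.
Lemma ev_mkPinj e j P : ev e (mkPinj j P) = ev (BinList.jump j e) P.
Proof. exact: Ring_polynom.mkPinj_ok. Qed.

Lemma zvD a b : zv (BinInt.Z.add a b) = zv a + zv b.
Proof. exact: (Ring_theory.morph_add morphZ). Qed.
Lemma zvM a b : zv (BinInt.Z.mul a b) = zv a * zv b.
Proof. exact: (Ring_theory.morph_mul morphZ). Qed.
Lemma zvN a : zv (BinInt.Z.opp a) = - zv a.
Proof. exact: (Ring_theory.morph_opp morphZ). Qed.
Lemma zv_nat n : zv (BinInt.Z.of_nat n) = n%:R.
Proof.
by elim: n => [//|n IH]; rewrite Znat.Nat2Z.inj_succ -BinInt.Z.add_1_r zvD IH -natr1.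
Qed.
End Evaluation.
Arguments ev {K} e P : simpl never.
Arguments zv {K} _ : simpl never.

Fixpoint ppow (P : pol) n := if n is m.+1 then pmul P (ppow P m) else p1.
Definition pnat n : pol := PC (BinInt.Z.of_nat n).
Definition pvar k : pol :=
  if k is 0 then Ring_polynom.PX p1 BinNums.xH p0
  else Ring_polynom.Pinj (BinPos.Pos.of_nat k) (Ring_polynom.PX p1 BinNums.xH p0).
Definition psub P Q := padd P (popp Q).

Fixpoint psubst (l : seq pol) (P : pol) : pol :=
  match P with
  | Ring_polynom.Pc c => PC c
  | Ring_polynom.Pinj j Q => psubst (BinList.jump j l) Q
  | Ring_polynom.PX P i Q =>
      padd (pmul (psubst l P) (ppow (head p0 l) (BinPos.Pos.to_nat i)))
           (psubst (behead l) Q)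
  end.

Arguments pvar : simpl never.
Arguments ppow : simpl never.
Arguments pnat : simpl never.
Section Eval.
Variable K : comNzRingType.
Implicit Types (e : seq K) (P Q : pol).

Lemma ev0 e : ev e p0 = 0. Proof. by []. Qed.
Lemma ev1 e : ev e p1 = 1. Proof. by []. Qed.
Lemma ev_nat e n : ev e (pnat n) = n%:R.
Proof. by rewrite evC zv_nat. Qed.
Lemma evB e P Q : ev e (psub P Q) = ev e P - ev e Q.
Proof. by rewrite evD evN. Qed.
Lemma evX e P n : ev e (ppow P n) = ev e P ^+ n.
Proof. by elim: n => [|n IH]; rewrite ?ev1 ?expr0 // exprS -IH -evM. Qed.

Lemma jumpE (A : Type) j (l : seq A) : BinList.jump j l = drop (BinPos.Pos.to_nat j) l.
Proof.
elim/BinPos.Pos.peano_ind: j l => [|j IH] l; first by case: l => //= x l; rewrite drop0.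
rewrite BinList.jump_succ /= IH Pnat.Pos2Nat.inj_succ.
rewrite -[in RHS]addn1 addnC -drop_drop drop1.
by rewrite -[List.tl _]/(behead _) -!drop1 !drop_drop addnC.
Qed.

Lemma ev_var e k : ev e (pvar k) = nth 0 e k.
Proof.
case: k => [|k]; first by rewrite ev_PX ev1 ev0 addr0 mul1r expr1 nth0.
rewrite ev_Pinj ev_PX ev1 ev0 addr0 mul1r expr1 jumpE.
by rewrite Pnat.Nat2Pos.id // -nth0 nth_drop addn0.
Qed.

Lemma ev_subst e l P : ev e (psubst l P) = ev (map (ev e) l) P.
Proof.
elim: P l => [//|j Q IH|P IHP i Q IHQ] l /=.
  by rewrite IH ev_Pinj !jumpE map_drop.
rewrite ev_PX evD evM evX IHP IHQ behead_map; congr (_ * _ ^+ _ + _).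
by case: l.
Qed.
End Eval.

Fixpoint pmap (f : Z -> Z) (P : pol) : pol :=
  match P with
  | Ring_polynom.Pc c => PC (f c)
  | Ring_polynom.Pinj j Q => mkPinj j (pmap f Q)
  | Ring_polynom.PX P i Q => mkPX (pmap f P) i (pmap f Q)
  end.

(* Divides by the n-th power of the first variable when this is possible. *)
Definition pdrop (n : nat) (P : pol) : pol :=
  match P with
  | Ring_polynom.PX P i Q =>
      let j := BinPos.Pos.to_nat i in
      if j == n then P else Ring_polynom.PX P (BinPos.Pos.of_nat (j - n)) Q
  | _ => P
  end.
(** Rounds when [c] does not divide; like [pdrop], it only proposes a result, and exactness is
    checked afterwards by [solved]. *)
Definition pdivc (c : Z) : pol -> pol := pmap (fun z => BinInt.Z.div z c).

(* Only the first k variables occur. *)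
Fixpoint closedp (k : nat) (P : pol) : bool :=
  match P with
  | Ring_polynom.Pc _ => true
  | Ring_polynom.Pinj j Q => closedp (k - BinPos.Pos.to_nat j)%N Q
  | Ring_polynom.PX P _ Q => [&& (0 < k)%N, closedp k P & closedp k.-1 Q]
  end.

Lemma ev_closed (K : comNzRingType) (e e' : seq K) P :
  closedp (size e) P -> ev (e ++ e') P = ev e P.
Proof.
elim: P e e' => [//|j Q IH|P IHP i Q IHQ] e e' /=.
  rewrite !ev_Pinj !jumpE drop_cat -size_drop => cQ.
  case: ltnP => [_|se]; first exact: IH.
  move: cQ; rewrite [drop _ e]drop_oversize //= => cQ.
  by rewrite -[drop _ e']cat0s IH ?drop_oversize.
by case: e => [//|x e] /=; rewrite !ev_PX /= => /andP[cP cQ]; rewrite (IHP (x :: e)) // IHQ.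
Qed.

(** * The nine equations in T, a_2, a_3, a_7 and C *)

Section Derivation.
Notation vT := (pvar 0).
Notation v2C := (pmul (pnat 2) (pvar 4)).
(** The power of 2 C balances the weights: r s - 1 exceeds (r - 1) + (s - 1) by (r - 1)(s - 1) = 2
    k. *)
Definition pprod k P Q := pmul (ppow v2C k) (pmul P Q).
(** Variables 0 to 4 are T, a_2/6, a_3/6, a_7/6, C. Variables 5 to 13 are the a_n at the other prime
    powers n below 20: 4, 5, 8, 9, 11, 13, 16, 17, 19. *)
Definition unknowns := [seq pvar i | i <- iota 5 9].
Definition coefs (qs : seq pol) : seq pol :=
  let q i := nth p0 qs i in
  let q2 := pmul (pnat 6) (pvar 1) in
  let q3 := pmul (pnat 6) (pvar 2) in
  let q7 := pmul (pnat 6) (pvar 3) in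
  [:: p0; p1; q2; q3; q 0; q 1; pprod 1 q2 q3; q7; q 2; q 3;
      pprod 2 q2 (q 1); q 4; pprod 3 q3 (q 0); q 5; pprod 3 q2 q7;
      pprod 4 q3 (q 1); q 6; q 7; pprod 4 q2 (q 3); q 8;
      pprod 6 (q 0) (q 1); pprod 6 q3 q7; pprod 5 q2 (q 4)].

Definition pconv (l : seq pol) n :=
  foldr (fun i P => padd (pmul (nth p0 l i) (nth p0 l (n - i))) P) p0 (iota 1 n.-1).
Definition pnext k (l : seq pol) n := padd (nth p0 l n) (pmul (pmul (pnat k) vT) (pconv l n)).
Definition pnexts k l m := [seq pnext k l n | n <- iota 0 m].

(* The coefficients of n = r s in f^2 and f^4, computed in two ways. *)
Definition relations l r s : pol * pol :=
  let lb := pnexts 1 l (r * s) in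
  let d n := pnext 2 lb n in
  let b n := nth p0 lb n in
  let k := ((r.-1 * s.-1)./2)%N in
  let a' := nth p0 l (r * s) in
  let b' := pprod k (b r) (b s) in
  (psub (padd a' (pmul vT (pconv l (r * s)))) b',
   psub (padd b' (pmul (pmul (pnat 2) vT) (pconv lb (r * s)))) (pprod k (d r) (d s))).
Definition coefz k P := psubst [seq if i == k then p0 else pvar i | i <- iota 0 14] P.
(* [P = c T^n (x_k - result)] *)
Definition solve c n k P := pdivc (BinInt.Z.opp (BinInt.Z.of_nat c)) (pdrop n (coefz k P)).
Definition solved c n k P q :=
  peq P (pmul (pmul (pnat c) (ppow vT n)) (psub (pvar k) q)).
(** Both relations at n contain a_(n-1), with coefficients 2 T and 4 T. The combination cancels it,
    together with 4 T a_2 a_(n-2), and leaves a_(n-2) with coefficient 8 T^2 + 4 T^2 = 12 T^2. *)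
Definition comb (e : pol * pol) := psub e.2 (pmul (pnat 2) e.1).
End Derivation.

(** At n = 6, 10, 18 both a_(n-2) and a_(n-1) are new, and both relations are consumed. At n = 12,
    14, 20 only a_(n-1) is new and one equation remains; at n = 15, 21, 22 both remain. *)
Definition q4 := solve 12 2 5 (comb (relations (coefs unknowns) 2 3)).
Definition qs1 := set_nth p0 unknowns 0 q4.
Definition q5 := solve 2 1 6 (relations (coefs qs1) 2 3).1.
Definition qs2 := set_nth p0 qs1 1 q5.
Definition q8 := solve 12 2 7 (comb (relations (coefs qs2) 2 5)).
Definition qs3 := set_nth p0 qs2 2 q8.
Definition q9 := solve 2 1 8 (relations (coefs qs3) 2 5).1.
Definition qs4 := set_nth p0 qs3 3 q9.
Definition r12 := relations (coefs qs4) 3 4.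
Definition q11 := solve 2 1 9 r12.1.
Definition qs5 := set_nth p0 qs4 4 q11.
Definition r14 := relations (coefs qs5) 2 7.
Definition q13 := solve 2 1 10 r14.1.
Definition qs6 := set_nth p0 qs5 5 q13.
Definition r15 := relations (coefs qs6) 3 5.
Definition r18 := relations (coefs qs6) 2 9.
Definition q16 := solve 12 2 11 (comb r18).
Definition qs7 := set_nth p0 qs6 6 q16.
Definition q17 := solve 2 1 12 (relations (coefs qs7) 2 9).1.
Definition qs8 := set_nth p0 qs7 7 q17.
Definition r20 := relations (coefs qs8) 4 5.
Definition q19 := solve 2 1 13 r20.1.
Definition qs9 := set_nth p0 qs8 8 q19.
Definition r21 := relations (coefs qs9) 3 7.
Definition r22 := relations (coefs qs9) 2 11.
Definition eqns : seq pol :=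
  [:: pdrop 2 (comb r12); pdrop 2 (comb r14); pdrop 1 r15.1; pdrop 1 r15.2;
      pdrop 2 (comb r20); pdrop 1 r21.1; pdrop 1 r21.2; pdrop 1 r22.1; pdrop 1 r22.2].
Fixpoint psize (P : pol) := match P with
  | Ring_polynom.Pc BinNums.Z0 => 0%N
  | Ring_polynom.Pc c => 1%N
  | Ring_polynom.Pinj j Q => psize Q
  | Ring_polynom.PX P i Q => (psize P + psize Q)%N end.
Lemma solved4 : solved 12 2 5 (comb (relations (coefs unknowns) 2 3)) q4. Proof. by vm_compute. Qed.
Lemma solved5 : solved 2 1 6 (relations (coefs qs1) 2 3).1 q5. Proof. by vm_compute. Qed.
Lemma solved8 : solved 12 2 7 (comb (relations (coefs qs2) 2 5)) q8. Proof. by vm_compute. Qed.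
Lemma solved9 : solved 2 1 8 (relations (coefs qs3) 2 5).1 q9. Proof. by vm_compute. Qed.
Lemma solved11 : solved 2 1 9 (relations (coefs qs4) 3 4).1 q11. Proof. by vm_compute. Qed.
Lemma solved13 : solved 2 1 10 (relations (coefs qs5) 2 7).1 q13. Proof. by vm_compute. Qed.
Lemma solved16 : solved 12 2 11 (comb (relations (coefs qs6) 2 9)) q16. Proof. by vm_compute. Qed.
Lemma solved17 : solved 2 1 12 (relations (coefs qs7) 2 9).1 q17. Proof. by vm_compute. Qed.
Lemma solved19 : solved 2 1 13 (relations (coefs qs8) 4 5).1 q19. Proof. by vm_compute. Qed.
Lemma dropped0 : peq (comb r12) (pmul (ppow (pvar 0) 2) (pdrop 2 (comb r12))). Proof. by vm_compute. Qed.
Lemma dropped1 : peq (comb r14) (pmul (ppow (pvar 0) 2) (pdrop 2 (comb r14))). Proof. by vm_compute. Qed.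
Lemma dropped2 : peq (r15.1) (pmul (ppow (pvar 0) 1) (pdrop 1 r15.1)). Proof. by vm_compute. Qed.
Lemma dropped3 : peq (r15.2) (pmul (ppow (pvar 0) 1) (pdrop 1 r15.2)). Proof. by vm_compute. Qed.
Lemma dropped4 : peq (comb r20) (pmul (ppow (pvar 0) 2) (pdrop 2 (comb r20))). Proof. by vm_compute. Qed.
Lemma dropped5 : peq (r21.1) (pmul (ppow (pvar 0) 1) (pdrop 1 r21.1)). Proof. by vm_compute. Qed.
Lemma dropped6 : peq (r21.2) (pmul (ppow (pvar 0) 1) (pdrop 1 r21.2)). Proof. by vm_compute. Qed.
Lemma dropped7 : peq (r22.1) (pmul (ppow (pvar 0) 1) (pdrop 1 r22.1)). Proof. by vm_compute. Qed.
Lemma dropped8 : peq (r22.2) (pmul (ppow (pvar 0) 1) (pdrop 1 r22.2)). Proof. by vm_compute. Qed.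
Lemma closed_eqns : all (closedp 5) eqns. Proof. by vm_compute. Qed.
Lemma closed_coefs : all (fun i => closedp 5 (nth p0 (coefs qs9) i)) (iota 1 22). Proof. by vm_compute. Qed.

(** * Soundness of the elimination for sequences in a field *)

Definition conv (K : pzRingType) (f : nat -> K) n := \sum_(1 <= i < n) f i * f (n - i)%N.

Definition next (K : pzRingType) k (T : K) (f : nat -> K) n := f n + k%:R * T * conv f n.

(* Rescaling the variable by e multiplies g_n by e^(n-1), C by e^2. *)
Definition hmult (K : pzRingType) (C : K) (g : nat -> K) :=
  forall r s, (0 < r)%N -> (0 < s)%N -> coprime r s ->
    g (r * s)%N = C ^+ ((r.-1 * s.-1)./2)%N * (g r * g s).

Lemma ev_pconv (K : comNzRingType) (e : seq K) l f n :
  (forall i, (0 < i < n)%N -> ev e (nth p0 l i) = f i) ->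
  ev e (pconv l n) = conv f n.
Proof.
move=> lf; rewrite /conv /pconv /index_iota subn1.
have: {in iota 1 n.-1, forall i, (0 < i < n)%N}.
  by move=> i; rewrite mem_iota; case: n {lf} => [|n] /=; rewrite ?add1n ?addn0 //; case: i.
elim: iota => [|i s IH] hs /=; first by rewrite big_nil ev0.
have hi : (0 < i < n)%N by apply: hs; rewrite mem_head.
rewrite big_cons evD evM !lf ?IH //; last first.
  by case/andP: hi => i0 lin; rewrite subn_gt0 lin -subn_gt0 subKn ?i0 // ltnW.
by move=> j js; apply: hs; rewrite inE js orbT.
Qed.

Section Elimination.
Variables (K : fieldType) (T C : K) (a : nat -> K).
Hypotheses (K2 : 2%:R != 0 :> K) (K3 : 3%:R != 0 :> K) (T0 : T != 0).
Let b := next 1 T a.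
Let d := next 2 T b.
Hypotheses (a1 : a 1%N = 1) (am : hmult (2%:R * C) a) (bm : hmult (2%:R * C) b)
  (dm : hmult (2%:R * C) d).

Let x6 n := a n / 6%:R.
Definition env := [:: T; x6 2; x6 3; x6 7; C].
Let idx := [:: 4; 5; 8; 9; 11; 13; 16; 17; 19]%N.
Let e := env ++ map a idx.

Let ev_next k f l n (lf : forall i, (0 < i <= n)%N -> ev e (nth p0 l i) = f i) :
  (0 < n)%N -> ev e (pnext k l n) = next k T f n.
Proof.
move=> n0; rewrite evD !evM ev_nat ev_var (@ev_pconv _ _ _ f); first by rewrite lf ?n0 /=.
by move=> i /andP[i0 lin]; rewrite lf // i0 ltnW.
Qed.

Let ev_pprod k P Q : ev e (pprod k P Q) = (2%:R * C) ^+ k * (ev e P * ev e Q).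
Proof. by rewrite !evM evX evM ev_nat ev_var. Qed.

Let ev_relations l r s (lf : forall i, (0 < i <= r * s)%N -> ev e (nth p0 l i) = a i) :
  (1 < r)%N -> (1 < s)%N -> coprime r s ->
  ev e (relations l r s).1 = 0 /\ ev e (relations l r s).2 = 0.
Proof.
move=> r1 s1 crs; cbv beta zeta iota delta [relations fst snd].
set lb := pnexts _ _ _.
have r0 := ltnW r1; have s0 := ltnW s1.
have lbf i : (0 < i < r * s)%N -> ev e (nth p0 lb i) = b i.
  case/andP => i0 irs; rewrite (nth_map 0%N) ?size_iota // nth_iota // add0n.
  apply: ev_next => // j /andP[j0 ji]; by apply: lf; rewrite j0 (leq_trans ji) // ltnW.
have dl i : (0 < i < r * s)%N -> ev e (pnext 2 lb i) = d i.
  case/andP=> i0 irs; apply: ev_next => // j /andP[j0 ji].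
  by apply: lbf; rewrite j0 (leq_ltn_trans ji).
have rs0 : (0 < r * s)%N by rewrite muln_gt0 r0.
have rlt : (0 < r < r * s)%N by rewrite r0 ltn_Pmulr.
have slt : (0 < s < r * s)%N by rewrite s0 ltn_Pmull.
have cl : ev e (pconv l (r * s)) = conv a (r * s).
  by apply: ev_pconv => i /andP[i0 irs]; rewrite lf // i0 ltnW.
have cb : ev e (pconv lb (r * s)) = conv b (r * s) by apply: ev_pconv.
have pb : ev e (pprod (r.-1 * s.-1)./2 (nth p0 lb r) (nth p0 lb s)) = b (r * s).
  by rewrite ev_pprod !lbf // bm.
have pd : ev e (pprod (r.-1 * s.-1)./2 (pnext 2 lb r) (pnext 2 lb s)) = d (r * s).
  by rewrite ev_pprod !dl // dm.
split.
  rewrite evB pb evD evM ev_var lf ?rs0 ?leqnn // cl /b /next /= mul1r subrr //.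
by rewrite evB pd evD evM evM pb ev_nat ev_var cb /d /next subrr.
Qed.

Let ev_comb (P : pol * pol) : ev e P.1 = 0 -> ev e P.2 = 0 -> ev e (comb P) = 0.
Proof. by rewrite evB evM => -> ->; rewrite mulr0 subr0. Qed.

Let ev_solved c n k P q : c%:R != 0 :> K -> solved c n k P q -> ev e P = 0 -> ev e q = nth 0 e k.
Proof.
move=> c0 /(ev_eq e) ->; rewrite !evM evB evX ev_nat !ev_var => /eqP.
rewrite mulf_eq0 mulf_eq0 expf_eq0 (negPf c0) (negPf T0) andbF /= subr_eq0.
by move/eqP.
Qed.

Let ev_pdrop n P : peq P (pmul (ppow (pvar 0) n) (pdrop n P)) -> ev e P = 0 -> ev e (pdrop n P) = 0.
Proof.
move=> /(ev_eq e) ->; rewrite evM evX ev_var => /eqP.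
by rewrite mulf_eq0 expf_eq0 (negPf T0) andbF /= => /eqP.
Qed.

(** Invariant of the elimination: the expressions found so far, and the variables still standing for
    unknowns, all take the values of [a]. *)
Let rep qs := forall j, (j < 9)%N -> ev e (nth p0 qs j) = a (nth 0%N idx j).

Let rep0 : rep unknowns.
Proof.
move=> j j9; rewrite (nth_map 0%N) ?size_iota // nth_iota // ev_var.
by rewrite nth_cat -[size env]/5%N ltnNge leq_addr addKn (nth_map 0%N).
Qed.

Let rep_set qs j q : rep qs -> ev e q = a (nth 0%N idx j) -> rep (set_nth p0 qs j q).
Proof. by move=> rq eq k k9; rewrite nth_set_nth /=; case: eqP => [->|_]; rewrite ?eq ?rq. Qed.

Let rep_coefs qs : rep qs -> forall i, (0 < i < 23)%N -> ev e (nth p0 (coefs qs) i) = a i.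
Proof.
have K6 : 6%:R != 0 :> K by rewrite (natrM _ 2 3) mulf_neq0.
move=> rq.
have s6 k v : ev e (pvar k) = x6 v -> ev e (pmul (pnat 6) (pvar k)) = a v.
  by move=> ev_k; rewrite evM ev_nat ev_k mulrC divfK.
have h2 := @s6 1%N 2%N (ev_var _ _).
have h3 := @s6 2%N 3%N (ev_var _ _).
have h7 := @s6 3%N 7%N (ev_var _ _).
case=> // i; rewrite ltnS => /= i22.
have hq j : (j < 9)%N -> ev e (nth p0 qs j) = a (nth 0%N idx j) by apply: rq.
do 22?[case: i i22 => [|i] i22; first by
  rewrite /= ?ev_pprod -?[nth p0 _ _]/(nth p0 qs _) ?ev1 ?a1 // ?h2 ?h3 ?h7 ?hq //=
     -?(am (r := 2) (s := 3)) -?(am (r := 2) (s := 5)) -?(am (r := 3) (s := 4))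
     -?(am (r := 2) (s := 7)) -?(am (r := 3) (s := 5)) -?(am (r := 2) (s := 9))
     -?(am (r := 4) (s := 5)) -?(am (r := 3) (s := 7)) -?(am (r := 2) (s := 11))].
by [].
Qed.

Let rel qs r s : rep qs -> (1 < r)%N -> (1 < s)%N -> (r * s < 23)%N -> coprime r s ->
  ev e (relations (coefs qs) r s).1 = 0 /\ ev e (relations (coefs qs) r s).2 = 0.
Proof.
move=> rq r1 s1 rs crs; apply: ev_relations => // i /andP[i0 irs].
by apply: rep_coefs => //; rewrite i0 (leq_ltn_trans irs).
Qed.

Let K12 : 12%:R != 0 :> K.
Proof. by rewrite (natrM _ 4 3) (natrM _ 2 2) !mulf_neq0. Qed.

Let step qs j c n P q : rep qs -> c%:R != 0 :> K -> (j < 9)%N -> ev e P = 0 ->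
  solved c n (5 + j) P q -> rep (set_nth p0 qs j q).
Proof.
move=> rq c0 j9 P0 sq; apply: rep_set => //; rewrite (ev_solved c0 sq P0).
by rewrite nth_cat -[size env]/5%N ltnNge leq_addr addKn (nth_map 0%N).
Qed.

Let step2 qs j n r s q : rep qs -> (j < 9)%N -> (1 < r)%N -> (1 < s)%N -> (r * s < 23)%N ->
    coprime r s -> solved 12 n (5 + j) (comb (relations (coefs qs) r s)) q ->
    rep (set_nth p0 qs j q).
Proof.
move=> rq j9 r1 s1 rs crs; apply: step => //; apply: ev_comb; exact: proj1 (rel _ _ _ _ _) || exact: proj2 (rel _ _ _ _ _).
Qed.

Let step1 qs j n r s q : rep qs -> (j < 9)%N -> (1 < r)%N -> (1 < s)%N -> (r * s < 23)%N ->
    coprime r s -> solved 2 n (5 + j) (relations (coefs qs) r s).1 q ->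
    rep (set_nth p0 qs j q).
Proof.
by move=> rq j9 r1 s1 rs crs; apply: step => //; case: (rel rq r1 s1 rs crs).
Qed.

Let rep1 : rep qs1.
Proof. refine (@step2 _ 0%N 2%N 2%N 3%N q4 rep0 isT isT isT isT isT solved4). Qed.
Let rep2 : rep qs2.
Proof. refine (@step1 _ 1%N 1%N 2%N 3%N q5 rep1 isT isT isT isT isT solved5). Qed.
Let rep3 : rep qs3.
Proof. refine (@step2 _ 2%N 2%N 2%N 5%N q8 rep2 isT isT isT isT isT solved8). Qed.
Let rep4 : rep qs4.
Proof. refine (@step1 _ 3%N 1%N 2%N 5%N q9 rep3 isT isT isT isT isT solved9). Qed.
Let rep5 : rep qs5.
Proof. refine (@step1 _ 4%N 1%N 3%N 4%N q11 rep4 isT isT isT isT isT solved11). Qed.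
Let rep6 : rep qs6.
Proof. refine (@step1 _ 5%N 1%N 2%N 7%N q13 rep5 isT isT isT isT isT solved13). Qed.
Let rep7 : rep qs7.
Proof. refine (@step2 _ 6%N 2%N 2%N 9%N q16 rep6 isT isT isT isT isT solved16). Qed.
Let rep8 : rep qs8.
Proof. refine (@step1 _ 7%N 1%N 2%N 9%N q17 rep7 isT isT isT isT isT solved17). Qed.
Let rep9 : rep qs9.
Proof. refine (@step1 _ 8%N 1%N 4%N 5%N q19 rep8 isT isT isT isT isT solved19). Qed.

Lemma coefs_eval i : (0 < i < 23)%N -> ev env (nth p0 (coefs qs9) i) = a i.
Proof.
move=> i_23; have i_in : i \in iota 1 22 by rewrite mem_iota; move: i_23; lia.
have cl := allP closed_coefs i i_in.
have := rep_coefs rep9 i_23; rewrite (ev_closed (e := env) (map a idx) cl); exact.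
Qed.

Lemma eqns_vanish i : ev env (nth p0 eqns i) = 0.
Proof.
have [r12a r12b] := rel (r := 3) (s := 4) rep4 isT isT isT isT.
have [r14a r14b] := rel (r := 2) (s := 7) rep5 isT isT isT isT.
have [r15a r15b] := rel (r := 3) (s := 5) rep6 isT isT isT isT.
have [r20a r20b] := rel (r := 4) (s := 5) rep8 isT isT isT isT.
have [r21a r21b] := rel (r := 3) (s := 7) rep9 isT isT isT isT.
have [r22a r22b] := rel (r := 2) (s := 11) rep9 isT isT isT isT.
rewrite -(ev_closed (map a idx)); last first.
  have [i9|i9] := ltnP i (size eqns); last first.
    by rewrite (nth_default _ i9).
  by move/(all_nthP p0): closed_eqns; apply.
case: i => [|i]; first by exact: (ev_pdrop (n := 2) (P := (comb r12)) dropped0 (ev_comb r12a r12b)).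
case: i => [|i]; first by exact: (ev_pdrop (n := 2) (P := (comb r14)) dropped1 (ev_comb r14a r14b)).
case: i => [|i]; first by exact: (ev_pdrop (n := 1) (P := r15.1) dropped2 (r15a)).
case: i => [|i]; first by exact: (ev_pdrop (n := 1) (P := r15.2) dropped3 (r15b)).
case: i => [|i]; first by exact: (ev_pdrop (n := 2) (P := (comb r20)) dropped4 (ev_comb r20a r20b)).
case: i => [|i]; first by exact: (ev_pdrop (n := 1) (P := r21.1) dropped5 (r21a)).
case: i => [|i]; first by exact: (ev_pdrop (n := 1) (P := r21.2) dropped6 (r21b)).
case: i => [|i]; first by exact: (ev_pdrop (n := 1) (P := r22.1) dropped7 (r22a)).
case: i => [|i]; first by exact: (ev_pdrop (n := 1) (P := r22.2) dropped8 (r22b)).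
have -> : nth p0 eqns i.+4.+4.+1 = p0 by apply: nth_nil.
exact: ev0.
Qed.
End Elimination.

End Elimination.

(** * Existence of a valuation ring in which p is not invertible *)

Module Valuation.
Import all_boot all_order all_algebra boolp classical_sets ring.
Import GRing.Theory Num.Theory.
Local Open Scope classical_set_scope.
Local Open Scope ring_scope.
Import Elimination.

Section Subrings.
Variable K : numFieldType.

Definition is_subring (B : set K) :=
  [/\ B 1, forall x y, B x -> B y -> B (x - y) & forall x y, B x -> B y -> B (x * y)].

Definition valuation_subring (p : nat) (B : set K) :=
  [/\ is_subring B, forall z, B z \/ B z^-1 & ~ B (p%:R)^-1].

Section Theory.
Variables (B : set K) (Bring : is_subring B).
Let B1 : B 1. Proof. by case: Bring. Qed.
Let BB x y : B x -> B y -> B (x - y). Proof. by case: Bring => _ + _; apply. Qed.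

Lemma subring0 : B 0. Proof. by rewrite -(subrr 1); apply: BB. Qed.
Lemma subringN x : B x -> B (- x).
Proof. by move=> Bx; rewrite -sub0r; apply: BB => //; apply: subring0. Qed.
Lemma subringD x y : B x -> B y -> B (x + y).
Proof. by move=> Bx By; rewrite -[y]opprK; apply: BB => //; apply: subringN. Qed.
Lemma subringM x y : B x -> B y -> B (x * y). Proof. by case: Bring => _ _; apply. Qed.
Lemma subringX x n : B x -> B (x ^+ n).
Proof. by move=> Bx; elim: n => [|n IH]; rewrite ?expr0 // exprS; apply: subringM. Qed.
Lemma subring_nat n : B n%:R.
Proof. by elim: n => [|n IH]; [exact: subring0|rewrite -natr1; apply: subringD]. Qed.
Lemma subring_sum (I : Type) (r : seq I) (P : pred I) (F : I -> K) :
  (forall i, P i -> B (F i)) -> B (\sum_(i <- r | P i) F i).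
Proof. by move=> BF; elim/big_ind: _ => //; [exact: subring0|exact: subringD]. Qed.
End Theory.

(* Subrings in which p is not invertible; the empty set makes the class
   closed under the union of the empty chain. *)
Let good p (B : set K) := (B = set0) \/ (is_subring B /\ ~ B (p%:R)^-1).

Lemma exists_maximal_subring p : (1 < p)%N ->
  exists B, [/\ is_subring B, ~ B (p%:R)^-1 &
    forall B', is_subring B' -> B `<=` B' -> ~ B' (p%:R)^-1 -> B' = B].
Proof.
move=> p1.
have p0 : p%:R != 0 :> K by rewrite pnatr_eq0 -lt0n ltnW.
have [F FP Ftot|A [[A0|[Ar Ap]] Amax]] := @Zorn_bigcup K (good p).
- have [[X [FX X0]]|nF] := pselect (exists X, F X /\ X <> set0); last first.
    left; rewrite -subset0 => x [X FX Xx]; apply: nF; exists X; split=> //.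
    by move=> X0; rewrite X0 in Xx.
  have Fgood Y x : F Y -> Y x -> is_subring Y /\ ~ Y (p%:R)^-1.
    by move=> FY Yx; case: (FP _ FY) => // Y0; rewrite Y0 in Yx.
  have pair x y : (\bigcup_(X in F) X) x -> (\bigcup_(X in F) X) y ->
      exists2 Y, F Y & Y x /\ Y y.
    move=> [Y FY Yx] [Z FZ Zy]; case: (Ftot _ _ FY FZ) => sub.
      by exists Z => //; split=> //; apply: sub.
    by exists Y => //; split=> //; apply: sub.
  right; split; last by move=> [Y FY Yp]; case: (Fgood _ _ FY Yp).
  split.
  + have /set0P[x Xx] : X != set0 by apply/eqP.
    by exists X => //; case: (Fgood _ _ FX Xx) => -[].
  + move=> x y /pair h /h[Y FY [Yx Yy]]; exists Y => //.
    by case: (Fgood _ _ FY Yx) => -[_ + _] _; apply.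
  + move=> x y /pair h /h[Y FY [Yx Yy]]; exists Y => //.
    by case: (Fgood _ _ FY Yx) => -[_ _ +] _; apply.
(* The image of Z is a good subring, so the empty set is not maximal. *)
- have Zr : is_subring [set (z%:~R : K) | z in [set: int]].
    split; first by exists 1.
      by move=> _ _ [x _ <-] [y _ <-]; exists (x - y) => //; rewrite rmorphB.
    by move=> _ _ [x _ <-] [y _ <-]; exists (x * y) => //; rewrite rmorphM.
  case: (Amax [set (z%:~R : K) | z in [set: int]]).
    rewrite A0; split; first by move=> ? [].
    by move=> sub; case: (sub 1); exists 1.
  right; split=> // -[z _ zp].
  have : (z * p%:Z)%:~R = 1%:~R :> K by rewrite rmorphM /= zp mulVf.
  move/intr_inj/(congr1 absz); rewrite abszM /= => /eqP.
  by rewrite muln_eq1 => /andP[_ /eqP p_1]; rewrite p_1 in p1.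
- exists A; split=> // B' B'r AB' B'p.
  have [//|neq] := pselect (B' = A); case: (Amax B'); last by right.
  by split=> // B'A; apply: neq; rewrite eqEsubset.
Qed.

(** A subring maximal among those without 1/p works. If neither z nor z^-1 lay in it, adjoining
    either would produce 1/p, and two such relations of minimal degree contradict each other. *)
Lemma exists_valuation_subring p : (1 < p)%N ->
  exists B, valuation_subring p B.
Proof.
move=> p1; have [B [Br Bp Bmax]] := exists_maximal_subring p1.
have p0 : p%:R != 0 :> K by rewrite pnatr_eq0 -lt0n ltnW.
have [B1 BB BM] := Br; have BD := subringD Br; have Bs := subring_sum Br.
have Bn n := subring_nat Br n; have BX := subringX Br.
have pV b : 1 = p%:R * b -> B b -> False.
  by move=> e Bb; apply: Bp; rewrite (_ : _^-1 = b) //; apply: (mulfI p0); rewrite mulfV.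
(* Inverting u does not invert p: u^n has the form 1 - p c, so (1/p) u^n in B would give 1/p in B.
   Maximality then puts u^-1 in B. *)
have p1_unit b : B b -> B (1 - p%:R * b)^-1.
  move=> Bb; set u := 1 - p%:R * b.
  have Bu : B u by apply: (BB) => //; apply: (BM).
  have u0 : u != 0.
    by rewrite subr_eq0; apply/eqP => /pV; apply.
  pose B' := [set z | exists n, B (z * u ^+ n)].
  suff <- : B' = B by exists 1%N; rewrite expr1 mulVf.
  apply: Bmax.
  - split; first by exists 0%N; rewrite mulr1.
    + move=> x y [n xn] [m ym]; exists (n + m)%N.
      have -> : (x - y) * u ^+ (n + m) = x * u ^+ n * u ^+ m - y * u ^+ m * u ^+ n.
        by rewrite exprD; ring.
      by apply: (BB); apply: (BM) => //; apply: (BX).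
    + move=> x y [n xn] [m ym]; exists (n + m)%N.
      by rewrite exprD mulrACA; apply: (BM).
  - by move=> z Bz; exists 0%N; rewrite mulr1.
  - move=> [n]; apply: contra_not Bp.
    have: exists2 c, B c & u ^+ n = 1 - p%:R * c.
      elim: n => [|n [c Bc IH]]; first by exists 0; [exact: subring0|rewrite mulr0 subr0].
      exists (b + c - p%:R * (b * c)); last by rewrite exprS IH /u; ring.
      by apply: (BB); [apply: (BD)|apply: (BM) => //; apply: (BM)].
    move=> [c Bc ->]; rewrite mulrBr mulr1 mulrA mulVf // mul1r => Bpc.
    by rewrite -[_^-1](subrK c); apply: (BD).
(* Descent on degrees: the constant term 1 - p g_0 of the relation in z^-1 is a unit, so that
   relation expresses the top power of z through lower ones. *)
have key n m : (m <= n)%N -> forall (z : K) (f g : nat -> K), (forall i, B (f i)) -> (forall i, B (g i)) ->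
    z != 0 -> p%:R * \sum_(i < n.+1) f i * z ^+ i = 1 ->
    p%:R * \sum_(i < m.+1) g i * z ^- i = 1 ->
    exists2 n', (n' < n)%N & exists2 f' : nat -> K, (forall i, B (f' i)) & p%:R * \sum_(i < n'.+1) f' i * z ^+ i = 1.
  move=> mn z f g Bf Bg z0 zf zg.
  case: n => [|n] in mn zf *.
    by exfalso; apply: (pV (f 0%N)) => //; rewrite -[LHS]zf big_ord1 expr0 mulr1.
  set u := (1 - p%:R * g 0%N)^-1.
  have Bu : B u by apply: p1_unit.
  pose h i := if (n.+1 - i <= m)%N then p%:R * u * g (n.+1 - i)%N else 0.
  have zn : z ^+ n.+1 = \sum_(i < n.+1) h i * z ^+ i.
    have u0 : 1 - p%:R * g 0%N != 0.
      by rewrite subr_eq0; apply/eqP => /pV; apply.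
    have zg' : 1 - p%:R * g 0%N = p%:R * \sum_(i < m) g i.+1 * z ^- i.+1.
      by apply/eqP; rewrite subr_eq addrC -[eqbLHS]zg big_ord_recl expr0 invr1 mulr1 mulrDr.
    have -> : z ^+ n.+1 = p%:R * u * \sum_(i < m) g i.+1 * z ^+ (n - i).
      have -> : z ^+ n.+1 = u * (1 - p%:R * g 0%N) * z ^+ n.+1 by rewrite mulVf // mul1r.
      rewrite zg' (mulrA u) (mulrC u) -mulrA; congr (_ * _).
      rewrite mulr_suml; apply: eq_bigr => i _.
      rewrite -mulrA; congr (_ * _).
      have im : (i <= n)%N by rewrite -ltnS (leq_trans (ltn_ord i)).
      by rewrite -{1}(subnK im) -addnS exprD mulrC mulfK // expf_neq0.
    rewrite (big_ord_widen_cond n.+1 predT (fun i => g i.+1 * z ^+ (n - i))) //.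
    rewrite mulr_sumr (reindex_inj rev_ord_inj) /= [RHS]big_mkcond /=.
    rewrite [LHS]big_mkcond; apply: eq_bigr => i _ /=.
    rewrite /h subSS; have -> : (n - (n - i) = i)%N by rewrite subKn // -ltnS.
    have -> : (n.+1 - i = (n - i).+1)%N by rewrite subSn // -ltnS.
    by case: ifP => _; rewrite ?mul0r // mulrA.
  exists n => //; exists (fun i => f i + f n.+1 * h i).
    move=> i; apply: (BD) => //; apply: (BM) => //; rewrite /h; case: ifP => _; last exact: subring0.
    by apply: (BM) => //; apply: (BM).
  rewrite -[RHS]zf [in RHS]big_ord_recr /= zn [f n.+1 * _]mulr_sumr -big_split /=; congr (_ * _).
  by apply: eq_bigr => i _; ring.
exists B; split=> // z.
have [[Bz|nBz]] := (pselect (B z), pselect (B z^-1)); first by left.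
move=> [Bz|nBzi]; first by right.
exfalso.
(* By maximality the ring B[y] contains 1/p; this is a polynomial relation in y. *)
have adj y : ~ B y -> exists n, exists2 f : nat -> K, (forall i, B (f i)) & p%:R * \sum_(i < n.+1) f i * y ^+ i = 1.
  move=> By; pose B' := [set w | exists2 q : {poly K}, (forall i, B q`_i) & w = q.[y]].
  have B'r : is_subring B'.
    split; first by exists 1; rewrite ?hornerC // => i; rewrite coefC; case: eqP => // _; exact: subring0.
      move=> _ _ [q1 b1 ->] [q2 b2 ->]; exists (q1 - q2); rewrite ?hornerE // => i.
      by rewrite coefB; apply: (BB).
    move=> _ _ [q1 b1 ->] [q2 b2 ->]; exists (q1 * q2); rewrite ?hornerM // => i.
    by rewrite coefM; apply: Bs => j _; apply: (BM).
  have [[q qB qp]|B'p] := pselect (B' (p%:R)^-1); last first.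
    case: By; rewrite -(Bmax B') //.
      exists 'X; rewrite ?hornerX // => i; rewrite coefX; case: eqP => // _; exact: subring0.
    move=> w Bw; exists w%:P; rewrite ?hornerC // => i.
    by rewrite coefC; case: eqP => // _; exact: subring0.
  exists (size q), (fun i => q`_i) => //.
  by rewrite -horner_coef_wide ?leqnSn // -qp divff.
have z0 : z != 0 by apply/eqP => z0; apply: nBz; rewrite z0; exact: subring0.
have [n [f Bf zf]] := adj _ nBz; have [m [g Bg zg]] := adj _ nBzi.
(* Induction on n + m; z and z^-1 exchange roles so that the longer relation is always the one
   shortened. *)
move: {2}(n + m).+1 (ltnSn (n + m)) => N.
elim: N => // N IH in z z0 nBz nBzi n m f g Bf Bg zf zg *.
have zgV : p%:R * \sum_(i < m.+1) g i * z ^- i = 1.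
  by rewrite -[RHS]zg; congr (_ * _); apply: eq_bigr => i _; rewrite exprVn.
rewrite ltnS => nmN; have [mn|/ltnW nm] := leqP m n.
  have [n' n'n [f' Bf' zf']] := key _ _ mn _ _ _ Bf Bg z0 zf zgV.
  apply: (IH z z0 nBz nBzi n' m f' g) => //.
  by apply: leq_trans nmN; rewrite ltn_add2r.
have zfV : p%:R * \sum_(i < n.+1) f i * (z^-1) ^- i = 1.
  by rewrite -[RHS]zf; congr (_ * _); apply: eq_bigr => i _; rewrite exprVn invrK.
have [m' m'm [g' Bg' zg']] := key _ _ nm _ _ _ Bg Bf (invr_neq0 z0) zg zfV.
apply: (IH z z0 nBz nBzi n m' f g') => //.
by apply: leq_trans nmN; rewrite ltn_add2l.
Qed.
End Subrings.

End Valuation.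

(** * Identities modulo 7, residues in the valuation ring, and weighted blow-ups *)

Module Certificates.
Import all_boot all_order all_algebra boolp classical_sets ring.
Import GRing.Theory Num.Theory.
Local Open Scope ring_scope.
Import Elimination Valuation.

Definition seven : Z := BinInt.Z.of_nat 7.
Definition pmod : pol -> pol := pmap (fun z => BinInt.Z.modulo z seven).

(* Terms of degree at most d in the first variable. *)
Fixpoint ptrunc (d : nat) (P : pol) : pol :=
  match P with
  | Ring_polynom.PX P i Q =>
      let j := BinPos.Pos.to_nat i in
      if (j <= d)%N then mkPX (ptrunc (d - j) P) i Q else mkPinj BinNums.xH Q
  | _ => P
  end.

Fixpoint ptpow d (P : pol) n := if n is m.+1 then ptrunc d (pmul P (ptpow d P m)) else p1.

(** Truncating after each multiplication avoids expanding powers of the blow-up parameter above [d];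
    the error is a multiple of the power [d.+1]. *)
Fixpoint ptsubst d (l : seq pol) (P : pol) : pol :=
  match P with
  | Ring_polynom.Pc c => PC c
  | Ring_polynom.Pinj j Q => ptsubst d (BinList.jump j l) Q
  | Ring_polynom.PX P i Q =>
      padd (ptrunc d (pmul (ptsubst d l P) (ptpow d (head p0 l) (BinPos.Pos.to_nat i))))
           (ptsubst d (behead l) Q)
  end.

(* A certificate lists, for each polynomial, the terms c x^a y^b .. of its
   multiplier, encoded as c + 7 (a + 32 (b + 32 ..)). *)
Fixpoint pmono (k : nat) (c : Z) (n : BinNums.N) : pol :=
  if k is k'.+1 then
    let: (q, e) := BinNat.N.div_eucl n (BinNat.N.of_nat 32) in
    let R := mkPinj BinNums.xH (pmono k' c q) in
    if e is BinNums.Npos i then mkPX R i p0 else R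
  else PC c.
Definition pterm k (n : BinNums.N) : pol :=
  let: (q, c) := BinNat.N.div_eucl n (BinNat.N.of_nat 7) in pmono k (BinInt.Z.of_N c) q.
Definition pterms k (s : seq BinNums.N) : pol := foldr (fun n P => padd (pterm k n) P) p0 s.
Definition lincomb k (cs : seq (seq BinNums.N)) (Ps : seq pol) : pol :=
  foldr (fun x Q => padd (pmul x.2 (pterms k x.1)) Q) p0 (zip cs Ps).
Definition certifies k cs Ps target := peq (pmod (psub (lincomb k cs Ps) target)) p0.

(** Returns 0 when the division is not exact. The value 0 is always sound as a consequence of the
    equation, and merely useless in a certificate. *)
Definition pdropc d (P : pol) : pol := let Q := pdrop d P in if peq P (pmul (ppow (pvar 0%N) d) Q) then Q else p0.
(* The coefficient of the d-th power of the first variable, when it is the lowest one. *)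
Definition leading d S P := pdropc d (ptsubst d S P).
Definition reduced S P := pmod (psubst S P).

Section Valuation.
Variables (K : numClosedFieldType) (B : set K).
Hypothesis Bval : valuation_subring 7 B.

(** The maximal ideal as the set of nonunits. Zero is listed separately because 0^-1 = 0 belongs to
    [B]. *)
Definition maxi z := z = 0 \/ ~ B z^-1.
Let Br : is_subring B. Proof. by case: Bval. Qed.
Let BvV z : B z \/ B z^-1. Proof. by case: Bval => _ + _; apply. Qed.

Lemma maxiB z : maxi z -> B z.
Proof. by case=> [->|nB]; [exact: subring0|case: (BvV z)]. Qed.
Lemma maxi0 : maxi 0. Proof. by left. Qed.
Lemma maxi1 : ~ maxi 1.
Proof. by case=> [/eqP|]; rewrite ?oner_eq0 // invr1; apply; case: Br. Qed.
Lemma maxiM z y : B z -> maxi y -> maxi (z * y).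
Proof.
move=> Bz [->|nB]; first by rewrite mulr0; left.
have [->|z0] := eqVneq z 0; first by rewrite mul0r; left.
right; apply: contra_not nB => Bzy.
by rewrite -(mulKf z0 y^-1) mulrCA -invfM; apply: subringM.
Qed.
Lemma maxiMr z y : maxi z -> B y -> maxi (z * y).
Proof. by move=> mz By; rewrite mulrC; apply: maxiM. Qed.
Lemma unitP z : B z -> maxi z \/ [/\ z != 0, B z^-1 & ~ maxi z].
Proof.
move=> Bz; have [z0|z0] := eqVneq z 0; first by left; left.
have [Bz'|nB] := pselect (B z^-1); last by left; right.
by right; split=> // -[/eqP|//]; rewrite (negPf z0).
Qed.
Lemma maxiD z y : maxi z -> maxi y -> maxi (z + y).
Proof.
move=> mz my; have [z0|z0] := eqVneq z 0; first by rewrite z0 add0r.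
have [y0|y0] := eqVneq y 0; first by rewrite y0 addr0.
case: (BvV (y / z)) => h.
  have -> : z + y = (1 + y / z) * z by rewrite mulrDl mul1r divfK.
  by apply: maxiM => //; apply: subringD => //; case: Br.
have -> : z + y = (1 + z / y) * y by rewrite mulrDl mul1r divfK // addrC.
by apply: maxiM => //; apply: subringD; [|case: Br|rewrite -[z / y]invrK invf_div].
Qed.
Lemma maxiN z : maxi z -> maxi (- z).
Proof. by move=> mz; rewrite -mulN1r; apply: maxiM => //; apply: subringN => //; case: Br. Qed.
Lemma maxiBB z y : maxi z -> maxi y -> maxi (z - y).
Proof. by move=> mz my; apply: maxiD => //; apply: maxiN. Qed.
Lemma maxi_prime z y : B z -> B y -> maxi (z * y) -> maxi z \/ maxi y.
Proof.
move=> Bz By mzy; case: (unitP Bz) => [|[z0 Bz' _]]; first by left.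
by right; rewrite -(mulKf z0 y); apply: maxiM.
Qed.
Lemma maxi_pow z n : B z -> maxi (z ^+ n) -> maxi z.
Proof.
move=> Bz; elim: n => [/maxi1 //|n IH]; rewrite exprS.
by case/maxi_prime => //; apply: subringX.
Qed.
Lemma maxi7 : maxi 7%:R. Proof. by right; case: Bval. Qed.

Lemma B_zv c : B (zv c).
Proof.
case: c => [|p|p]; first exact: subring0.
  by rewrite -(Znat.positive_nat_Z p) zv_nat; apply: subring_nat.
have -> : BinNums.Zneg p = BinInt.Z.opp (BinNums.Zpos p) by [].
by rewrite zvN -(Znat.positive_nat_Z p) zv_nat; apply: subringN => //; apply: subring_nat.
Qed.

Definition integral (e : seq K) := forall i, B (nth 0 e i).
Lemma integral_nil : integral [::].
Proof. by move=> i; rewrite nth_nil; apply: subring0. Qed.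
Lemma integral_cons x e : B x -> integral e -> integral (x :: e).
Proof. by move=> Bx Be [|i] //=; apply: Be. Qed.
Lemma integral_drop n e : integral e -> integral (drop n e).
Proof. by move=> Be i; rewrite nth_drop. Qed.

Lemma B_ev e P : integral e -> B (ev e P).
Proof.
elim: P e => [c|j Q IH|P IHP i Q IHQ] e Be; first exact: B_zv.
  by rewrite ev_Pinj jumpE; apply: IH; apply: integral_drop.
rewrite ev_PX; apply: subringD => //.
  by apply: subringM => //; [apply: IHP|apply: subringX => //; rewrite -nth0; apply: Be].
by rewrite -drop1; apply: IHQ; apply: integral_drop.
Qed.

Lemma ev_pmod e P : integral e -> maxi (ev e P - ev e (pmod P)).
Proof.
elim: P e => [c|j Q IH|P IHP i Q IHQ] e Be.
- rewrite !evC {1}(BinInt.Z.div_mod c seven) // zvD zvM addrK.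
  by apply: maxiMr; [rewrite zv_nat; exact: maxi7|exact: B_zv].
- by rewrite ev_Pinj ev_mkPinj !jumpE; apply: IH; apply: integral_drop.
- rewrite ev_PX ev_mkPX opprD addrACA -mulrBl; apply: maxiD.
    by apply: maxiMr; [apply: IHP|apply: subringX => //; rewrite -nth0; apply: Be].
  by rewrite -drop1; apply: IHQ; apply: integral_drop.
Qed.

Lemma ev_congr e e' P : integral e -> integral e' ->
  (forall i, maxi (nth 0 e i - nth 0 e' i)) -> maxi (ev e P - ev e' P).
Proof.
elim: P e e' => [c|j Q IH|P IHP i Q IHQ] e e' Be Be' ee'.
- by rewrite subrr; left.
- rewrite !ev_Pinj !jumpE; apply: IH; try exact: integral_drop.
  by move=> i; rewrite !nth_drop.
- rewrite !ev_PX opprD addrACA; apply: maxiD; last first.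
    rewrite -!drop1; apply: IHQ; try exact: integral_drop.
    by move=> k; rewrite !nth_drop.
  rewrite -!nth0; set n := BinPos.Pos.to_nat i.
  have -> : ev e P * (nth 0 e 0) ^+ n - ev e' P * (nth 0 e' 0) ^+ n =
    (ev e P - ev e' P) * (nth 0 e 0) ^+ n + ev e' P * ((nth 0 e 0) ^+ n - (nth 0 e' 0) ^+ n).
    by ring.
  apply: maxiD; first by apply: maxiMr; [apply: IHP|apply: subringX].
  apply: maxiM; first exact: B_ev.
  rewrite subrXX; apply: maxiMr; first exact: ee'.
  by apply: subring_sum => // k _; apply: subringM => //; apply: subringX.
Qed.

Lemma ev_trunc d e P : integral e -> exists2 r, B r &
  ev e P = ev e (ptrunc d P) + head 0 e ^+ d.+1 * r.
Proof.
move=> Be; have Bh : B (head 0 e) by rewrite -nth0; apply: Be.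
elim: P d => [c|j Q IH|P IHP i Q IHQ] d.
- by exists 0; rewrite ?mulr0 ?addr0 //; exact: subring0.
- by exists 0; rewrite ?mulr0 ?addr0 //; exact: subring0.
- rewrite /=; case: leqP => [jd|dj]; last first.
    exists (ev e P * head 0 e ^+ (BinPos.Pos.to_nat i - d.+1)).
      by apply: subringM => //; [exact: B_ev|exact: subringX].
    rewrite ev_PX ev_mkPinj jumpE drop1 addrC mulrCA -exprD subnKC //.
  have [r Br' Pr] := IHP (d - BinPos.Pos.to_nat i)%N; exists r => //.
  rewrite ev_mkPX ev_PX Pr mulrDl addrAC; congr (_ + _).
  by rewrite -mulrA mulrCA -exprD mulrC -subSn // subnK // leqW.
Qed.

Lemma ev_tpow d e P n : integral e -> exists2 r, B r &
  ev e P ^+ n = ev e (ptpow d P n) + head 0 e ^+ d.+1 * r.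
Proof.
move=> Be; elim: n => [|n [r Br1 IH]].
  by exists 0; rewrite ?mulr0 ?addr0 ?expr0 //; exact: subring0.
have [s Bs Es] := ev_trunc d (pmul P (ptpow d P n)) Be.
exists (s + ev e P * r).
  by apply: subringD => //; apply: subringM => //; exact: B_ev.
rewrite exprS IH mulrDr /= -evM Es; ring.
Qed.

Lemma ev_tsubst d e l P : integral e -> exists2 r, B r &
  ev (map (ev e) l) P = ev e (ptsubst d l P) + head 0 e ^+ d.+1 * r.
Proof.
move=> Be; elim: P l => [c|j Q IH|P IHP i Q IHQ] l /=.
- by exists 0; rewrite ?mulr0 ?addr0 //; exact: subring0.
- by rewrite ev_Pinj jumpE -map_drop -jumpE; apply: IH.
- have [r1 B1 E1] := IHP l; have [r2 B2 E2] := IHQ (behead l).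
  have [r3 B3 E3] := ev_tpow d (head p0 l) (BinPos.Pos.to_nat i) Be.
  set R := pmul _ _; have [r4 B4 E4] := ev_trunc d R Be.
  set h := head 0 e in E1 E2 E3 E4 *; set n := BinPos.Pos.to_nat i in E3 R E4 *.
  exists (r4 + r1 * ev e (head p0 l) ^+ n + ev e (ptsubst d l P) * r3 + r2).
    apply: subringD => //; apply: subringD => //; last first.
      by apply: subringM => //; exact: B_ev.
    by apply: subringD => //; apply: subringM => //; apply: subringX => //; exact: B_ev.
  rewrite ev_PX evD behead_map E2 E1.
  have -> : head 0 (map (ev e) l) = ev e (head p0 l) by case: (l).
  rewrite mulrDl {1}E3 mulrDr -evM -/R E4; ring.
Qed.

Lemma ev_pdropc d (e : seq K) P : head 0 e != 0 -> ev e P = 0 -> ev e (pdropc d P) = 0.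
Proof.
move=> l0 P0; rewrite /pdropc; case: ifP => [/(ev_eq e) PQ|_]; last exact: ev0.
move: P0; rewrite PQ evM evX ev_var nth0 => /eqP.
by rewrite mulf_eq0 expf_eq0 (negPf l0) andbF /= => /eqP.
Qed.

(** Dividing by l^d leaves the leading form plus l times an integral error, and l is in the maximal
    ideal. *)
Lemma maxi_leading d e S P : integral e -> head 0 e != 0 -> maxi (head 0 e) ->
  ev (map (ev e) S) P = 0 -> maxi (ev e (leading d S P)).
Proof.
move=> Be l0 ml; have [r Br1 ->] := ev_tsubst d S P Be.
rewrite /leading /pdropc; case: ifP => [/(ev_eq e) PQ|_ _]; last first.
  by rewrite ev0; exact: maxi0.
rewrite {1}PQ evM evX ev_var nth0 exprSr -mulrA -mulrDr => /eqP.
rewrite mulf_eq0 expf_eq0 (negPf l0) andbF /= addr_eq0 => /eqP ->.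
by apply: maxiN; apply: maxiMr.
Qed.

(** [S] describes the residues of [z] as polynomials in fewer parameters [e]; substituting [S] is
    how coordinates already known modulo the maximal ideal are removed. *)
Definition agrees z e S := forall i, maxi (nth 0 z i - ev e (nth p0 S i)).
Lemma agrees_nil e : agrees [::] e [::].
Proof. by move=> i; rewrite !nth_nil ev0 subrr; left. Qed.
Lemma agrees_cons x s z e S : maxi (x - ev e s) -> agrees z e S -> agrees (x :: z) e (s :: S).
Proof. by move=> h a [|i] //=; apply: a. Qed.

Lemma maxi_reduced z e S P : integral z -> integral e -> agrees z e S ->
  maxi (ev z P) -> maxi (ev e (reduced S P)).
Proof.
move=> Bz Be a zP; rewrite /reduced.
have := ev_pmod (psubst S P) Be; rewrite ev_subst.
have BS : integral (map (ev e) S).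
  move=> i; have [iS|iS] := ltnP i (size S); last by rewrite nth_default ?size_map //; exact: subring0.
  by rewrite (nth_map p0) //; exact: B_ev.
have zS : maxi (ev z P - ev (map (ev e) S) P).
  apply: ev_congr => // i; have := a i.
  have [iS|iS] := ltnP i (size S); first by rewrite (nth_map p0).
  by rewrite (nth_default p0 iS) ev0 [nth 0 (map _ _) i]nth_default ?size_map.
move=> h; have := maxiBB zP (maxiD zS h).
by rewrite !subrKA subKr; apply.
Qed.

Definition all_maxi e Ps := forall i, maxi (ev e (nth p0 Ps i)).
Lemma all_maxi_map z e (f : pol -> pol) Ps : f p0 = p0 ->
  (forall P, maxi (ev z P) -> maxi (ev e (f P))) -> all_maxi z Ps -> all_maxi e (map f Ps).
Proof.
move=> f0 h a i; have [iP|iP] := ltnP i (size Ps); last first.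
  by rewrite nth_default ?size_map // ev0; exact: maxi0.
by rewrite (nth_map p0) //; apply: h.
Qed.

(** Both an integral multiple of a small value and a multiple of 7 are small, so an identity modulo
    7 suffices. *)
Lemma certified k cs e Ps target : integral e -> certifies k cs Ps target ->
  all_maxi e Ps -> maxi (ev e target).
Proof.
move=> Be cert a; have c : maxi (ev e (lincomb k cs Ps)).
  rewrite /lincomb; elim: Ps cs a {cert} => [|P Ps IH] [|h cs] a /=; try exact: maxi0.
  rewrite evD evM; apply: maxiD; last by apply: IH => i; apply: (a i.+1).
  by apply: maxiMr; [exact: (a 0%N)|exact: B_ev].
have := ev_pmod (psub (lincomb k cs Ps) target) Be.
rewrite (ev_eq e cert) ev0 subr0 evB => h.
by have := maxiBB c h; rewrite subKr.
Qed.

(* Every valuation is a maximum over finitely many elements. *)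
Lemma exists_dominant (zs : seq K) : has (fun z => z != 0) zs ->
  exists k, [/\ (k < size zs)%N, nth 0 zs k != 0 & forall i, B (nth 0 zs i / nth 0 zs k)].
Proof.
elim: zs => // x zs IH /=; have [x0|x0] /= := eqVneq x 0.
  move=> /IH[k [ks k0 kB]]; exists k.+1; split=> //; case=> [|i] //=.
  by rewrite x0 mul0r; exact: subring0.
move=> _; have [/IH[k [ks k0 kB]]|/hasPn h] := boolP (has (fun z => z != 0) zs).
  case: (BvV (x / nth 0 zs k)) => h; first by exists k.+1; split=> //; case=> [|i] /=.
  exists 0%N; split=> //; case=> [|i] /=; first by rewrite divff //; case: Br.
  have -> : nth 0 zs i / x = nth 0 zs i / nth 0 zs k * (x / nth 0 zs k)^-1.
    by rewrite invf_div mulrA divfK.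
  exact: subringM.
exists 0%N; split=> //; case=> [|i] /=; first by rewrite divff //; case: Br.
have -> : nth 0 zs i = 0; last by rewrite mul0r; exact: subring0.
have [iz|iz] := ltnP i (size zs); last by rewrite nth_default.
by apply/eqP; rewrite -[_ == _]negbK; apply: h; rewrite mem_nth.
Qed.

(* Weighted blow-up of the origin. *)
Lemma blowup (zs : seq K) (ws : seq nat) : size ws = size zs -> all (leq 1) ws ->
  has (fun z => z != 0) zs -> exists l us, [/\ l != 0, size us = size zs,
    forall i, nth 0 zs i = l ^+ nth 0%N ws i * nth 0 us i, integral us &
    exists2 k, (k < size zs)%N & nth 0 us k = 1].
Proof.
(* Taking a root of order the weight makes the coordinates comparable; the dominant root is the
   parameter [l]. This step needs an algebraically closed field. *)
move=> sw w1 z0; pose rho := [seq p.1.-root p.2 | p <- zip ws zs].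
have srho : size rho = size zs by rewrite size_map size_zip sw minnn.
have nrho i : (i < size zs)%N -> nth 0 rho i = (nth 0%N ws i).-root (nth 0 zs i).
  by move=> iz; rewrite (nth_map (0%N, 0)) ?size_zip ?sw ?minnn // nth_zip.
have wpos i : (i < size zs)%N -> (0 < nth 0%N ws i)%N.
  by move=> iz; move/(all_nthP 0%N): w1; apply; rewrite sw.
have rhoK i : (i < size zs)%N -> nth 0 rho i ^+ nth 0%N ws i = nth 0 zs i.
  by move=> iz; rewrite nrho // rootCK // wpos.
have /exists_dominant[k [kz k0 kB]] : has (fun z => z != 0) rho.
  case/hasP: z0 => z /(nthP 0)[i iz <-] zi; apply/hasP; exists (nth 0 rho i).
    by rewrite mem_nth // srho.
  by rewrite nrho // rootC_eq0 // wpos.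
rewrite srho in kz.
exists (nth 0 rho k), [seq (p.2 / nth 0 rho k) ^+ p.1 | p <- zip ws rho].
have nu i : (i < size zs)%N -> nth 0 [seq (p.2 / nth 0 rho k) ^+ p.1 | p <- zip ws rho] i =
    (nth 0 rho i / nth 0 rho k) ^+ nth 0%N ws i.
  move=> iz; rewrite (nth_map (0%N, 0)) ?size_zip ?srho ?sw ?minnn //.
  by rewrite nth_zip ?srho.
split=> //.
- by rewrite size_map size_zip srho sw minnn.
- move=> i; have [iz|iz] := ltnP i (size zs).
    by rewrite nu // exprMn mulrCA exprVn divff ?expf_neq0 // mulr1 rhoK.
  by rewrite nth_default // [X in _ = _ * X]nth_default ?mulr0 // size_map size_zip srho sw minnn.
- move=> i; have [iz|iz] := ltnP i (size zs).
    by rewrite nu //; apply: subringX.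
  by rewrite nth_default ?size_map ?size_zip ?srho ?sw ?minnn //; exact: subring0.
- by exists k => //; rewrite nu // divff // expr1n.
Qed.

Lemma maxi_root z n : (0 < n)%N -> maxi (z ^+ n) -> maxi z.
Proof.
move=> n0 mz; case: (BvV z) => [Bz|Bz']; first exact: maxi_pow mz.
have [z0|z0] := eqVneq z 0; first by rewrite z0; exact: maxi0.
case: maxi1; rewrite -(divff (expf_neq0 n z0)).
by apply: maxiMr => //; rewrite -exprVn; apply: subringX.
Qed.

Lemma blowup_maxi (zs : seq K) (ws : seq nat) : size ws = size zs -> all (leq 1) ws ->
  has (fun z => z != 0) zs -> (forall i, maxi (nth 0 zs i)) -> exists l us, [/\ l != 0, maxi l, size us = size zs,
    forall i, nth 0 zs i = l ^+ nth 0%N ws i * nth 0 us i & integral us /\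
    exists2 k, (k < size zs)%N & nth 0 us k = 1].
Proof.
move=> sw w1 z0 mz; have [l [us [l0 su zu Bu [k kz uk]]]] := blowup sw w1 z0.
exists l, us; split=> //; last by split=> //; exists k.
have := mz k; rewrite zu uk mulr1; apply: maxi_root.
by move/(all_nthP 0%N): w1; apply; rewrite sw.
Qed.

Lemma unit_nat n : coprime 7 n -> B (n%:R)^-1.
Proof.
move=> cn; have Bn : B n%:R by exact: subring_nat.
case: (unitP Bn) => [mn|[] //]; case: maxi1.
have n0 : (0 < n)%N by case: n cn {Bn mn}.
have g1 : gcdn n 7 = 1%N by rewrite gcdnC; apply/eqP.
have [u _] := Bezoutl 7 n0; rewrite g1 => /dvdnP[q qE].
have -> : 1 = q%:R * n%:R - u%:R * 7%:R :> K by rewrite -!natrM -qE natrD addrK.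
by apply: maxiBB; apply: maxiM; rewrite ?maxi7 //; exact: subring_nat || exact: maxi7.
Qed.
End Valuation.

End Certificates.

(** * Multipliers of the identities modulo 7, and expansions near one of the points with C = 0 *)

Module Data.
Import BinNums BinNat all_boot.
Local Open Scope N_scope.
Import Elimination Valuation Certificates.

Notation certificate := (seq (seq BinNums.N)).
Local Open Scope N_scope.
Definition cert_tinf_y : certificate :=
  [:: [:: 47; 52; 67; 71; 257; 260; 269; 278; 283; 293; 295; 465; 473; 485; 501; 682; 689; 697; 702;
    718; 902; 905; 913; 922; 925; 1121; 1128; 1138; 1345; 1357; 7184; 7204; 7213; 7397; 7410; 7419;
    7620; 7624; 7638; 14342; 14345];
[:: 34; 36; 46; 50; 60; 67; 71; 78; 244; 250; 258; 261; 268; 279; 281; 290; 453; 459; 467; 472; 480;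
    491; 500; 675; 682; 692; 697; 703; 709; 902; 907; 916; 918; 1121; 1131; 7171; 7178; 7183; 7194;
    7197; 7398; 7401; 7408; 7418; 7627];
[:: 23; 30; 37; 45; 50; 62; 232; 244; 246; 258; 260; 279; 449; 456; 467; 473; 485; 699; 897; 908;
    7173; 7177; 7185; 7191; 7395; 7403];
[:: 40; 48; 51; 59; 64; 250; 253; 264; 267; 279; 458; 464; 473; 478; 488; 681; 688; 694; 902; 908;
    7173; 7181; 7184; 7192; 7404];
[:: 13; 22; 34; 38; 225; 236; 244; 247; 450];
[:: 3; 12; 22; 227; 232];
[:: 2; 19; 26; 226; 237];
[:: 5; 12; 16; 228];
[:: 4; 11; 20; 229]].
Definition cert_tinf_w : certificate :=
  [:: [:: 29; 40; 48; 233];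
[:: 11; 18; 22; 32];
[:: 6; 11];
[:: 2; 9; 22]].
Definition cert_tinf_x : certificate :=
  [:: [:: 11; 19; 26];
[::];
[::];
[:: 2]].
Definition cert_x0_y : certificate :=
  [:: [:: 25; 232; 241; 7183; 7397; 7405; 14346; 14351; 14362; 14563; 21505; 21514; 21523; 28673;
    35842];
[:: 16; 24; 29; 37; 227; 233; 239; 7180; 7184; 7393; 14340; 14344; 14351; 14362; 14565; 21520;
    28673; 28681; 35844];
[:: 20; 23; 230; 7181; 7187; 14341; 21509];
[:: 16; 24; 230; 7186; 14338; 21510];
[:: 4; 12; 7174];
[:: 4]].
Definition cert_x00_w : certificate :=
  [:: [:: 2];
[:: 4]].
Definition cert_x00_c : certificate :=
  [:: [::];
[:: 2]].
Definition cert_x03_w : certificate :=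
  [:: [:: 4; 227; 449; 678];
[:: 1; 11; 229; 452; 677];
[:: 4; 225];
[:: 4; 225]].
Definition cert_x03_c : certificate :=
  [:: [:: 5];
[:: 6];
[::];
[:: 4]].
Definition cert_t0_y : certificate :=
  [:: [:: 4; 19; 27; 225; 232; 453; 459; 7180; 7184; 7191; 7397; 7404; 7407; 7620; 14342; 14349;
    14353; 14361; 14561; 14571; 14577; 14787; 21513; 21520; 21733; 21741; 28677; 28680; 28688;
    28897; 28906; 35845; 35856; 36065; 43011; 43018; 50186; 57345];
[:: 19; 37; 48; 51; 229; 235; 240; 248; 256; 263; 454; 464; 7171; 7176; 7187; 7194; 7198; 7394;
    7404; 7411; 7417; 7617; 7624; 14355; 14566; 14570; 14577; 14584; 14788; 21505; 21514; 21519;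
    21526; 21733; 21737; 21747; 28678; 28682; 28691; 28699; 28703; 28897; 28909; 35842; 35853;
    35857; 36070; 43010; 43020; 50177; 50189; 57348];
[::];
[:: 5; 19; 23; 34; 38; 46; 229; 232; 242; 247; 7180; 7185; 7201; 7205; 7398; 7404; 7411; 14340;
    14349; 14356; 14365; 14561; 14570; 21513; 21519; 21530; 28676; 28685; 35841; 35853];
[:: 1; 8; 16; 30; 225; 232; 7174; 7178; 7183; 7191; 7395; 14338; 14347; 21505; 21513; 28674];
[::];
[:: 5; 11; 19; 26; 7174; 7178; 14338; 14348; 21510];
[::];
[:: 1; 10; 15; 7173; 7177; 14341]].
Definition cert_t0_w : certificate :=
  [:: [:: 1; 10; 227; 453; 675; 899];
[:: 2; 229; 236; 451; 461; 676; 901];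
[::];
[:: 12; 450; 673]].
Definition cert_t0_c : certificate :=
  [:: [:: 3];
[:: 4; 8];
[::];
[:: 10]].
Definition cert_l1_c1 : certificate :=
  [:: [:: 4; 8; 20; 228; 234; 239; 450; 460; 677; 680; 687; 901; 905; 914; 7396; 7404; 7412; 7617;
    7625; 7633; 14337; 14347; 14356; 14562; 14568; 14578; 21508; 21733];
[:: 3; 225; 676; 1126; 7174; 7394; 7618; 7845; 8066; 14341; 14786];
[:: 5; 11; 19; 22; 227; 234; 242; 251; 451; 467; 475; 675; 898; 1123; 7174; 7178; 7193; 7397; 7404;
    7411; 7419; 7845; 8069; 14338; 14562; 14788];
[:: 5; 8; 15; 24; 226; 235; 244; 249; 454; 460; 473; 674; 681; 689; 900; 907; 914; 1121; 1130; 1136;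
    1347; 1574; 7169; 7181; 7194; 7397; 7403; 7407; 7417; 7626; 7632; 7843; 7849; 7859; 8068; 14344;
    14790];
[:: 6; 13; 15; 227; 233; 242; 7172; 7178; 7188];
[:: 2; 7169];
[:: 6; 13; 17; 227; 450; 676; 7174; 7178; 7393];
[:: 1; 10; 16; 24; 228; 235; 244; 452; 458; 676; 7174; 7179]].
Definition cert_l1_w : certificate :=
  [:: [:: 1126];
[::];
[:: 677; 7169];
[:: 677; 7172];
[::];
[:: 6]].
Definition cert_l1_y : certificate :=
  [:: [::];
[::];
[::];
[:: 2]].
Definition cert_l2_c1 : certificate :=
  [:: [:: 2; 11; 16; 23; 230; 232; 244];
[:: 5; 12; 17; 23; 228; 234; 242];
[::];
[:: 4; 10; 18]].
Definition cert_l2_w : certificate :=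
  [:: [::];
[::];
[::];
[:: 25];
[:: 10];
[:: 5]].
Definition cert_l2_y : certificate :=
  [:: [::];
[:: 4]].
Definition cert_m_x : certificate :=
  [:: [:: 25; 34; 39; 46; 244; 249; 272; 460; 466; 472; 478; 676; 685; 691; 698; 703; 900; 904; 915;
    1123];
[:: 18; 24; 32; 41; 46; 51; 62; 230; 236; 251; 262; 267; 449; 461; 465; 674; 684; 689];
[:: 6; 10; 15; 26; 29; 232; 454];
[:: 2; 9; 17; 225];
[:: 6; 8; 18; 229];
[:: 5; 10];
[:: 8];
[:: 19; 24; 37; 226; 242; 248; 253; 451; 457; 466];
[:: 3; 12];
[::];
[::];
[::];
[::];
[:: 5];
[::];
[::];
[::];
[::];
[:: 3; 10; 19; 30; 41; 225; 232; 242; 251; 257; 452; 463; 678];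
[:: 3; 9; 19; 23; 34; 225; 234; 241; 450];
[:: 4; 9; 20];
[:: 3; 13; 19]].
Definition cert_m_c : certificate :=
  [:: [:: 13];
[::];
[::];
[::];
[::];
[::];
[::];
[::];
[::];
[::];
[::];
[::];
[::];
[::];
[::];
[::];
[::];
[::];
[:: 6]].
Definition cert_m_w : certificate :=
  [:: [::];
[:: 1]].
Definition cert_m_y : certificate :=
  [:: [:: 51; 58; 65; 265; 270; 276; 286; 290; 482; 484; 492; 499; 507; 709; 723; 731; 925; 934;
    944; 950; 1145; 1153; 1157; 1171; 1367; 1373; 1385; 1391; 1591; 1602; 1604; 1613; 1809; 1815;
    1832; 2038; 2049; 2258; 2265; 2270; 2473; 2484; 2494; 2704; 2924; 2936; 3140; 3147; 3154; 3365;
    3377; 3597; 3812; 3818; 4033; 4259; 7206; 7213; 7219; 7227; 7424; 7435; 7452; 7641; 7650; 7653;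
    7659; 7669; 7867; 7872; 7880; 7886; 7894; 8090; 8096; 8103; 8111; 8305; 8311; 8322; 8327; 8333;
    8532; 8535; 8542; 8550; 8754; 8763; 8767; 8772; 8972; 8976; 8986; 8993; 9197; 9218; 9427; 9435;
    9635; 9644; 9649; 9655; 9859; 9866; 9871; 10085; 10092; 10098; 10308; 10317; 10533; 10537;
    10753; 10979; 14375; 14383; 14390; 14583; 14589; 14603; 14612; 14802; 14807; 14813; 14824;
    14832; 15033; 15042; 15056; 15251; 15254; 15262; 15269; 15468; 15474; 15479; 15486; 15496;
    15689; 15699; 15707; 15709; 15913; 15923; 15927; 15934; 16133; 16153; 16354; 16364; 16367;
    16378; 16580; 16585; 16594; 16806; 16809; 16818; 17029; 17032; 17254; 17260; 17475; 21530;
    21538; 21543; 21548; 21748; 21755; 21765; 21773; 21967; 21974; 21982; 21988; 22185; 22191;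
    22200; 22217; 22420; 22426; 22433; 22637; 22648; 22658; 22849; 22859; 22870; 23075; 23085;
    23091; 23298; 23522; 23533; 23540; 23746; 23756; 23970; 23979; 24195; 28689; 28695; 28704;
    28712; 28906; 28922; 28927; 29129; 29136; 29146; 29149; 29353; 29368; 29378; 29569; 29578;
    29583; 29591; 29798; 29802; 29808; 30017; 30029; 30035; 30245; 30248; 30469; 30472; 30691;
    30697; 30918; 35848; 35862; 36072; 36080; 36089; 36094; 36290; 36296; 36305; 36310; 36520;
    36531; 36534; 36745; 36755; 36964; 36973; 36980; 37190; 37411; 37418; 37634; 37862; 43020;
    43034; 43234; 43243; 43248; 43257; 43461; 43468; 43474; 43688; 43695; 43909; 44355; 50177;
    50185; 50195; 50402; 50412; 50417; 50630; 50633; 51301; 57346; 57356; 57573; 57576; 57794;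
    58021; 64516; 64742];
[:: 46; 50; 256; 277; 485; 492; 499; 711; 716; 723; 929; 935; 940; 1143; 1150; 1157; 1166; 1369;
    1377; 1585; 1607; 1807; 1825; 2035; 2041; 2048; 2251; 2258; 2266; 2475; 2479; 2487; 2701; 2914;
    2924; 3141; 3148; 3364; 3589; 7206; 7213; 7432; 7438; 7643; 7648; 7653; 7660; 7867; 7870; 7880;
    7885; 8081; 8091; 8093; 8105; 8305; 8310; 8322; 8326; 8536; 8546; 8749; 8752; 8762; 8765; 8978;
    9202; 9208; 9409; 9421; 9428; 9633; 9644; 9858; 9867; 10085; 10310; 10534; 14359; 14369; 14375;
    14585; 14598; 14802; 14807; 14814; 14821; 15025; 15033; 15040; 15044; 15259; 15261; 15466;
    15473; 15481; 15486; 15697; 15704; 15912; 15919; 15927; 16132; 16141; 16146; 16353; 16364;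
    16367; 16578; 16589; 16805; 16808; 17026; 17254; 21519; 21526; 21535; 21743; 21751; 21759;
    21967; 21979; 21982; 22187; 22200; 22209; 22408; 22420; 22422; 22634; 22646; 22851; 22859;
    23073; 23083; 23091; 23298; 23304; 23525; 23532; 23974; 28689; 28698; 28904; 28916; 29128;
    29136; 29147; 29352; 29362; 29571; 29587; 29796; 29805; 29809; 30244; 30466; 30690; 35851;
    35860; 36076; 36289; 36298; 36304; 36521; 36530; 36737; 36746; 36965; 36970; 43237; 43457;
    43685; 43688; 43910; 44132; 50180; 50402; 50627; 50853];
[:: 34; 258; 262; 481; 485; 696; 702; 711; 922; 927; 1145; 1360; 1587; 1592; 2029; 2034; 2252; 2693;
    2915; 7201; 7638; 7858; 7867; 8082; 8086; 8313; 8522; 8530; 8748; 8754; 8973; 9189; 9193; 9635;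
    14362; 14580; 14587; 14799; 14807; 15025; 15252; 15468; 15476; 15689; 15909; 15915; 16133;
    16356; 21747; 21967; 22195; 22411; 22626; 22852; 23073; 28683; 28908; 29129; 29349; 29352;
    29571; 29797; 36070; 36294; 36517];
[:: 32; 248; 253; 472; 477; 692; 697; 703; 913; 919; 1137; 1146; 1354; 1580; 1588; 1805; 2026; 2246;
    2466; 7192; 7409; 7415; 7641; 7856; 7867; 8082; 8300; 8306; 8523; 8740; 8747; 8961; 9190; 14353;
    14577; 14796; 15019; 15027; 15240; 15462; 15468; 15682; 15909; 21514; 21736; 21962; 22188;
    22404; 22629; 28899; 29123; 29348];
[:: 29; 256; 474; 698; 703; 920; 1135; 1142; 1362; 1583; 2025; 2470; 7193; 7419; 7636; 7638; 7858;
    7863; 8082; 8298; 8308; 8521; 8746; 8963; 9188; 14352; 14578; 14804; 15018; 15023; 15241; 15469;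
    15684; 15910; 21737; 22189; 22402; 22629; 29125; 29348];
[:: 23; 467; 692; 695; 915; 919; 1129; 1139; 1352; 1363; 1793; 1801; 2018; 2245; 7184; 7633; 7851;
    7857; 8074; 8082; 8297; 8518; 8520; 8738; 14568; 14797; 15017; 15233; 15241; 15460; 15681;
    22179];
[:: 249; 470; 698; 915; 921; 1137; 1362; 1578; 1805; 2245; 7412; 7635; 7858; 8072; 8084; 8301; 8965;
    14793; 15020; 15243; 15460; 15684; 22405];
[:: 276; 2029; 2469; 2480; 2692; 2916; 2923; 3137; 3363; 7439; 7878; 8961; 9185; 9200; 9414; 9644;
    9862; 10081; 14793; 15461; 15684; 15905; 15920; 16130; 16355; 16362; 16581; 16805; 21741; 21760;
    22179; 22200; 22405; 22626; 22644; 23080; 23297; 28680; 28902; 28923; 29122; 29347; 29363;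
    29570; 29795; 29803; 30018; 35845; 36083; 36291; 36516; 36520; 36738; 36962; 43010; 43238;
    43245; 43457; 43685; 50180; 50402];
[:: 265; 1136; 1581; 1588; 1801; 2028; 7426; 7633; 7867; 8301; 8308; 8742; 8744; 8961; 9186; 14356;
    14586; 14795; 15018; 15027; 15236; 15458; 15469; 15686; 15905; 21517; 21738; 21746; 21957;
    22189; 22406; 22628; 28677; 28901; 28909; 29126; 29345; 35845; 36067];
[:: 258; 463; 905; 1129; 1139; 1579; 1797; 2021; 7183; 7414; 7850; 7856; 8068; 8291; 8297; 8514;
    8739; 14348; 14570; 14579; 15011; 15020; 15236; 15459; 21509; 21738; 21954; 22178; 28674;
    28900];
[:: 247; 254; 688; 697; 912; 1352; 1581; 2021; 7407; 7418; 7850; 7857; 8077; 8301; 8518; 8739;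
    14571; 14578; 14792; 15012; 15238; 15457; 21517; 21731; 21954; 28675; 28902];
[:: 239; 475; 685; 906; 914; 1347; 1356; 1574; 1795; 7403; 7627; 7636; 8065; 8077; 8290; 8514;
    14564; 14786; 14795; 15009; 21509; 21953];
[:: 464; 473; 689; 914; 1128; 1354; 1798; 7624; 7634; 7849; 8291; 14571; 14785; 14793; 15009; 15234;
    21733; 21954];
[:: 466; 696; 905; 1131; 1354; 1570; 1576; 2022; 7627; 7851; 7859; 8076; 8292; 8301; 8518; 8740;
    14349; 15010; 15018; 15236; 21729; 21955; 22178];
[:: 457; 463; 681; 907; 1123; 1128; 1346; 1571; 7176; 7401; 7628; 7844; 7849; 8069; 14566; 15009];
[:: 243; 463; 907; 1130; 1345; 7404; 7624; 7851; 8292; 15009];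
[:: 236; 905; 1122; 1347; 7841; 8067];
[:: 683; 1121; 1345; 7845; 8070];
[:: 7192; 7205; 7419; 7430; 7643; 7654; 7865; 7872; 7877; 8083; 8087; 8098; 8304; 8311; 8319; 8520;
    8535; 8748; 8754; 8759; 8972; 9193; 9201; 9409; 9421; 9638; 9861; 10084; 14361; 14368; 14578;
    14582; 14589; 14800; 14809; 14816; 15028; 15033; 15040; 15241; 15252; 15465; 15476; 15481;
    15688; 15696; 15906; 15912; 15922; 16129; 16138; 16358; 16362; 16579; 16801; 21521; 21526;
    21746; 21751; 21963; 21971; 21975; 22187; 22194; 22203; 22412; 22420; 22630; 22639; 22853;
    22859; 23075; 23081; 23525; 28680; 28905; 29130; 29140; 29349; 29361; 29573; 29576; 29800;
    30245; 36067; 36077; 36291; 36300; 36523; 36737; 36964; 43011; 43237; 43461; 43684];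
[:: 7429; 7874; 8298; 8742; 8753; 8963; 9186; 9194; 9412; 9637; 14352; 15017; 15031; 15460; 15476;
    15685; 15908; 15916; 16133; 16354; 21512; 21741; 21755; 22182; 22402; 22628; 22634; 22853;
    23074; 28898; 28911; 29126; 29794; 35845; 36066; 36515; 43009; 43237];
[:: 7866; 8299; 8741; 8963; 9190; 15016; 15023; 15460; 15683; 15908; 21739; 22178; 22189; 22406;
    22630; 28901; 29122; 29347];
[:: 7423; 8291; 8307; 8515; 8740; 8749; 8966; 9186; 14569; 14583; 14787; 15012; 15234; 15462; 15468;
    15681; 15909; 21732; 21953; 22178; 22185; 22404; 22626; 28673; 28901; 28904; 29124; 29347;
    36065];
[:: 7417; 7852; 8069; 8291; 8741; 14571; 14788; 15012; 21509; 21731; 21739; 21957; 22180; 28678;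
    28899];
[:: 7176; 7402; 7627; 7845; 7852; 8068; 14565; 15013]].
Definition cert_q0_w : certificate :=
  [:: [:: 457; 7179; 7398; 229612; 236547; 458763];
[:: 243; 7181; 229391; 236547; 458763; 458979; 688134];
[:: 17; 232; 7174; 229388; 229606; 458755];
[:: 7170; 229604; 458756]].
Definition cert_q0_y : certificate :=
  [:: [:: 449; 7396; 14337];
[:: 14338];
[:: 12; 228];
[:: 228; 7169]].
Definition cert_q0_c : certificate :=
  [:: [::];
[:: 3]].
Definition cert_n0_y : certificate :=
  [:: [:: 673];
[:: 15; 234; 450];
[:: 22; 244; 459]].
Definition cert_n0_c : certificate :=
  [:: [::];
[::];
[:: 6]].
Definition cert_n1_y : certificate :=
  [:: [:: 25; 226; 232; 454; 457];
[:: 6; 11; 15; 225; 452];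
[:: 8; 20; 234]].
Definition cert_n1_c : certificate :=
  [:: [::];
[::];
[:: 6]].
Definition cert_b_m : certificate :=
  [:: [::];
[:: 1]].
Definition cert_b_u : certificate :=
  [:: [:: 4];
[::];
[:: 8]].
Definition cert_b_v : certificate :=
  [:: [::];
[::];
[:: 6]].
Definition cert_a_m : certificate :=
  [:: [::];
[:: 2];
[:: 9; 229]].
Definition cert_a_u : certificate :=
  [:: [::];
[::];
[:: 5]].
Definition cert_c_m : certificate :=
  [:: [:: 685; 899; 7409; 7626; 7844; 14354; 14571; 14790; 21517; 28678];
[:: 449; 7177; 7397; 14337];
[:: 678; 7404; 14562; 21509]].
Definition cert_c_u : certificate :=
  [:: [:: 233; 454];
[:: 4]].
Definition cert_c_l : certificate :=
  [:: [::];
[::];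
[:: 4]].
Definition cert_h_z_0 : certificate :=
  [:: [:: 3];
[:: 1];
[:: 6];
[:: 5]].
Definition cert_h_z_1 : certificate :=
  [:: [:: 6];
[:: 4];
[:: 2];
[:: 3]].
Definition cert_h_z_2 : certificate :=
  [:: [::];
[:: 3];
[:: 6];
[:: 5]].
Definition cert_h_z_3 : certificate :=
  [:: [:: 2];
[:: 6];
[:: 6];
[:: 6]].
Definition cert_h_i_0 : certificate :=
  [:: [:: 4];
[:: 5];
[:: 2];
[:: 2]].
Definition cert_h_i_1 : certificate :=
  [:: [:: 3];
[:: 4];
[:: 5];
[:: 1]].
Definition cert_h_i_2 : certificate :=
  [:: [::];
[:: 5]].
Definition cert_h_i_3 : certificate :=
  [:: [:: 6];
[:: 3];
[:: 6]].
Definition cert_h_w_0 : certificate :=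
  [:: [:: 3];
[:: 4];
[:: 1];
[:: 3]].
Definition cert_h_w_1 : certificate :=
  [:: [:: 3];
[:: 3];
[:: 2];
[:: 5]].
Definition cert_h_w_2 : certificate :=
  [:: [:: 6];
[:: 5];
[::];
[:: 4]].
Definition cert_h_w_3 : certificate :=
  [:: [:: 6];
[::];
[:: 2]].
Definition cert_h_t_0 : certificate :=
  [:: [::];
[::];
[:: 3];
[:: 2]].
Definition cert_h_t_1 : certificate :=
  [:: [:: 2];
[:: 2];
[:: 3];
[:: 3]].
Definition cert_h_t_2 : certificate :=
  [:: [::];
[:: 6]].
Definition cert_h_t_3 : certificate :=
  [:: [::];
[:: 2];
[:: 5];
[:: 5]].
Definition cert_q1_s : certificate :=
  [:: [:: 1];
[:: 5];
[:: 6];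
[:: 228]].
Definition cert_q1_c : certificate :=
  [:: [::];
[::];
[:: 20; 229];
[:: 241; 449]].
Definition cert_q1_a : certificate :=
  [:: [::];
[::];
[::];
[:: 1]].
Definition cert_q1_r : certificate :=
  [:: [::];
[:: 3]].
(** Signed terms n x^i y^j approximating 2 X, and below 64 W, near X = -1/2, where x = Y/9 and y =
    C/27. With weights 1 and 2 for x and y, every term has weight at most 5. *)
Definition branch_X : seq (bool * N * N * N) :=
  [:: (true, 1, 0, 0); (false, 32, 1, 0); (false, 896, 2, 0); (false, 336, 1, 1); (false, 49664, 3, 0); (true, 56, 0, 2); (false, 47232, 2, 1); (false, 3422208, 4, 0); (true, 11744, 1, 2); (false, 5591808, 3, 1); (false, 263200768, 5, 0)].
Definition branch_W : seq (bool * N * N * N) :=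
  [:: (false, 839808, 3, 0); (false, 36288, 0, 2); (false, 1399680, 2, 1); (false, 3773952, 1, 2); (false, 98537472, 3, 1)].

End Data.

(** * Solutions of the homogenized equations, chart by chart *)

Module Charts.
Import all_boot all_order all_algebra boolp classical_sets ring.
Import GRing.Theory Num.Theory.
Local Open Scope ring_scope.
Import Elimination Valuation Certificates Data.

Definition eqns_nf : seq pol := Eval vm_compute in eqns.
Lemma eqnsE : eqns = eqns_nf. Proof. by vm_compute. Qed.

Definition sol (K : comNzRingType) (z : seq K) := forall i, ev z (nth p0 eqns_nf i) = 0.
(* Solutions come in weighted homogeneous families. *)
Definition hsol (K : comNzRingType) (T X Y W C : K) :=
  forall e, sol [:: e * T; e * X; e ^+ 2 * Y; e ^+ 6 * W; e ^+ 2 * C].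

Lemma hsol_scale (K : comNzRingType) (T X Y W C l : K) :
  hsol T X Y W C -> hsol (l * T) (l * X) (l ^+ 2 * Y) (l ^+ 6 * W) (l ^+ 2 * C).
Proof. by move=> h e; have := h (e * l); rewrite !exprMn -!mulrA. Qed.

Lemma hsol_sol (K : comNzRingType) (T X Y W C : K) : hsol T X Y W C -> sol [:: T; X; Y; W; C].
Proof. by move/(_ 1); rewrite !expr1n !mul1r. Qed.

Notation v0 := (pvar 0). Notation v1 := (pvar 1). Notation v2 := (pvar 2).
Notation v3 := (pvar 3). Notation v4 := (pvar 4).
Declare Scope pol_scope.
Delimit Scope pol_scope with pol.
Notation "n %:P" := (pnat n) : pol_scope.
Notation "P + Q" := (padd P Q) : pol_scope.
Notation "P * Q" := (pmul P Q) : pol_scope.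
Notation "P - Q" := (psub P Q) : pol_scope.
Notation "P ^+ n" := (ppow P n) : pol_scope.

Fixpoint leads ds S (eqs : seq pol) :=
  match ds, eqs with
  | d :: ds', P :: eqs' => leading d S P :: leads ds' S eqs'
  | _, _ => [::]
  end.

Section Charts.
Variables (K : numClosedFieldType) (B : set K).
Hypothesis Bval : valuation_subring 7 B.
Let Br : is_subring B. Proof. by case: Bval. Qed.
Notation M := (maxi B).
Notation integral := (integral B).
Notation agrees := (agrees B).
Let mB := maxiB Bval.
Let mP := maxi_prime Bval.

Lemma sol_reduced z e S : integral z -> integral e -> agrees z e S -> sol z ->
  all_maxi B e (map (reduced S) eqns_nf).
Proof.
move=> Bz Be a sz; apply: all_maxi_map; [by []|by move=> P; apply: maxi_reduced Be a|].
by move=> i; rewrite sz; left.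
Qed.

Lemma sol_certified z e S k cs target : integral z -> integral e -> agrees z e S -> sol z ->
  certifies k cs (map (reduced S) eqns_nf) target -> M (ev e target).
Proof. by move=> Bz Be a sz c; apply: (certified Bval Be c); apply: sol_reduced sz. Qed.

Ltac int := repeat (apply: (integral_cons); [by []|]); exact: (integral_nil Bval).
Ltac agr := repeat (apply: agrees_cons;
  [rewrite ?(evD, evM, evB, evX, ev_var, ev_nat, ev0, ev1) /= ?subr0 ?subrr; first [by left|by []]|]);
  exact: agrees_nil.
Ltac evs := rewrite ?(evD, evM, evB, evX, ev_nat, ev_var, ev0, ev1) /=.
Ltac certify e S k cs t :=
  match goal with
  | s : sol _ |- _ =>
    have := @sol_certified _ e S k cs t _ _ _ s;
    evs; apply; [int|int|agr|vm_compute; reflexivity]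
  end.

Let B0 : B 0. Proof. exact: subring0. Qed.
Let B1 : B 1. Proof. by case: Br. Qed.
Let Bn n : B n%:R. Proof. exact: subring_nat. Qed.
Let BB x y : B x -> B y -> B (x - y). Proof. by case: Br => _ + _; apply. Qed.
Hint Resolve B0 B1 Bn : core.

Let unit_pow c n y : ~ M c -> B c -> B y -> M (c ^+ n * y) -> M y.
Proof.
move=> nc Bc By cy; case: (mP _ By cy) => [|cn|//]; first exact: subringX.
by case: nc; apply: (maxi_pow Bval Bc cn).
Qed.

Lemma lead_certified l us S ds eqs e S' k cs target : integral (l :: us) -> integral e ->
  l != 0 -> M l -> (forall i, ev (map (ev (l :: us)) S) (nth p0 eqs i) = 0) ->
  agrees (l :: us) e S' -> certifies k cs (map (reduced S') (leads ds S eqs)) target ->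
  M (ev e target).
Proof.
move=> Bu Be l0 ml eq0 a c; apply: (certified Bval Be c).
apply: all_maxi_map; [by []|by move=> P; apply: maxi_reduced Be a|].
elim: ds eqs eq0 {c} => [|d ds IH] [|P eqs] eq0 [|i] /=; rewrite ?ev0; try by left.
  by apply: maxi_leading => //; apply: (eq0 0%N).
by apply: IH => k'; apply: (eq0 k'.+1).
Qed.

Section TOne.
Variables X Y W C : K.
Hypotheses (BX : B X) (BY : B Y) (BW : B W) (BC : B C).
Hypothesis s : sol [:: 1; X; Y; W; C].

(** Residues at infinity in the chart T = 1: the second value 3 of X is -1/2 modulo 7. Eliminating
    Y, then W, leaves the factors X and X - 3 only. *)
Lemma chart_infinity : M C -> [/\ M Y, M W & M X \/ M (X - 3%:R)].
Proof.
move=> mC.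
have mY : M Y.
  apply: (@maxi_pow _ _ Bval _ 9) => //.
  by certify [:: X; Y; W] [:: p1; v0; v1; v2; p0] 3%N cert_tinf_y (v1 ^+ 9)%pol.
have mW : M W.
  apply: (@maxi_pow _ _ Bval _ 2) => //.
  by certify [:: X; W] [:: p1; v0; p0; v1; p0] 2%N cert_tinf_w (v1 ^+ 2)%pol.
split=> //.
have BX3 : B (X - 3%:R) by apply: BB.
have h : M (X ^+ 6 * (X - 3%:R) ^+ 6).
  by certify [:: X] [:: p1; v0; p0; p0; p0] 1%N cert_tinf_x (v0 ^+ 6 * (v0 - 3%:P) ^+ 6)%pol.
by case: (mP _ _ h) => [||/(maxi_pow Bval BX)|/(maxi_pow Bval BX3)];
  [exact: subringX|exact: subringX|left|right].
Qed.

(** The residues are those of two theta points with T = 1: C = 1/2 = 4 for Z, and Y = 1/54 = 3, W =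
    1/2187 = 5, C = 1/18 = 2 for Z[zeta3]. *)
Lemma chart_x0 : ~ M C -> M X ->
  [/\ M Y, M W & M (C - 4%:R)] \/ [/\ M (Y - 3%:R), M (W - 5%:R) & M (C - 2%:R)].
Proof.
move=> nC mX; have BY3 : B (Y - 3%:R) by apply: BB.
have h : M (Y * (Y - 3%:R)).
  apply: (unit_pow (n := 5) nC BC); first exact: subringM.
  by certify [:: Y; W; C] [:: p1; p0; v0; v1; v2] 3%N cert_x0_y (v2 ^+ 5 * (v0 * (v0 - 3%:P)))%pol.
case: (mP BY BY3 h) => mY; [left|right].
- have mW : M W.
    apply: (unit_pow (n := 1) nC BC) => //.
    by certify [:: W; C] [:: p1; p0; p0; v0; v1] 2%N cert_x00_w (v1 ^+ 1 * v0)%pol.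
  split=> //; apply: (unit_pow (n := 3) nC BC); first exact: BB.
  by certify [:: C] [:: p1; p0; p0; p0; v0] 1%N cert_x00_c (v0 ^+ 3 * (v0 - 4%:P))%pol.
- have BW5 : B (W - 5%:R) by apply: BB.
  have mW : M (W - 5%:R).
    apply: (maxi_pow (n := 2) Bval BW5); apply: (unit_pow (n := 1) nC BC); first exact: subringX.
    by certify [:: W; C] [:: p1; p0; 3%:P%pol; v0; v1] 2%N cert_x03_w (v1 ^+ 1 * (v0 - 5%:P) ^+ 2)%pol.
  have BC2 : B (C - 2%:R) by apply: BB.
  split=> //; apply: (maxi_pow (n := 3) Bval BC2); apply: (unit_pow (n := 2) nC BC).
    exact: subringX.
  by certify [:: C] [:: p1; p0; 3%:P%pol; 5%:P%pol; v0] 1%N cert_x03_c (v0 ^+ 2 * (v0 - 2%:P) ^+ 3)%pol.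
Qed.
End TOne.

Section XOne.
Variables T Y W C : K.
Hypotheses (BT : B T) (BY : B Y) (BW : B W) (BC : B C).
Hypothesis s : sol [:: T; 1; Y; W; C].
(** The residue of (0, 1, 0, 0, 18), a point with T = 0 at which the relations still vanish to first
    order after division by powers of T. *)
Lemma chart_t0 : M T -> [/\ M Y, M W & M (C - 18%:R)].
Proof.
move=> mT.
have mY : M Y.
  apply: (maxi_pow (n := 6) Bval BY).
  by certify [:: Y; W; C] [:: p0; p1; v0; v1; v2] 3%N cert_t0_y (v0 ^+ 6)%pol.
have mW : M W.
  apply: (maxi_pow (n := 3) Bval BW).
  by certify [:: W; C] [:: p0; p1; p0; v0; v1] 2%N cert_t0_w (v0 ^+ 3)%pol.
split=> //; apply: (maxi_pow (n := 2) Bval); first exact: BB.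
by certify [:: C] [:: p0; p1; p0; p0; v0] 1%N cert_t0_c ((v0 - 18%:P) ^+ 2)%pol.
Qed.
End XOne.

Section Origin.
Variables l r Y W C : K.
Hypotheses (Bl : B l) (BrB : B r) (BY : B Y) (BW : B W) (BC : B C).
Hypotheses (l0 : l != 0) (ml : M l).
Let d := [:: 1; 3; 1; 1; 1; 1; 1; 0; 0]%N.

(** Residues with T = X = 0 are studied on the blow-up of T = X = 0: in this chart X/T is integral,
    in the next one T/X is in the maximal ideal. The leading forms generate 1 modulo 7 if C = 1, and
    force Y and W to be small if C is small. *)
Lemma chart_origin_T : sol [:: l; l * r; Y; W; C] -> C = 1 \/ M C -> M C /\ M Y /\ M W.
Proof.
have -> : [:: l; l * r; Y; W; C] =
    map (ev [:: l; r; Y; W; C]) [:: v0; (v0 * v1)%pol; v2; v3; v4].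
  by rewrite [RHS]/map evM !ev_var.
move=> s; have int0 : integral [:: l; r; Y; W; C] by int.
case=> [C1|mC].
  case: (@maxi1 _ _ Bval).
  have := lead_certified (ds := d) (e := [:: r; Y; W]) (S' := [:: p0; v0; v1; v2; p1])
    (k := 3) (cs := cert_l1_c1) (target := p1) int0 _ l0 ml s.
  evs; apply; [int|rewrite C1; agr|vm_compute; reflexivity].
have mW : M W.
  apply: (maxi_pow (n := 3) Bval BW).
  have := lead_certified (ds := d) (e := [:: r; Y; W]) (S' := [:: p0; v0; v1; v2; p0])
    (k := 3) (cs := cert_l1_w) (target := (v2 ^+ 3)%pol) int0 _ l0 ml s.
  evs; apply; [int|agr|vm_compute; reflexivity].
split=> //; split=> //; apply: (maxi_pow (n := 6) Bval BY).
have := lead_certified (ds := d) (e := [:: r; Y]) (S' := [:: p0; v0; v1; p0; p0])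
  (k := 2) (cs := cert_l1_y) (target := (v1 ^+ 6)%pol) int0 _ l0 ml s.
evs; apply; [int|agr|vm_compute; reflexivity].
Qed.

Lemma chart_origin_X : M r -> sol [:: l * r; l; Y; W; C] -> C = 1 \/ M C -> M C /\ M Y /\ M W.
Proof.
have -> : [:: l * r; l; Y; W; C] =
    map (ev [:: l; r; Y; W; C]) [:: (v0 * v1)%pol; v0; v2; v3; v4].
  by rewrite [RHS]/map evM !ev_var.
move=> mr s; have int0 : integral [:: l; r; Y; W; C] by int.
case=> [C1|mC].
  case: (@maxi1 _ _ Bval).
  have := lead_certified (ds := d) (e := [:: Y; W]) (S' := [:: p0; p0; v0; v1; p1])
    (k := 2) (cs := cert_l2_c1) (target := p1) int0 _ l0 ml s.
  evs; apply; [int|rewrite C1; agr|vm_compute; reflexivity].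
have mW : M W.
  apply: (maxi_pow (n := 3) Bval BW).
  have := lead_certified (ds := d) (e := [:: Y; W]) (S' := [:: p0; p0; v0; v1; p0])
    (k := 2) (cs := cert_l2_w) (target := (v1 ^+ 3)%pol) int0 _ l0 ml s.
  evs; apply; [int|agr|vm_compute; reflexivity].
split=> //; split=> //; apply: (maxi_pow (n := 4) Bval BY).
have := lead_certified (ds := d) (e := [:: Y]) (S' := [:: p0; p0; v0; p0; p0])
  (k := 1) (cs := cert_l2_y) (target := (v0 ^+ 4)%pol) int0 _ l0 ml s.
evs; apply; [int|agr|vm_compute; reflexivity].
Qed.
End Origin.
End Charts.

(* Coefficients with respect to the first variable. *)
Fixpoint psplit (P : pol) : seq pol :=
  match P with
  | Ring_polynom.Pc c => [:: P]
  | Ring_polynom.Pinj j Q => [:: Ring_polynom.mkPinj_pred j Q]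
  | Ring_polynom.PX P i Q => Q :: nseq (BinPos.Pos.to_nat i).-1 p0 ++ psplit P
  end.

(* Remainder of a polynomial in w modulo w^2 = al w + be. *)
Definition wreduce (al be : pol) (cs : seq pol) : pol * pol :=
  foldr (fun c AB => (pmod ((AB.1 * al) + AB.2)%pol, pmod ((AB.1 * be) + c)%pol)) (p0, p0) cs.

(** Elimination of w from c_i w + e_i = 0 and w^2 = al w + be: the 2 x 2 minors of the rows (c_i,
    e_i), and the polarized norms of c_i w + e_i over the quadratic extension. Rows 0, 1, 2 are
    paired with later rows, which is enough for the certificates. *)
Definition minors (al be : pol) (L : seq (pol * pol)) : seq pol :=
  let c i := (nth (p0, p0) L i).1 in
  let e i := (nth (p0, p0) L i).2 in
  [seq pmod (c i * e j - e i * c j)%pol | i <- iota 0 3, j <- iota i.+1 (7 - i)] ++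
  [seq pmod (((e i * e j) + (al * (e i * c j))) - (be * (c i * c j)))%pol | i <- iota 0 3, j <- iota i (3 - i)].

(** The variables are W, Y', X, C, with W first so that [psplit] sorts by powers of W. Here Y = 5
    X^2 + 4 C + 3 Y' modulo 7; the inverse of 3 is 5, hence the factor 5 in Y' below. *)
Definition chart_eqns := map (reduced [:: p1; v2; ((5%:P * v2 ^+ 2) + (4%:P * v3)) + (3%:P * v1); v0; v3]%pol) eqns_nf.
(** The combination [comb] at n = 15. It is quadratic in W with leading coefficient 6 = -1, so its
    lower coefficients are those of W^2 = al W + be. *)
Definition quadric := psplit (pmod (nth p0 chart_eqns 3 - (2%:P * nth p0 chart_eqns 2))%pol).
Definition quadric_minors :=
  let al := nth p0 quadric 1 in let be := nth p0 quadric 0 in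
  minors al be [seq wreduce al be (psplit (nth p0 chart_eqns i)) | i <- [:: 0; 1; 2; 4; 5; 6; 7; 8]%N].
Definition quadric_minors_nf : seq pol := Eval vm_compute in quadric_minors.
Section Charts.
Variables (K : numClosedFieldType) (B : set K).
Hypothesis Bval : valuation_subring 7 B.
Let Br : is_subring B. Proof. by case: Bval. Qed.
Notation M := (maxi B).
Notation integral := (integral B).
Notation agrees := (agrees B).
Let mB := maxiB Bval.
Let mP := maxi_prime Bval.

Ltac int := repeat (apply: (integral_cons); [by []|]); exact: (integral_nil Bval).
Ltac agr := repeat (apply: agrees_cons;
  [rewrite ?(evD, evM, evB, evX, ev_var, ev_nat, ev0, ev1) /= ?subr0 ?subrr; first [by left|by []]|]);
  exact: agrees_nil.
Ltac evs := rewrite ?(evD, evM, evB, evX, ev_nat, ev_var, ev0, ev1) /=.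
Ltac certify e S k cs t :=
  match goal with
  | s : sol _ |- _ =>
    have := @sol_certified _ _ Bval _ e S k cs t _ _ _ s;
    evs; apply; [int|int|agr|vm_compute; reflexivity]
  end.

Let B0 : B 0. Proof. exact: subring0. Qed.
Let B1 : B 1. Proof. by case: Br. Qed.
Let Bn n : B n%:R. Proof. exact: subring_nat. Qed.
Let BB x y : B x -> B y -> B (x - y). Proof. by case: Br => _ + _; apply. Qed.
Hint Resolve B0 B1 Bn : core.
Ltac Bs := repeat first [by [] | apply: (subringX Br) | apply: (subringM Br) | apply: BB | apply: (subringD Br) | apply: (subringN Br)].

Let unit_pow c n y : ~ M c -> B c -> B y -> M (c ^+ n * y) -> M y.
Proof.
move=> nc Bc By cy; case: (mP _ By cy) => [|cn|//]; first exact: subringX.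
by case: nc; apply: (maxi_pow Bval Bc cn).
Qed.

Definition horner (w : K) u cs := foldr (fun c acc => ev u c + w * acc) 0 cs.

Lemma ev_mkPinj_pred (e : seq K) j P :
  ev e (Ring_polynom.mkPinj_pred j P) = ev (drop (BinPos.Pos.to_nat j).-1 e) P.
Proof.
case: j => [j|j|]; rewrite /Ring_polynom.mkPinj_pred; last by rewrite drop0.
  by rewrite ev_Pinj jumpE Pnat.Pos2Nat.inj_xI Pnat.Pos2Nat.inj_xO.
rewrite ev_Pinj jumpE; congr (ev (drop _ _) _).
by rewrite -(BinPos.Pos.succ_pred_double j) Pnat.Pos2Nat.inj_succ.
Qed.

Lemma ev_split w u P : ev (w :: u) P = horner w u (psplit P).
Proof.
elim: P => [c|j Q _|P IHP i Q _].
- by rewrite /= mulr0 addr0.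
- rewrite /= mulr0 addr0 ev_mkPinj_pred ev_Pinj jumpE.
  case: (BinPos.Pos.to_nat j) (Pnat.Pos2Nat.is_pos j) => [|n _] //=.
  by move/PeanoNat.Nat.lt_irrefl.
- rewrite ev_PX IHP [RHS]/= addrC; congr (_ + _).
  case: (BinPos.Pos.to_nat i) (Pnat.Pos2Nat.is_pos i) => [/PeanoNat.Nat.lt_irrefl//|n _].
  rewrite exprSr mulrA mulrC; congr (_ * _).
  elim: n => [|n IH]; first by rewrite expr0 mulr1.
  by rewrite [RHS]/= ev0 add0r -IH exprSr mulrA mulrC.
Qed.

Lemma maxi_wreduce w u al be cs : B w -> integral u -> M (w ^+ 2 - (ev u al * w + ev u be)) ->
  M (horner w u cs - (ev u (wreduce al be cs).1 * w + ev u (wreduce al be cs).2)).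
Proof.
move=> Bw Bu q; elim: cs => [|c cs IH] /=.
  by rewrite ev0 mul0r addr0 subr0; left.
set A := (wreduce al be cs).1 in IH *; set D := (wreduce al be cs).2 in IH *.
have h1 := ev_pmod Bval ((A * al) + D)%pol Bu; have h2 := ev_pmod Bval ((A * be) + c)%pol Bu.
rewrite !evD !evM in h1 h2.
have -> : ev u c + w * horner w u cs - (ev u (pmod (A * al + D)%pol) * w + ev u (pmod (A * be + c)%pol)) =
  w * (horner w u cs - (ev u A * w + ev u D)) + ev u A * (w ^+ 2 - (ev u al * w + ev u be)) +
  ((ev u A * ev u al + ev u D - ev u (pmod (A * al + D)%pol)) * w +
   (ev u A * ev u be + ev u c - ev u (pmod (A * be + c)%pol))) by ring.
do 2?apply: (maxiD Bval); [exact: maxiM| |by apply: (maxiMr Bval)|by []].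
by apply: (maxiM Bval) => //; apply: B_ev.
Qed.

Lemma all_maxi_cat u s t : all_maxi B u s -> all_maxi B u t -> all_maxi B u (s ++ t).
Proof. by move=> hs ht i; rewrite nth_cat; case: ifP. Qed.

Lemma all_maxi_gen (A : Type) u (f : A -> pol) s : (forall x, M (ev u (f x))) ->
  all_maxi B u (map f s).
Proof. by move=> hf; elim: s => [|x s IH] [|i] /=; rewrite ?ev0; try by left. Qed.

Lemma all_maxi_flatten (A : Type) u (f : A -> seq pol) s : (forall x, all_maxi B u (f x)) ->
  all_maxi B u (flatten (map f s)).
Proof.
move=> hf; elim: s => [|x s IH] /=; first by move=> i; rewrite nth_nil ev0; left.
exact: all_maxi_cat.
Qed.

Lemma maxi_minors w u al be L : B w -> integral u -> M (w ^+ 2 - (ev u al * w + ev u be)) ->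
  (forall i, M (ev u (nth (p0, p0) L i).1 * w + ev u (nth (p0, p0) L i).2)) ->
  all_maxi B u (minors al be L).
Proof.
move=> Bw Bu q hL; have Be P : B (ev u P) by apply: B_ev.
have mo P : M (ev u P) -> M (ev u (pmod P)).
  by move=> mP'; have := maxiBB Bval mP' (ev_pmod Bval P Bu); rewrite subKr.
pose c i := ev u (nth (p0, p0) L i).1; pose e i := ev u (nth (p0, p0) L i).2.
apply: all_maxi_cat; apply: all_maxi_flatten => i; apply: all_maxi_gen => j; apply: mo; evs.
  have -> : c i * e j - e i * c j = c i * (c j * w + e j) - c j * (c i * w + e i) by ring.
  exact: (maxiBB Bval (maxiM Bval (Be _) (hL j)) (maxiM Bval (Be _) (hL i))).
have -> : e i * e j + ev u al * (e i * c j) - ev u be * (c i * c j) =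
    e i * (c j * w + e j) + c j * (ev u al - w) * (c i * w + e i) +
    c i * c j * (w ^+ 2 - (ev u al * w + ev u be)) by ring.
do 2?apply: (maxiD Bval); [exact: (maxiM Bval (Be _) (hL j))| |].
  by apply: (maxiM Bval _ (hL i)); apply: subringM => //; [exact: Be|apply: BB => //; exact: Be].
by apply: (maxiM Bval _ q); apply: subringM => //; exact: Be.
Qed.

Section XUnit.
Variables X Y W C : K.
Hypotheses (BX : B X) (BY : B Y) (BW : B W) (BC : B C).
Hypothesis s : sol [:: 1; X; Y; W; C].
Let Y' := 5%:R * (Y - (5%:R * X ^+ 2 + 4%:R * C)).

Let BY' : B Y'.
Proof. by apply: subringM => //; apply: BB => //; apply: subringD => //; apply: subringM => //; apply: subringX. Qed.

Lemma maxi_quadric_minors : all_maxi B [:: Y'; X; C] quadric_minors_nf.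
Proof.
have e : integral [:: W; Y'; X; C] by int.
have ch : all_maxi B [:: W; Y'; X; C] chart_eqns.
  apply: (sol_reduced Bval) s => //; first by int.
  do 2!(apply: agrees_cons; first by evs; rewrite ?subrr; left).
  apply: agrees_cons; last by agr.
  evs; have -> : Y - (5%:R * X ^+ 2 + 4%:R * C + 3%:R * Y') =
      7%:R * (- 2%:R * (Y - (5%:R * X ^+ 2 + 4%:R * C))) by rewrite /Y'; ring.
  apply: (maxiMr Bval); first exact: maxi7.
  by apply: subringM => //; [exact: subringN|apply: BB => //; apply: subringD => //; apply: subringM => //; apply: subringX].
have -> : quadric_minors_nf = quadric_minors by vm_compute.
have u : integral [:: Y'; X; C] by int.
have q : M (W ^+ 2 - (ev [:: Y'; X; C] (nth p0 quadric 1) * W + ev [:: Y'; X; C] (nth p0 quadric 0))).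
  have hq : M (horner W [:: Y'; X; C] quadric).
    rewrite -ev_split; set R := (_ - _)%pol.
    have mR : M (ev [:: W; Y'; X; C] R).
      by rewrite /R evB evM; apply: (maxiBB Bval); [exact: ch|apply: (maxiM Bval); [exact: B_ev|exact: ch]].
    by have := maxiBB Bval mR (ev_pmod Bval R e); rewrite subKr.
  have [Q0 [Q1 sq]] : exists Q0 Q1, quadric = [:: Q0; Q1; 6%:P%pol].
    by exists (nth p0 quadric 0), (nth p0 quadric 1); vm_compute.
  rewrite sq /= ev_nat in hq *.
  set q1 := ev _ Q1 in hq *; set q0 := ev _ Q0 in hq *.
  have -> : W ^+ 2 - (q1 * W + q0) = 7%:R * W ^+ 2 - (q0 + W * (q1 + W * (6%:R + W * 0))) by ring.
  exact: (maxiBB Bval (maxiMr Bval (maxi7 Bval) (subringX Br 2 BW)) hq).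
apply: (maxi_minors (w := W)) => // i; set is_ := [:: _; _; _; _; _; _; _; _].
have [il|il] := ltnP i (size is_); last first.
  by rewrite nth_default ?size_map //= ev0 mul0r addr0; left.
rewrite (nth_map 0%N) //; set P := nth p0 chart_eqns _.
have mPp : M (ev [:: W; Y'; X; C] P) by exact: ch.
rewrite ev_split in mPp.
by have := maxiBB Bval mPp (maxi_wreduce (psplit P) BW u q); rewrite subKr.
Qed.

(** Once W is eliminated, Y, X, C and finally W are found in this order. The residues are those of
    the theta point of Z[i]: X = 1/12 = 3 and C = 1/8 = 1 modulo 7. *)
Lemma chart_x_unit : ~ M C -> ~ M X -> [/\ M Y, M W, M (X - 3%:R) & M (C - 1)].
Proof.
move=> nC nX; have mins := maxi_quadric_minors.
have u : integral [:: Y'; X; C] by int.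
have mY : M Y.
  have h : M (X ^+ 8 * (C ^+ 8 * Y)).
    have := certified Bval (k := 3) (cs := cert_m_y)
      (target := (v1 ^+ 8 * (v2 ^+ 8 * (((5%:P * v1 ^+ 2) + (4%:P * v2)) + (3%:P * v0))))%pol) u _ mins.
    evs => /(_ ltac:(vm_compute; reflexivity)) h.
    have -> : X ^+ 8 * (C ^+ 8 * Y) = X ^+ 8 * (C ^+ 8 * (5%:R * X ^+ 2 + 4%:R * C + 3%:R * Y')) +
       7%:R * (- 2%:R * X ^+ 8 * C ^+ 8 * (Y - (5%:R * X ^+ 2 + 4%:R * C))).
      by rewrite /Y'; ring.
    apply: (maxiD Bval) => //; apply: (maxiMr Bval); first exact: maxi7.
    by Bs.
  by apply: (unit_pow (n := 8) nC BC BY); apply: (unit_pow (n := 8) nX BX _ h); apply: subringM => //; apply: subringX.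
have int2 : integral [:: X; C] by int.
(* For Y = 0 the variable Y' is -25 X^2 - 20 C, which is 3 X^2 + C modulo 7. *)
have red2 : all_maxi B [:: X; C] (map (reduced [:: (3%:P * v0 ^+ 2) + v1; v0; v1]%pol) quadric_minors_nf).
  apply: all_maxi_map mins => // P; apply: (maxi_reduced Bval u int2).
  apply: agrees_cons; last by agr.
  evs; have -> : Y' - (3%:R * X ^+ 2 + C) = 5%:R * Y - 7%:R * (4%:R * X ^+ 2 + 3%:R * C) by rewrite /Y'; ring.
  apply: (maxiBB Bval); first exact: (maxiM Bval).
  apply: (maxiMr Bval); first exact: maxi7.
  by apply: subringD => //; apply: subringM => //; apply: subringX.
have mX : M (X - 3%:R).
  apply: (unit_pow (n := 8) nC BC); first exact: BB.
  apply: (unit_pow (n := 5) nX BX); first by apply: subringM; [|exact: subringX|exact: BB].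
  have := certified Bval (k := 2) (cs := cert_m_x) (target := (v0 ^+ 5 * (v1 ^+ 8 * (v0 - 3%:P)))%pol) int2 _ red2.
  by evs; apply; vm_compute.
have int1 : integral [:: C] by int.
have mC : M (C - 1).
  apply: (unit_pow (n := 4) nC BC); first exact: BB.
  have red1 : all_maxi B [:: C] (map (reduced [:: 3%:P; v0]%pol)
      (map (reduced [:: (3%:P * v0 ^+ 2) + v1; v0; v1]%pol) quadric_minors_nf)).
    by apply: all_maxi_map red2 => // P; apply: (maxi_reduced Bval int2 int1); agr.
  have := certified Bval (k := 1) (cs := cert_m_c) (target := (v0 ^+ 4 * (v0 - p1))%pol) int1 _ red1.
  by evs; apply; vm_compute.
split=> //.
by certify [:: W] [:: p1; 3%:P; p0; v0; p1]%pol 1%N cert_m_w (pvar 0%N).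
Qed.
End XUnit.
End Charts.

(** * The points with C = 0 and the simple points *)

Definition pint (neg : bool) (n : BinNums.N) : pol :=
  let z := BinInt.Z.of_N n in PC (if neg then BinInt.Z.opp z else z).
Definition branch_pol (s : seq (bool * BinNums.N * BinNums.N * BinNums.N)) (x y : pol) : pol :=
  foldr (fun t Q => let: (neg, n, i, j) := t in
    ((pint neg n * (x ^+ BinNat.N.to_nat i * y ^+ BinNat.N.to_nat j)) + Q)%pol) p0 s.

(* Multiplying out w = - e0 / c0 in a polynomial with coefficients cs in w. *)
Definition weliminate (e0 c0 : pol) (cs : seq pol) : pol :=
  (foldr (fun c Ap => ((Ap.1 * popp e0) + (c * Ap.2), Ap.2 * c0)%pol) (p0, p1) cs).1.

(** Near X = Y = W = C = 0: X = l, Y = l (y - 9 l + c), W = l^2 w, C = 2 l c, and the first four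
    equations are divided by their powers of l. The outer substitution moves w to the front; the
    first equation is linear in w and serves to eliminate it. *)
Definition branch0_eqns := [seq psubst [:: v1; v0; v2; v3] (pdropc x.1 (psubst
  [:: p1; v0; v0 * (((v2 - 9%:P * v0)) + v3); v0 ^+ 2 * v1; 2%:P * (v0 * v3)]%pol x.2)) | x <- zip [:: 3; 3; 4; 4]%N eqns_nf].
Definition branch0_linear := psplit (nth p0 branch0_eqns 0).
Definition branch0_elim := let e0 := nth p0 branch0_linear 0 in let c0 := nth p0 branch0_linear 1 in
  [seq weliminate e0 c0 (psplit P) | P <- behead branch0_eqns].
Definition branch0 : seq pol := Eval vm_compute in branch0_elim.
Definition branch0_c0 : pol := Eval vm_compute in nth p0 branch0_linear 1.
(** The chart y = m u, c = m (c0 + v) of a further blow-up, centred at the roots c0 = 0 and c0 = 9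
    of the leading forms. *)
Definition branch0_blow c := [seq pdropc x.1 (psubst [:: v0; v0 * v1; v0 * (c + v2)]%pol x.2) | x <- zip [:: 4; 5; 4]%N branch0].
Definition branch00 : seq pol := Eval vm_compute in branch0_blow p0.
Definition branch09 : seq pol := Eval vm_compute in branch0_blow 9%:P%pol.
(** Chart of the blow-up of [branch00] with weights 1, 1, 2 in which the third coordinate is
    normalized to 1: m = l a, u = l b, v = l^2. *)
Definition branch000_def := [seq pdropc x.1 (psubst [:: v0 * v1; v0 * v2; v0 ^+ 2]%pol x.2) | x <- zip [:: 4; 4; 3]%N branch00].
Definition branch000 : seq pol := Eval vm_compute in branch000_def.

Section Charts.
Variables (K : numClosedFieldType) (B : set K).
Hypothesis Bval : valuation_subring 7 B.
Let Br : is_subring B. Proof. by case: Bval. Qed.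
Notation M := (maxi B).
Notation integral := (integral B).
Notation agrees := (agrees B).
Let mB := maxiB Bval.
Let mP := maxi_prime Bval.

Ltac int := repeat (apply: (integral_cons); [by []|]); exact: (integral_nil Bval).
Ltac agr := repeat (apply: agrees_cons;
  [rewrite ?(evD, evM, evB, evX, ev_var, ev_nat, ev0, ev1) /= ?subr0 ?subrr; first [by left|by []]|]);
  exact: agrees_nil.
Ltac evs := rewrite ?(evD, evM, evB, evX, ev_nat, ev_var, ev0, ev1) /=.
Ltac certify e S k cs t :=
  match goal with
  | s : sol _ |- _ =>
    have := @sol_certified _ _ Bval _ e S k cs t _ _ _ s;
    evs; apply; [int|int|agr|vm_compute; reflexivity]
  end.

Let B0 : B 0. Proof. exact: subring0. Qed.
Let B1 : B 1. Proof. by case: Br. Qed.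
Let Bn n : B n%:R. Proof. exact: subring_nat. Qed.
Let BB x y : B x -> B y -> B (x - y). Proof. by case: Br => _ + _; apply. Qed.
Hint Resolve B0 B1 Bn : core.
Ltac Bs := repeat first [by [] | apply: (subringX Br) | apply: (subringM Br) | apply: BB | apply: (subringD Br) | apply: (subringN Br)].

Let unit_pow c n y : ~ M c -> B c -> B y -> M (c ^+ n * y) -> M y.
Proof.
move=> nc Bc By cy; case: (mP _ By cy) => [|cn|//]; first exact: subringX.
by case: nc; apply: (maxi_pow Bval Bc cn).
Qed.

Definition vanish e Ps := forall i, ev e (nth p0 Ps i) = 0 :> K.

Lemma vanish_map z e (A : Type) (f : A -> pol -> pol) ds Ps :
  (forall d P, ev z P = 0 -> ev e (f d P) = 0) -> vanish z Ps -> vanish e [seq f x.1 x.2 | x <- zip ds Ps].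
Proof.
move=> hf; elim: ds Ps => [|d ds IH] [|P Ps] hP [|i] //=.
  by apply: hf; apply: (hP 0%N).
by apply: IH => k; apply: (hP k.+1).
Qed.

Section Isolated.
Variables (S : seq pol) (certs : seq certificate) (z : seq K).
Hypothesis cert : all (fun k => certifies 4 (nth [::] certs k)
  (map (reduced [:: p0; v0; v1; v2; v3]) (leads [:: 1; 1; 1; 1]%N S eqns_nf)) (pvar k)) (iota 0 4).

(* An approximate solution at which the linear parts of the equations are
   independent modulo M is approximated by at most one solution. *)
Lemma isolated (d : seq K) : size d = 4 -> (forall i, M (nth 0 d i)) ->
  (forall l us, size us = 4 -> (forall i, nth 0 d i = l * nth 0 us i) -> sol (map (ev (l :: us)) S)) ->
  forall i, nth 0 d i = 0.
Proof.
move=> sd md hS; have [z0|/hasPn z0] := boolP (has (fun x => x != 0) d); last first.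
  move=> i; have [id|id] := ltnP i (size d); last by rewrite nth_default.
  by apply/eqP; rewrite -[_ == _]negbK; apply: z0; rewrite mem_nth.
have sw : size [:: 1; 1; 1; 1]%N = size d by rewrite sd.
have [l [us [l0 ml su du [Bu [k kd uk]]]]] := blowup_maxi Bval sw isT z0 md.
rewrite sd in su kd; exfalso; apply: (maxi1 Bval); rewrite -uk.
have mk : M (ev us (pvar k)); last by rewrite ev_var in mk.
have Bl : integral (l :: us) by apply: integral_cons => //; exact: mB.
apply: (lead_certified (ds := [:: 1; 1; 1; 1]%N) (S' := [:: p0; v0; v1; v2; v3])
  (k := 4) (cs := nth [::] certs k) Bval Bl Bu l0 ml (S := S) (eqs := eqns_nf)).
- apply: hS => // i; rewrite du; case: i => [|[|[|[|i]]]] //=; rewrite ?expr1 //.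
  by rewrite (nth_default 0 (s := us)) ?su // !mulr0.
- case: us su {du Bu uk Bl} => [|u0 [|u1 [|u2 [|u3 [|]]]]] // _.
  by apply: agrees_cons; [rewrite ev0 subr0|agr].
- by move/allP: cert; apply; rewrite mem_iota.
Qed.
End Isolated.

Ltac four := case=> [|[|[|[|i]]]]; [| | | |by rewrite /= nth_nil; left].

Let nat_mul0 n x : n.+1%:R * x = 0 -> x = 0 :> K.
Proof. by move=> /eqP; rewrite mulf_eq0 pnatr_eq0 /= => /eqP. Qed.

(** Scaling T to 2 turns the solution into the integral point (2, 0, 0, 0, 2). Integrality matters:
    [leading] requires the constant terms to vanish over Z and not only modulo 7. *)
Lemma isolated_theta_Z X Y W C : sol [:: 2%:R; 2%:R * X; 4%:R * Y; 64%:R * W; 4%:R * C] ->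
  M X -> M Y -> M W -> M (C - 4%:R) -> [/\ X = 0, Y = 0, W = 0 & 2%:R * C = 1].
Proof.
move=> s mX mY mW mC; have mn n := maxiM Bval (Bn n).
pose d := [:: 2%:R * X; 4%:R * Y; 64%:R * W; 4%:R * C - 2%:R].
have h : forall i, nth 0 d i = 0.
  apply: (@isolated [:: 2%:P; v0 * v1; v0 * v2; v0 * v3; 2%:P + (v0 * v4)]%pol
     [:: cert_h_z_0; cert_h_z_1; cert_h_z_2; cert_h_z_3]); [by vm_compute|by []| |].
  - four.
    + exact: mn.
    + exact: mn.
    + exact: mn.
    + rewrite [nth _ _ _]/=; have -> : 4%:R * C - 2%:R = 4%:R * (C - 4%:R) + 2%:R * 7%:R by ring.
      by apply: (maxiD Bval); apply: mn => //; exact: maxi7.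
  - move=> l [|u0 [|u1 [|u2 [|u3 [|]]]]] // _ du; rewrite /map; evs.
    rewrite -(du 0%N : _ = l * u0) -(du 1%N : _ = l * u1) -(du 2%N : _ = l * u2) -(du 3%N : _ = l * u3).
    rewrite [nth _ _ _]/= [nth _ _ _]/= [nth _ _ _]/= [nth _ _ _]/= ?[_ + (_ - _)]addrC ?subrK //.
have e0 : 2%:R * X = 0 := h 0%N; have e1 : 4%:R * Y = 0 := h 1%N.
have e2 : 64%:R * W = 0 := h 2%N; have e3 : 4%:R * C - 2%:R = 0 := h 3%N.
split; [exact: nat_mul0 e0|exact: nat_mul0 e1|exact: nat_mul0 e2|].
by apply/subr0_eq/(@nat_mul0 1); rewrite -e3; ring.
Qed.

(** For T = 12 the theta point is (12, 1, 0, 0, 18); note 1728^2 = 12^6. *)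
Lemma isolated_theta_Zi X Y W C : sol [:: 12%:R; 12%:R * X; 144%:R * Y; 1728%:R ^+ 2 * W; 144%:R * C] ->
  M (X - 3%:R) -> M Y -> M W -> M (C - 1) -> [/\ 12%:R * X = 1, Y = 0, W = 0 & 8%:R * C = 1].
Proof.
move=> s mX mY mW mC; have mn n := maxiM Bval (Bn n).
pose d := [:: 12%:R * X - 1; 144%:R * Y; 1728%:R ^+ 2 * W; 144%:R * C - 18%:R].
have h : forall i, nth 0 d i = 0.
  apply: (@isolated [:: 12%:P; 1%:P + (v0 * v1); v0 * v2; v0 * v3; 18%:P + (v0 * v4)]%pol
     [:: cert_h_i_0; cert_h_i_1; cert_h_i_2; cert_h_i_3]); [by vm_compute|by []| |].
  - four.
    + rewrite [nth _ _ _]/=; have -> : 12%:R * X - 1 = 12%:R * (X - 3%:R) + 5%:R * 7%:R by ring.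
      by apply: (maxiD Bval); apply: mn => //; exact: maxi7.
    + exact: mn.
    + exact: (maxiM Bval (subringX Br 2 (Bn _))).
    + rewrite [nth _ _ _]/=; have -> : 144%:R * C - 18%:R = 144%:R * (C - 1) + 18%:R * 7%:R by ring.
      by apply: (maxiD Bval); apply: mn => //; exact: maxi7.
  - move=> l [|u0 [|u1 [|u2 [|u3 [|]]]]] // _ du; rewrite /map; evs.
    rewrite -(du 0%N : _ = l * u0) -(du 1%N : _ = l * u1) -(du 2%N : _ = l * u2) -(du 3%N : _ = l * u3).
    rewrite [nth _ _ _]/= [nth _ _ _]/= [nth _ _ _]/= [nth _ _ _]/= ?[_ + (_ - _)]addrC ?subrK //.
have e0 : 12%:R * X - 1 = 0 := h 0%N; have e1 : 144%:R * Y = 0 := h 1%N.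
have e2 : 1728%:R ^+ 2 * W = 0 := h 2%N; have e3 : 144%:R * C - 18%:R = 0 := h 3%N.
split; [exact/subr0_eq|exact: nat_mul0 e1| |].
  by apply: (@nat_mul0 (1728 * 1728).-1); rewrite -e2 expr2 -natrM.
by apply/subr0_eq/(@nat_mul0 17); rewrite -e3; ring.
Qed.

(** For T = 18 the theta point is (18, 0, 6, 216 * 72, 18), since 18^6 = 216 * 72 * 2187. The
    products avoid large unary numerals. *)
Lemma isolated_theta_Zzeta3 X Y W C : sol [:: 18%:R; 18%:R * X; 324%:R * Y; (216%:R * 72%:R) * (2187%:R * W); 324%:R * C] ->
  M X -> M (Y - 3%:R) -> M (W - 5%:R) -> M (C - 2%:R) -> [/\ X = 0, 54%:R * Y = 1, 2187%:R * W = 1 & 18%:R * C = 1].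
Proof.
move=> s mX mY mW mC; have mn n := maxiM Bval (Bn n).
pose d := [:: 18%:R * X; 324%:R * Y - 6%:R; (216%:R * 72%:R) * (2187%:R * W - 1); 324%:R * C - 18%:R].
have h : forall i, nth 0 d i = 0.
  apply: (@isolated [:: 18%:P; v0 * v1; 6%:P + (v0 * v2); (216%:P * 72%:P) + (v0 * v3); 18%:P + (v0 * v4)]%pol
     [:: cert_h_w_0; cert_h_w_1; cert_h_w_2; cert_h_w_3]); [by vm_compute|by []| |].
  - four.
    + exact: mn.
    + rewrite [nth _ _ _]/=; have -> : 324%:R * Y - 6%:R = 324%:R * (Y - 3%:R) + 138%:R * 7%:R by ring.
      by apply: (maxiD Bval); apply: mn => //; exact: maxi7.
    + rewrite [nth _ _ _]/=; apply: (maxiM Bval); first by rewrite -natrM.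
      have -> : 2187%:R * W - 1 = 2187%:R * (W - 5%:R) + 1562%:R * 7%:R by ring.
      by apply: (maxiD Bval); apply: mn => //; exact: maxi7.
    + rewrite [nth _ _ _]/=; have -> : 324%:R * C - 18%:R = 324%:R * (C - 2%:R) + 90%:R * 7%:R by ring.
      by apply: (maxiD Bval); apply: mn => //; exact: maxi7.
  - move=> l [|u0 [|u1 [|u2 [|u3 [|]]]]] // _ du; rewrite /map; evs.
    rewrite -(du 0%N : _ = l * u0) -(du 1%N : _ = l * u1) -(du 2%N : _ = l * u2) -(du 3%N : _ = l * u3).
    rewrite [nth _ _ _]/= [nth _ _ _]/= [nth _ _ _]/= [nth _ _ _]/= ?[_ + (_ - _)]addrC ?subrK //.
    have -> : 216%:R * 72%:R + 216%:R * 72%:R * (2187%:R * W - 1) = 216%:R * 72%:R * (2187%:R * W) :> K by ring.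
    exact: s.
have e0 : 18%:R * X = 0 := h 0%N; have e1 : 324%:R * Y - 6%:R = 0 := h 1%N.
have e2 : (216%:R * 72%:R) * (2187%:R * W - 1) = 0 := h 2%N; have e3 : 324%:R * C - 18%:R = 0 := h 3%N.
split; [exact: nat_mul0 e0| | |].
- by apply/subr0_eq/(@nat_mul0 5); rewrite -e1; ring.
- apply/subr0_eq/(@nat_mul0 (216 * 72).-1); rewrite -[RHS]e2 prednK ?natrM //.
- by apply/subr0_eq/(@nat_mul0 17); rewrite -e3; ring.
Qed.

(** The same uniqueness at (0, 1, 0, 0, 18): nearby solutions coincide with it and have T = 0. *)
Lemma isolated_degenerate T Y W C : sol [:: T; 1; Y; W; C] ->
  M T -> M Y -> M W -> M (C - 18%:R) -> T = 0.
Proof.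
move=> s mT mY mW mC; have mn n := maxiM Bval (Bn n).
pose d := [:: T; Y; W; C - 18%:R].
have h : forall i, nth 0 d i = 0.
  apply: (@isolated [:: v0 * v1; 1%:P; v0 * v2; v0 * v3; 18%:P + (v0 * v4)]%pol
     [:: cert_h_t_0; cert_h_t_1; cert_h_t_2; cert_h_t_3]); [by vm_compute|by []| |].
  - four.
    + exact: mT.
    + exact: mY.
    + exact: mW.
    + exact: mC.
  - move=> l [|u0 [|u1 [|u2 [|u3 [|]]]]] // _ du; rewrite /map; evs.
    rewrite -(du 0%N : _ = l * u0) -(du 1%N : _ = l * u1) -(du 2%N : _ = l * u2) -(du 3%N : _ = l * u3).
    rewrite [nth _ _ _]/= [nth _ _ _]/= [nth _ _ _]/= [nth _ _ _]/= ?[_ + (_ - _)]addrC ?subrK //.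
have e0 : T = 0 := h 0%N; have e1 : Y = 0 := h 1%N.
have e2 : W = 0 := h 2%N; have e3 : C - 18%:R = 0 := h 3%N.
exact: e0.
Qed.
End Charts.

Section Charts.
Variables (K : numClosedFieldType) (B : set K).
Hypothesis Bval : valuation_subring 7 B.
Let Br : is_subring B. Proof. by case: Bval. Qed.
Notation M := (maxi B).
Notation integral := (integral B).
Notation agrees := (agrees B).
Let mB := maxiB Bval.
Let mP := maxi_prime Bval.

Ltac int := repeat (apply: (integral_cons); [by []|]); exact: (integral_nil Bval).
Ltac agr := repeat (apply: agrees_cons;
  [rewrite ?(evD, evM, evB, evX, ev_var, ev_nat, ev0, ev1) /= ?subr0 ?subrr; first [by left|by []]|]);
  exact: agrees_nil.
Ltac evs := rewrite ?(evD, evM, evB, evX, ev_nat, ev_var, ev0, ev1) /=.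
Ltac certify e S k cs t :=
  match goal with
  | s : sol _ |- _ =>
    have := @sol_certified _ _ Bval _ e S k cs t _ _ _ s;
    evs; apply; [int|int|agr|vm_compute; reflexivity]
  end.

Let B0 : B 0. Proof. exact: subring0. Qed.
Let B1 : B 1. Proof. by case: Br. Qed.
Let Bn n : B n%:R. Proof. exact: subring_nat. Qed.
Let BB x y : B x -> B y -> B (x - y). Proof. by case: Br => _ + _; apply. Qed.
Hint Resolve B0 B1 Bn : core.
Ltac Bs := repeat first [by [] | apply: (subringX Br) | apply: (subringM Br) | apply: BB | apply: (subringD Br) | apply: (subringN Br)].

Let unit_pow c n y : ~ M c -> B c -> B y -> M (c ^+ n * y) -> M y.
Proof.
move=> nc Bc By cy; case: (mP _ By cy) => [|cn|//]; first exact: subringX.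
by case: nc; apply: (maxi_pow Bval Bc cn).
Qed.

Ltac cert_lead intl l0 ml s ds e S' k cs t :=
  have := lead_certified (ds := ds) (e := e) (S' := S') (k := k) (cs := cs) (target := t)
    Bval intl _ l0 ml s;
  evs; apply; [int|agr|vm_compute; reflexivity].

Let unit_not z : ~ M z -> B z -> B z^-1 /\ z != 0.
Proof. by move=> nz Bz; case: (unitP Bz) => [/nz|[]]. Qed.

Lemma vanish_drops (z e : seq K) S ds Ps : head 0 e != 0 -> z = map (ev e) S -> vanish z Ps ->
  vanish e [seq pdropc x.1 (psubst S x.2) | x <- zip ds Ps].
Proof.
move=> e0 zE h; apply: (vanish_map (f := fun d P => pdropc d (psubst S P))) h => d P zP.
by apply: ev_pdropc => //; rewrite ev_subst -zE.
Qed.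

(** The leading forms at the origin have only the trivial common zero modulo 7, whereas a blow-up
    has a coordinate equal to 1. *)
Lemma branch000_empty l a b : l != 0 -> M l -> M a -> M b -> ~ vanish [:: l; a; b] branch000.
Proof.
move=> l00 ml1 ma mb s1; pose zs := [:: l; a; b].
have z0 : has (fun z => z != 0) zs by rewrite /= l00.
have mz i : M (nth 0 zs i) by case: i => [|[|[|i]]] //; rewrite /= nth_nil; left.
have [l' [us [l0 ml su zu [Bu [k kz uk]]]]] := blowup_maxi Bval (zs := zs) (ws := [:: 1; 1; 1]%N) erefl isT z0 mz.
case: us su zu Bu uk => [|x [|y [|z [|]]]] // _ zu Bu uk.
have [Bx By Bz] : [/\ B x, B y & B z] by split; [exact: (Bu 0%N)|exact: (Bu 1%N)|exact: (Bu 2%N)].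
have Bl' : B l' by apply: mB.
have intl : integral [:: l'; x; y; z] by int.
have s : vanish (map (ev [:: l'; x; y; z]) [:: v0 * v1; v0 * v2; v0 * v3]%pol) branch000.
  rewrite /map; evs; rewrite -[l' * x](zu 0%N) -[l' * y](zu 1%N) -[l' * z](zu 2%N); exact: s1.
have my : M y.
  apply: (maxi_pow (n := 6) Bval By).
  by cert_lead intl l0 ml s [:: 2; 4; 3]%N [:: x; y; z] [:: p0; v0; v1; v2] 3%N cert_c_m (v1 ^+ 6)%pol.
have mz' : M z.
  apply: (maxi_pow (n := 4) Bval Bz).
  by cert_lead intl l0 ml s [:: 2; 4; 3]%N [:: x; z] [:: p0; v0; p0; v1] 2%N cert_c_u (v1 ^+ 4)%pol.
have mx : M x.
  apply: (maxi_pow (n := 3) Bval Bx).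
  by cert_lead intl l0 ml s [:: 2; 4; 3]%N [:: x] [:: p0; v0; p0; p0] 1%N cert_c_l (v0 ^+ 3)%pol.
apply: (maxi1 Bval); rewrite -uk; case: k kz {uk} => [|[|[|k]]] //.
Qed.

Lemma branch00_empty m u v : m != 0 -> M m -> M u -> M v -> ~ vanish [:: m; u; v] branch00.
Proof.
move=> m0 mm mu mv s1; pose zs := [:: m; u; v].
have z0 : has (fun z => z != 0) zs by rewrite /= m0.
have mz i : M (nth 0 zs i) by case: i => [|[|[|i]]] //; rewrite /= nth_nil; left.
have [l [us [l0 ml su zu [Bu [k kz uk]]]]] := blowup_maxi Bval (zs := zs) (ws := [:: 1; 1; 2]%N) erefl isT z0 mz.
case: us su zu Bu uk => [|a [|b [|c [|]]]] // _ zu Bu uk.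
have [Ba Bb Bc] : [/\ B a, B b & B c] by split; [exact: (Bu 0%N)|exact: (Bu 1%N)|exact: (Bu 2%N)].
have Bl : B l by apply: mB.
have intl : integral [:: l; a; b; c] by int.
have s : vanish (map (ev [:: l; a; b; c]) [:: v0 * v1; v0 * v2; v0 ^+ 2 * v3]%pol) branch00.
  rewrite /map; evs; rewrite -[l * a](zu 0%N) -[l * b](zu 1%N) -[l ^+ 2 * c](zu 2%N); exact: s1.
have ma : M a.
  apply: (maxi_pow (n := 4) Bval Ba).
  by cert_lead intl l0 ml s [:: 4; 4; 3]%N [:: a; b; c] [:: p0; v0; v1; v2] 3%N cert_a_m (v0 ^+ 4)%pol.
have mb : M b.
  apply: (maxi_pow (n := 3) Bval Bb).
  by cert_lead intl l0 ml s [:: 4; 4; 3]%N [:: b; c] [:: p0; p0; v0; v1] 2%N cert_a_u (v0 ^+ 3)%pol.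
(* As a and b are small, the normalized coordinate is c = 1, so v = l^2. *)
case: k kz uk => [|[|[|k]]] // _ /= uk; try by apply: (maxi1 Bval); rewrite -uk.
apply: (branch000_empty l0 ml ma mb).
have -> : branch000 = branch000_def by vm_compute.
apply: (vanish_drops (z := [:: m; u; v])) => //.
rewrite /map; evs; congr [:: _; _; _]; [exact: (zu 0%N)|exact: (zu 1%N)|].
by rewrite (zu 2%N : v = l ^+ 2 * c) uk mulr1.
Qed.

Lemma branch09_empty m u v : m != 0 -> M m -> M u -> M v -> ~ vanish [:: m; u; v] branch09.
Proof.
move=> m0 mm mu mv s1; pose zs := [:: m; u; v].
have z0 : has (fun z => z != 0) zs by rewrite /= m0.
have mz i : M (nth 0 zs i) by case: i => [|[|[|i]]] //; rewrite /= nth_nil; left.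
have [l [us [l0 ml su zu [Bu [k kz uk]]]]] := blowup_maxi Bval (zs := zs) (ws := [:: 2; 1; 1]%N) erefl isT z0 mz.
case: us su zu Bu uk => [|a [|b [|c [|]]]] // _ zu Bu uk.
have [Ba Bb Bc] : [/\ B a, B b & B c] by split; [exact: (Bu 0%N)|exact: (Bu 1%N)|exact: (Bu 2%N)].
have Bl : B l by apply: mB.
have intl : integral [:: l; a; b; c] by int.
have s : vanish (map (ev [:: l; a; b; c]) [:: v0 ^+ 2 * v1; v0 * v2; v0 * v3]%pol) branch09.
  rewrite /map; evs; rewrite -[l ^+ 2 * a](zu 0%N) -[l * b](zu 1%N) -[l * c](zu 2%N); exact: s1.
have ma : M a.
  by cert_lead intl l0 ml s [:: 2; 2; 1]%N [:: a; b; c] [:: p0; v0; v1; v2] 3%N cert_b_m (pvar 0%N).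
have mb : M b.
  apply: (maxi_pow (n := 2) Bval Bb).
  by cert_lead intl l0 ml s [:: 2; 2; 1]%N [:: b; c] [:: p0; p0; v0; v1] 2%N cert_b_u (v0 ^+ 2)%pol.
have mc : M c.
  by cert_lead intl l0 ml s [:: 2; 2; 1]%N [:: c] [:: p0; p0; p0; v0] 1%N cert_b_v (pvar 0%N).
by apply: (maxi1 Bval); rewrite -uk; case: k kz {uk} => [|[|[|k]]].
Qed.

Lemma branch0_empty m y c : m != 0 -> M m -> M y -> M c -> ~ vanish [:: m; y; c] branch0.
Proof.
move=> m0 mm my mc s1; pose zs := [:: m; y; c].
have z0 : has (fun z => z != 0) zs by rewrite /= m0.
have mz i : M (nth 0 zs i) by case: i => [|[|[|i]]] //; rewrite /= nth_nil; left.
have [l [us [l0 ml su zu [Bu [k kz uk]]]]] := blowup_maxi Bval (zs := zs) (ws := [:: 1; 1; 1]%N) erefl isT z0 mz.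
case: us su zu Bu uk => [|a [|b [|d [|]]]] // _ zu Bu uk.
have [Ba Bb Bd] : [/\ B a, B b & B d] by split; [exact: (Bu 0%N)|exact: (Bu 1%N)|exact: (Bu 2%N)].
have Bl : B l by apply: mB.
(* If a were small, the leading forms would make b and d small too. Hence a is a unit, and y and c
   are integral multiples of m. *)
have na : ~ M a.
  move=> ma; have intl : integral [:: l; a; b; d] by int.
  have s : vanish (map (ev [:: l; a; b; d]) [:: v0 * v1; v0 * v2; v0 * v3]%pol) branch0.
    rewrite /map; evs; rewrite -[l * a](zu 0%N) -[l * b](zu 1%N) -[l * d](zu 2%N); exact: s1.
  have mb : M b.
    apply: (maxi_pow (n := 7) Bval Bb).
    by cert_lead intl l0 ml s [:: 4; 5; 4]%N [:: b; d] [:: p0; p0; v0; v1] 2%N cert_n0_y (v0 ^+ 7)%pol.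
  have md : M d.
    apply: (maxi_pow (n := 4) Bval Bd).
    by cert_lead intl l0 ml s [:: 4; 5; 4]%N [:: d] [:: p0; p0; p0; v0] 1%N cert_n0_c (v0 ^+ 4)%pol.
  by apply: (maxi1 Bval); rewrite -uk; case: k kz {uk} => [|[|[|k]]].
have [Bai a0] := unit_not na Ba.
have mE : m = l * a := zu 0%N; have yE : y = l * b := zu 1%N; have cE : c = l * d := zu 2%N.
pose u := b / a; pose v := d / a.
have Bu' : B u by apply: subringM. have Bv : B v by apply: subringM.
have yu : y = m * u by rewrite yE mE /u mulrAC mulrA divfK // mulrC.
have cv : c = m * v by rewrite cE mE /v mulrAC mulrA divfK // mulrC.
have Bm : B m by apply: mB.
have intl : integral [:: m; u; v] by int.
have s : vanish (map (ev [:: m; u; v]) [:: v0; v0 * v1; v0 * v2]%pol) branch0.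
  by rewrite /map; evs; rewrite -yu -cv.
have mu : M u.
  apply: (maxi_pow (n := 5) Bval Bu').
  by cert_lead intl m0 mm s [:: 4; 5; 4]%N [:: u; v] [:: p0; v0; v1] 2%N cert_n1_y (v0 ^+ 5)%pol.
have Bv2 : B (v - 2%:R) by apply: BB.
have h : M (v ^+ 3 * (v - 2%:R)).
  by cert_lead intl m0 mm s [:: 4; 5; 4]%N [:: v] [:: p0; p0; v0] 1%N cert_n1_c (v0 ^+ 3 * (v0 - 2%:P))%pol.
case: (mP (subringX Br 3 Bv) Bv2 h) => [/(maxi_pow Bval Bv) mv|mv].
  apply: (branch00_empty m0 mm mu mv).
  have -> : branch00 = branch0_blow p0 by vm_compute.
  apply: (vanish_drops (z := [:: m; y; c])) => //.
  by rewrite /map; evs; rewrite add0r -yu -cv.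
(* The integer 9 lifts the residue 2; [branch09] has to be centred at an integer where its lowest
   terms cancel over Z. *)
have mv' : M (v - 9%:R).
  have -> : v - 9%:R = v - 2%:R - 7%:R by ring.
  by apply: (maxiBB Bval) => //; exact: maxi7.
apply: (branch09_empty m0 mm mu mv').
have -> : branch09 = branch0_blow 9%:P%pol by vm_compute.
apply: (vanish_drops (z := [:: m; y; c])) => //.
by rewrite /map; evs; rewrite [9%:R + _]addrC subrK -yu -cv.
Qed.
End Charts.

Definition branch_X_pol := branch_pol branch_X v0 v1.
Definition branch_W_pol := branch_pol branch_W v0 v1.
Definition branch_weights := [:: v0 * v1; v0 ^+ 2 * v2]%pol.
(** T is scaled to 2. The remainders of 2 X and 64 W get weight 6, beyond the weights of the
    subtracted expansions; 36 = 4 * 9 and 108 = 4 * 27 restore 4 Y and 4 C. *)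
Definition branch_half_subst P Q := [:: 2%:P; psubst branch_weights P + (v0 ^+ 6 * v3);
  36%:P * (v0 * v1); psubst branch_weights Q + (v0 ^+ 6 * v4); 108%:P * (v0 ^+ 2 * v2)]%pol.

Section Charts.
Variables (K : numClosedFieldType) (B : set K).
Hypothesis Bval : valuation_subring 7 B.
Let Br : is_subring B. Proof. by case: Bval. Qed.
Notation M := (maxi B).
Notation integral := (integral B).
Notation agrees := (agrees B).
Let mB := maxiB Bval.
Let mP := maxi_prime Bval.

Ltac int := repeat (apply: (integral_cons); [by []|]); exact: (integral_nil Bval).
Ltac agr := repeat (apply: agrees_cons;
  [rewrite ?(evD, evM, evB, evX, ev_var, ev_nat, ev0, ev1) /= ?subr0 ?subrr; first [by left|by []]|]);
  exact: agrees_nil.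
Ltac evs := rewrite ?(evD, evM, evB, evX, ev_nat, ev_var, ev0, ev1) /=.
Ltac certify e S k cs t :=
  match goal with
  | s : sol _ |- _ =>
    have := @sol_certified _ _ Bval _ e S k cs t _ _ _ s;
    evs; apply; [int|int|agr|vm_compute; reflexivity]
  end.

Let B0 : B 0. Proof. exact: subring0. Qed.
Let B1 : B 1. Proof. by case: Br. Qed.
Let Bn n : B n%:R. Proof. exact: subring_nat. Qed.
Let BB x y : B x -> B y -> B (x - y). Proof. by case: Br => _ + _; apply. Qed.
Hint Resolve B0 B1 Bn : core.
Ltac Bs := repeat first [by [] | apply: (subringX Br) | apply: (subringM Br) | apply: BB | apply: (subringD Br) | apply: (subringN Br)].

Let unit_pow c n y : ~ M c -> B c -> B y -> M (c ^+ n * y) -> M y.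
Proof.
move=> nc Bc By cy; case: (mP _ By cy) => [|cn|//]; first exact: subringX.
by case: nc; apply: (maxi_pow Bval Bc cn).
Qed.

Ltac cert_lead intl l0 ml s ds e S' k cs t :=
  have := lead_certified (ds := ds) (e := e) (S' := S') (k := k) (cs := cs) (target := t)
    Bval intl _ l0 ml s;
  evs; apply; [int|agr|vm_compute; reflexivity].

Let unit_not z : ~ M z -> B z -> B z^-1 /\ z != 0.
Proof. by move=> nz Bz; case: (unitP Bz) => [/nz|[]]. Qed.

Lemma ev_weliminate (w : K) u e0 c0 cs : ev u c0 != 0 -> ev u e0 + w * ev u c0 = 0 ->
  horner w u cs = 0 -> ev u (weliminate e0 c0 cs) = 0.
Proof.
move=> c00 lin h0; rewrite /weliminate; set f := fun _ _ => _.
have key : ev u (foldr f (p0, p1) cs).2 = ev u c0 ^+ size cs /\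
    ev u c0 * ev u (foldr f (p0, p1) cs).1 = ev u c0 ^+ size cs * horner w u cs.
  elim: cs {h0} => [|c cs [IH2 IH1]] /=; first by rewrite ev1 ev0 expr0 !mulr0.
  rewrite evM IH2 -exprSr; split=> //; rewrite evD !evM evN IH2.
  have -> : - ev u e0 = w * ev u c0 by exact: addr0_eq lin.
  rewrite mulrDr mulrA IH1 !exprS; ring.
by apply: (mulfI c00); rewrite key.2 h0 !mulr0.
Qed.

(** If C were nonzero, the blow-up with weights 1, 1, 2, 1 would have X as its dominant coordinate.
    The first equation then eliminates w, and [branch0_empty] excludes the other three. *)
Lemma branch_zero X Y W C : sol [:: 1; X; Y; W; C] -> M X -> M Y -> M W -> M C -> C = 0.
Proof.
move=> s1 mX mY mW mC; have [//|C0] := eqVneq C 0; exfalso; pose zs := [:: X; Y; W; C].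
have z0 : has (fun z => z != 0) zs by rewrite /= C0 !orbT.
have mz i : M (nth 0 zs i) by case: i => [|[|[|[|i]]]] //; rewrite /= nth_nil; left.
have [l [us [l0 ml su zu [Bu [k kz uk]]]]] := blowup_maxi Bval (zs := zs) (ws := [:: 1; 1; 2; 1]%N) erefl isT z0 mz.
case: us su zu Bu uk => [|a [|b [|w [|c [|]]]]] // _ zu Bu uk.
have [Ba Bb Bw Bc] : [/\ B a, B b, B w & B c].
  by split; [exact: (Bu 0%N)|exact: (Bu 1%N)|exact: (Bu 2%N)|exact: (Bu 3%N)].
have Bl : B l by apply: mB.
have intl : integral [:: l; a; b; w; c] by int.
have s : vanish (map (ev [:: l; a; b; w; c]) [:: p1; v0 * v1; v0 * v2; v0 ^+ 2 * v3; v0 * v4]%pol) eqns_nf.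
  rewrite /map; evs; rewrite -[l * a](zu 0%N) -[l * b](zu 1%N) -[l ^+ 2 * w](zu 2%N) -[l * c](zu 3%N).
  exact: s1.
have mw : M w.
  apply: (maxi_pow (n := 3) Bval Bw).
  by cert_lead intl l0 ml s [:: 3; 3; 4; 4]%N [:: a; b; w; c] [:: p0; v0; v1; v2; v3] 4%N cert_q0_w (v2 ^+ 3)%pol.
have mb : M b.
  apply: (maxi_pow (n := 5) Bval Bb).
  by cert_lead intl l0 ml s [:: 3; 3; 4; 4]%N [:: a; b; c] [:: p0; v0; v1; p0; v2] 3%N cert_q0_y (v1 ^+ 5)%pol.
have mc : M c.
  apply: (maxi_pow (n := 3) Bval Bc).
  by cert_lead intl l0 ml s [:: 3; 3; 4; 4]%N [:: a; c] [:: p0; v0; p0; p0; v1] 2%N cert_q0_c (v1 ^+ 3)%pol.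
have {k kz uk} a1 : a = 1.
  by case: k kz uk => [|[|[|[|k]]]] //= _ u1; case: (maxi1 Bval); rewrite -u1.
have XE : X = l by rewrite (zu 0%N : X = l * a) a1 mulr1.
have YE : Y = l * b := zu 1%N. have WE : W = l ^+ 2 * w := zu 2%N. have CE : C = l * c := zu 3%N.
have n20 : 2%:R != 0 :> K by rewrite pnatr_eq0.
pose c' := 2%:R^-1 * c; pose y := b + 9%:R * l - c'.
have mc' : M c' by apply: (maxiM Bval) => //; exact: (unit_nat Bval (n := 2)).
have my : M y.
  by apply: (maxiBB Bval) => //; apply: (maxiD Bval) => //; apply: (maxiM Bval).
have cE : c = 2%:R * c' by rewrite mulVKf.
pose e := [:: l; w; y; c'].
have sE : vanish [:: w; l; y; c'] branch0_eqns.
  apply: (vanish_map (f := fun d P => psubst [:: v1; v0; v2; v3] (pdropc d (psubst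
    [:: p1; v0; v0 * (((v2 - 9%:P * v0)) + v3); v0 ^+ 2 * v1; 2%:P * (v0 * v3)]%pol P)))) s1 => d P zP.
  rewrite ev_subst; have -> : map (ev [:: w; l; y; c']) [:: v1; v0; v2; v3] = e by rewrite /map !ev_var.
  apply: ev_pdropc => //; rewrite ev_subst /map -{}zP; congr ev; evs.
  rewrite XE YE WE CE [in l * c]cE /y; congr [:: _; _; _; _; _]; ring.
pose u := [:: l; y; c'].
have intu : integral u by do 3?[apply: integral_cons; first exact: mB]; exact: integral_nil.
have [e0 lE] : exists e0, branch0_linear = [:: e0; branch0_c0].
  by exists (nth p0 branch0_linear 0); vm_compute.
have lin : ev u e0 + w * ev u branch0_c0 = 0.
  have := sE 0%N; rewrite ev_split -[psplit _]/branch0_linear lE => <-.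
  by rewrite /horner /foldr mulr0 addr0.
(* The coefficient of w has constant term 1 modulo 7. *)
have c0u : ~ M (ev u branch0_c0).
  move=> mc0; apply: (maxi1 Bval).
  have int0 := integral_nil Bval.
  have r0 : M (ev [::] (reduced [:: p0; p0; p0] branch0_c0)).
    apply: (maxi_reduced Bval intu int0 _ mc0).
    by do 3?[apply: agrees_cons; first by rewrite ev0 subr0]; exact: agrees_nil.
  have all0 : all_maxi B [::] [:: reduced [:: p0; p0; p0] branch0_c0].
    case=> [|i]; first exact: r0.
    by rewrite -[nth _ _ _]/(nth p0 [::] i) nth_nil ev0; left.
  have := certified Bval (k := 0) (cs := [:: [:: BinNat.N.of_nat 1]]) (target := p1) int0 _ all0.
  by rewrite ev1; apply; vm_compute.
have c00 : ev u branch0_c0 != 0 by apply/eqP => c00; apply: c0u; rewrite c00; left.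
apply: (branch0_empty Bval l0 ml my mc').
have -> : branch0 = branch0_elim by vm_compute.
have -> : branch0_elim = [seq weliminate e0 branch0_c0 (psplit P) | P <- behead branch0_eqns].
  by rewrite /branch0_elim lE.
move=> i.
have [is_|is_] := ltnP i (size (behead branch0_eqns)); last first.
  by rewrite nth_default ?size_map ?is_ // ev0.
rewrite (nth_map p0 p0 _ is_) nth_behead; apply: (ev_weliminate c00 lin).
by rewrite -ev_split; exact: sE.
Qed.

(** Subtracting the expansions of X and W in Y and C flattens the equations. In the blow-up with
    weights 1, 2, 6, 6 the leading forms make all four coordinates small, which is impossible if C
    is nonzero. *)
Lemma branch_half X Y W C :
  sol [:: 2%:R; 2%:R * X; 4%:R * Y; 64%:R * W; 4%:R * C] ->
  M (2%:R * X + 1) -> M Y -> M W -> M C -> C = 0.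
Proof.
move=> s1 mX mY mW mC; have [//|C0] := eqVneq C 0; exfalso.
have n90 : 9%:R != 0 :> K by rewrite pnatr_eq0.
have n270 : 27%:R != 0 :> K by rewrite pnatr_eq0.
pose a0 := 9%:R^-1 * Y; pose c0 := 27%:R^-1 * C.
have ma0 : M a0 by apply: (maxiM Bval) => //; exact: (unit_nat Bval (n := 9)).
have mc0 : M c0 by apply: (maxiM Bval) => //; exact: (unit_nat Bval (n := 27)).
pose r0 := 2%:R * X - ev [:: a0; c0] branch_X_pol.
pose s0 := 64%:R * W - ev [:: a0; c0] branch_W_pol.
have int0 : integral [:: a0; c0] by do 2?[apply: integral_cons; first exact: mB]; exact: integral_nil.
have small P : M (ev [:: a0; c0] P - ev [:: 0; 0] P).
  apply: (ev_congr Bval) => //; first by int.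
  by case=> [|[|i]] /=; rewrite ?subr0 // !nth_nil subrr; left.
have mr0 : M r0.
  have PX0 : ev [:: 0; 0] branch_X_pol = - 1 :> K.
    have c : peq (psubst [:: p0; p0] branch_X_pol) (popp p1) by vm_compute.
    have := ev_eq ([::] : seq K) c.
    move=> h; apply: etrans (etrans (esym (ev_subst [::] [:: p0; p0] branch_X_pol)) h) _.
    exact: etrans (evN _ p1) (congr1 _ (ev1 _)).
  have -> : r0 = (2%:R * X + 1) - (ev [:: a0; c0] branch_X_pol - ev [:: 0; 0] branch_X_pol).
    by rewrite PX0 /r0; ring.
  exact: (maxiBB Bval).
have ms0 : M s0.
  have PW0 : ev [:: 0; 0] branch_W_pol = 0 :> K.
    have c : peq (psubst [:: p0; p0] branch_W_pol) p0 by vm_compute.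
    have := ev_eq ([::] : seq K) c.
    by move=> h; apply: etrans (etrans (esym (ev_subst [::] [:: p0; p0] branch_W_pol)) h) _.
  apply: (maxiBB Bval); first exact: (maxiM Bval).
  by have := small branch_W_pol; rewrite PW0 subr0.
pose zs := [:: a0; c0; r0; s0].
have z0 : has (fun z => z != 0) zs.
  by apply/hasP; exists c0; rewrite ?inE ?eqxx ?orbT // mulf_neq0 // invr_neq0.
have mz i : M (nth 0 zs i) by case: i => [|[|[|[|i]]]] //; rewrite /= nth_nil; left.
have [l [us [l0 ml su zu [Bu [k kz uk]]]]] := blowup_maxi Bval (zs := zs) (ws := [:: 1; 2; 6; 6]%N) erefl isT z0 mz.
case: us su zu Bu uk => [|a [|c [|r [|t [|]]]]] // _ zu Bu uk.
have [Ba Bc Br' Bt] : [/\ B a, B c, B r & B t].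
  by split; [exact: (Bu 0%N)|exact: (Bu 1%N)|exact: (Bu 2%N)|exact: (Bu 3%N)].
have Bl : B l by apply: mB.
have intl : integral [:: l; a; c; r; t] by int.
have aE : a0 = l * a := zu 0%N. have cE : c0 = l ^+ 2 * c := zu 1%N.
have rE : r0 = l ^+ 6 * r := zu 2%N. have tE : s0 = l ^+ 6 * t := zu 3%N.
have SxE : map (ev [:: l; a; c; r; t]) branch_weights = [:: a0; c0].
  by rewrite /branch_weights /map; evs; rewrite aE cE.
have gen P Q : 2%:R * X = ev [:: a0; c0] P + l ^+ 6 * r -> 64%:R * W = ev [:: a0; c0] Q + l ^+ 6 * t ->
  vanish (map (ev [:: l; a; c; r; t]) (branch_half_subst P Q)) eqns_nf.
  move=> eX eW; rewrite /branch_half_subst /map !(ev_nat, evD, ev_subst) SxE; evs.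
  rewrite -eX -eW -aE -cE /a0 /c0.
  have -> : 36%:R * (9%:R^-1 * Y) = 4%:R * Y by field.
  by have -> : 108%:R * (27%:R^-1 * C) = 4%:R * C by field.
have s := gen branch_X_pol branch_W_pol (etrans (esym (subrKC _ _)) (congr1 _ rE))
  (etrans (esym (subrKC _ _)) (congr1 _ tE)).
have mt : M t.
  by cert_lead intl l0 ml s [:: 6; 6; 6; 4]%N [:: a; c; r; t] [:: p0; v0; v1; v2; v3] 4%N cert_q1_s (pvar 3%N).
have mc : M c.
  apply: (maxi_pow (n := 4) Bval Bc).
  by cert_lead intl l0 ml s [:: 6; 6; 6; 4]%N [:: a; c; r] [:: p0; v0; v1; v2; p0] 3%N cert_q1_c (v1 ^+ 4)%pol.
have ma : M a.
  apply: (maxi_pow (n := 4) Bval Ba).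
  by cert_lead intl l0 ml s [:: 6; 6; 6; 4]%N [:: a; r] [:: p0; v0; p0; v1; p0] 2%N cert_q1_a (v0 ^+ 4)%pol.
have mr : M r.
  by cert_lead intl l0 ml s [:: 6; 6; 6; 4]%N [:: r] [:: p0; p0; p0; v0; p0] 1%N cert_q1_r (pvar 0%N).
by apply: (maxi1 Bval); rewrite -uk; case: k kz {uk} => [|[|[|[|k]]]].
Qed.
End Charts.

(** At C = 1/2 the three cases read T^2 = 1, 4, 9, with (a_2, a_3, a_7) equal to (0, 0, 0), (T/2, 0,
    0), (0, 1, 2). *)
Definition theta_point (K : fieldType) (T X Y W C : K) :=
  [\/ [/\ X = 0, Y = 0, W = 0 & 2%:R * C = T ^+ 2],
      [/\ 12%:R * X = T, Y = 0, W = 0 & 8%:R * C = T ^+ 2] |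
      [/\ X = 0, 54%:R * Y = T ^+ 2, 2187%:R * W = T ^+ 6 & 18%:R * C = T ^+ 2]].

Lemma theta_point_scale (K : fieldType) (T X Y W C l : K) : l != 0 ->
  theta_point (l * T) (l * X) (l ^+ 2 * Y) (l ^+ 6 * W) (l ^+ 2 * C) -> theta_point T X Y W C.
Proof.
move=> l0; have l2 : l ^+ 2 != 0 by rewrite expf_neq0.
have l6 : l ^+ 6 != 0 by rewrite expf_neq0.
have z (a x : K) : a != 0 -> a * x = 0 -> x = 0.
  by move=> a0 /eqP; rewrite mulf_eq0 (negPf a0) => /eqP.
by case=> -[]; rewrite ?exprMn ?[_%:R * (_ * _)]mulrCA => hx hy hw hc;
  [constructor 1|constructor 2|constructor 3]; split;
  ((by apply: z hx) || (by apply: z hy) || (by apply: z hw) || (by apply: (mulfI l0)) ||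
   (by apply: (mulfI l2)) || (by apply: (mulfI l6))).
Qed.

(** * Assembling the charts *)

Section Charts.
Variables (K : numClosedFieldType) (B : set K).
Hypothesis Bval : valuation_subring 7 B.
Let Br : is_subring B. Proof. by case: Bval. Qed.
Notation M := (maxi B).
Let mB := maxiB Bval.
Let B1 : B 1. Proof. by case: Br. Qed.
Let Bn n : B n%:R. Proof. exact: subring_nat. Qed.

Lemma solutions_T X Y W C : B X -> B Y -> B W -> B C -> C != 0 ->
  hsol 1 X Y W C -> theta_point 1 X Y W C.
Proof.
move=> BX BY BW BC C0 h; have s := hsol_sol h.
have sc n : sol [:: n%:R; n%:R * X; n%:R ^+ 2 * Y; n%:R ^+ 6 * W; n%:R ^+ 2 * C].
  by have := h n%:R; rewrite mulr1.
have half : sol [:: 2%:R; 2%:R * X; 4%:R * Y; 64%:R * W; 4%:R * C].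
  by have := sc 2%N; rewrite -!natrX.
case: (unitP BC) => [mC|[_ _ nC]].
  have [mY mW [mX|mX]] := chart_infinity Bval BX BY BW BC s mC.
    by have := branch_zero Bval s mX mY mW mC => /eqP; rewrite (negPf C0).
  have mX' : M (2%:R * X + 1).
    have -> : 2%:R * X + 1 = 2%:R * (X - 3%:R) + 7%:R by ring.
    by apply: (maxiD Bval); [exact: (maxiM Bval)|exact: maxi7].
  by have := branch_half Bval half mX' mY mW mC => /eqP; rewrite (negPf C0).
case: (unitP BX) => [mX|[_ _ nX]].
  case: (chart_x0 Bval BX BY BW BC s nC mX) => -[mY mW mC].
    have [-> -> -> e] := isolated_theta_Z Bval half mX mY mW mC.
    by constructor 1; rewrite e expr1n.
  constructor 3; rewrite !expr1n; apply: (isolated_theta_Zzeta3 Bval _ mX mY mW mC).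
  have := sc 18%N; rewrite -[18%:R ^+ 2]natrX.
  have -> : 18%:R ^+ 6 * W = 216%:R * 72%:R * (2187%:R * W).
    by rewrite !mulrA; congr (_ * _); rewrite (natrM _ 2 9) (natrM _ 8 27) (natrM _ 8 9) (natrM _ 81 27) (natrM _ 9 9) (natrM _ 9 3); ring.
  by [].
have [mY mW mX mC] := chart_x_unit Bval BX BY BW BC s nC nX.
constructor 2; rewrite !expr1n; apply: (isolated_theta_Zi Bval _ mX mY mW mC).
have := sc 12%N; rewrite -[12%:R ^+ 2]natrX.
have -> : 12%:R ^+ 6 * W = 1728%:R ^+ 2 * W.
  by congr (_ * _); rewrite -[6%N]/(3 * 2)%N exprM -[12%:R ^+ 3]natrX.
by [].
Qed.

Lemma solutions_integral T X Y W C : B T -> B X -> B Y -> B W -> B C -> T != 0 -> C != 0 ->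
  ~ [/\ M T, M X, M Y, M W & M C] -> hsol T X Y W C -> theta_point T X Y W C.
Proof.
move=> BT BX BY BW BC T0 C0 nM h.
have key l : B l -> l != 0 -> hsol (l * T) (l * X) (l ^+ 2 * Y) (l ^+ 6 * W) (l ^+ 2 * C).
  by move=> _ _; apply: hsol_scale.
case: (unitP BT) => [mT|[_ BT' nT]].
  exfalso; case: (unitP BX) => [mX|[X0 BX' nX]]; last first.
    have := key X^-1 BX' (invr_neq0 X0); rewrite mulVf // => /hsol_sol s.
    have mTX : M (X^-1 * T) by apply: (maxiM Bval).
    have BX2 n : B (X^-1 ^+ n) by apply: subringX.
    have [mY mW mC] := chart_t0 Bval (mB mTX) (subringM Br (BX2 _) BY) (subringM Br (BX2 _) BW) (subringM Br (BX2 _) BC) s mTX.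
    have /eqP := isolated_degenerate Bval s mTX mY mW mC.
    by rewrite mulf_eq0 invr_eq0 (negPf X0) (negPf T0).
  (* C is made equal to 1 when it is a unit *)
  have [e [e0 Be eC]] : exists e, [/\ e != 0, B e & e ^+ 2 * C = 1 \/ e = 1 /\ M C].
    case: (unitP BC) => [mC|[_ BC' _]]; first by exists 1; rewrite oner_neq0; split=> //; right.
    exists (sqrtC C^-1); split; first by rewrite sqrtC_eq0 invr_eq0.
      case: Bval => _ BV _; case: (BV (sqrtC C^-1)) => // Bi.
      have -> : sqrtC C^-1 = (sqrtC C^-1)^-1 * C^-1.
        by rewrite -{3}(sqrtCK C^-1) expr2 mulKf // sqrtC_eq0 invr_eq0.
      exact: subringM.
    by left; rewrite sqrtCK mulVf.
  have s := hsol_sol (key e Be e0).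
  have eC' : e ^+ 2 * C = 1 \/ M (e ^+ 2 * C).
    by case: eC => [|[-> mC]]; [left|right; rewrite expr1n mul1r].
  have BeX n z : B z -> B (e ^+ n * z) by move=> Bz; apply: subringM => //; apply: subringX.
  have BeM n z : M z -> M (e ^+ n * z) by move=> mz; apply: (maxiM Bval) => //; apply: subringX.
  have [mC mYW] : M (e ^+ 2 * C) /\ M (e ^+ 2 * Y) /\ M (e ^+ 6 * W).
    have eT0 : e * T != 0 by rewrite mulf_neq0.
    have [BXT|BXT'] := pselect (B (X / T)).
      have XE : e * X = e * T * (X / T) by rewrite -mulrA [T * _]mulrC divfK.
      rewrite XE in s; apply: (chart_origin_T Bval _ BXT (BeX _ _ BY) (BeX _ _ BW) (BeX _ _ BC) eT0 _ s eC').
        exact: subringM.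
      exact: (maxiM Bval).
    have eX0 : e * X != 0.
      rewrite mulf_neq0 //; apply/eqP => X0; case: BXT'.
      by rewrite X0 mul0r; exact: subring0.
    have mTX : M (T / X) by right; rewrite invf_div.
    have TE : e * T = e * X * (T / X).
      by rewrite -mulrA [X * _]mulrC divfK //; apply: contraNneq eX0 => ->; rewrite mulr0.
    rewrite TE in s; apply: (chart_origin_X Bval _ _ (BeX _ _ BY) (BeX _ _ BW) (BeX _ _ BC) eX0 _ mTX s eC').
    - exact: subringM.
    - exact: mB.
    - exact: (maxiM Bval).
  case: eC mC mYW => [-> /(maxi1 Bval) //|[-> mC _]].
  by rewrite !expr1n !mul1r => -[mY mW]; apply: nM.
have := key T^-1 BT' (invr_neq0 T0); rewrite mulVf // => hT.
have BX2 n z : B z -> B (T^-1 ^+ n * z) by move=> Bz; apply: subringM => //; apply: subringX.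
apply: (theta_point_scale (invr_neq0 T0)); rewrite mulVf //.
apply: solutions_T => //; try exact: BX2; first exact: subringM.
by rewrite mulf_neq0 // expf_neq0 // invr_neq0.
Qed.

(** The blow-up with the weights 1, 1, 2, 6, 2 of T, X, Y, W, C normalizes a point of weighted
    projective space: integral coordinates, one of them equal to 1. *)
Lemma solutions (T X Y W C : K) : T != 0 -> C != 0 -> hsol T X Y W C -> theta_point T X Y W C.
Proof.
move=> T0 C0 h; pose zs := [:: T; X; Y; W; C].
have z0 : has (fun z => z != 0) zs by rewrite /= T0.
have [l [us [l0 su zu Bu [k kz uk]]]] := blowup Bval (zs := zs) (ws := [:: 1; 1; 2; 6; 2]%N) erefl isT z0.
case: us su zu Bu uk => [|t [|x [|y [|w [|c [|]]]]]] // _ zu Bu uk.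
have TE : T = l * t := zu 0%N. have XE : X = l * x := zu 1%N. have YE : Y = l ^+ 2 * y := zu 2%N.
have WE : W = l ^+ 6 * w := zu 3%N. have CE : C = l ^+ 2 * c := zu 4%N.
have li0 : l^-1 != 0 by rewrite invr_eq0.
have cancel n z : l^-1 ^+ n * (l ^+ n * z) = z by rewrite mulrA -exprMn mulVf // expr1n mul1r.
have h' : hsol t x y w c.
  have := hsol_scale l^-1 h; rewrite TE XE YE WE CE !cancel.
  by rewrite !(cancel 1%N).
apply: (theta_point_scale li0); rewrite TE XE YE WE CE !cancel !(cancel 1%N).
apply: solutions_integral => //.
- exact: (Bu 0%N). - exact: (Bu 1%N). - exact: (Bu 2%N). - exact: (Bu 3%N). - exact: (Bu 4%N).
- by apply: contraNneq T0 => t0; rewrite TE t0 mulr0.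
- by apply: contraNneq C0 => c0; rewrite CE c0 mulr0.
move=> [m0 m1 m2 m3 m4]; apply: (maxi1 Bval); rewrite -uk.
by case: k kz {uk} => [|[|[|[|[|k]]]]].
Qed.
End Charts.

Theorem homogeneous_solutions (K : numClosedFieldType) (T X Y W C : K) :
  T != 0 -> C != 0 -> hsol T X Y W C -> theta_point T X Y W C.
Proof.
have [B Bval] := exists_valuation_subring K (isT : 1 < 7)%N.
by move=> T0 C0 h; apply: (solutions Bval T0 C0 h).
Qed.

End Charts.

(** * From the homogenized equations back to multiplicative sequences *)

Module Coefficients.
Import all_boot all_order all_algebra ring zify.
Import GRing.Theory Num.Theory.
Local Open Scope ring_scope.
Import Elimination Valuation Certificates Data Charts.

Definition mult (K : pzRingType) (g : nat -> K) :=
  forall r s, (0 < r)%N -> (0 < s)%N -> coprime r s -> g (r * s)%N = g r * g s.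

Definition twist (K : pzRingType) (e : K) (g : nat -> K) n := e ^+ n.-1 * g n.

Lemma conv_twist (K : comPzRingType) (e : K) g n : e * conv (twist e g) n = e ^+ n.-1 * conv g n.
Proof.
rewrite /conv !mulr_sumr; apply: eq_big_nat => i /andP[i0 lin].
have -> : twist e g i * twist e g (n - i) = e ^+ (i.-1 + (n - i).-1)%N * (g i * g (n - i)%N).
  by rewrite exprD mulrACA.
rewrite mulrA -exprS; congr (_ ^+ _ * _); lia.
Qed.

Lemma next_twist (K : comPzRingType) (e : K) k T g n :
  next k (e * T) (twist e g) n = twist e (next k T g) n.
Proof.
rewrite /next; have -> : k%:R * (e * T) * conv (twist e g) n = k%:R * T * (e * conv (twist e g) n) by ring.
by rewrite conv_twist /twist; ring.
Qed.

Lemma conv_ext (K : pzRingType) (f g : nat -> K) n : (forall i, (0 < i < n)%N -> f i = g i) ->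
  conv f n = conv g n.
Proof.
move=> fg; apply: eq_big_nat => i i_n; rewrite !fg //; lia.
Qed.

Lemma next_ext (K : pzRingType) k T (f g : nat -> K) n : (forall i, (0 < i <= n)%N -> f i = g i) ->
  (0 < n)%N -> next k T f n = next k T g n.
Proof.
move=> fg n0; rewrite /next fg ?n0 /= //; congr (_ + _ * _).
by apply: conv_ext => i i_n; apply: fg; lia.
Qed.

Lemma hmult_twist (K : comPzRingType) (e : K) g : mult g -> hmult (e ^+ 2) (twist e g).
Proof.
move=> gm r s r0 s0 crs; rewrite /twist gm //; set k := (_ ./2)%N.
have -> : (e ^+ 2) ^+ k * (e ^+ r.-1 * g r * (e ^+ s.-1 * g s)) =
    e ^+ (2 * k + r.-1 + s.-1)%N * (g r * g s).
  by rewrite (exprD _ _ s.-1) (exprD _ _ r.-1) (exprM e 2 k); ring.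
congr (_ ^+ _ * _); rewrite {}/k.
(* Coprime r and s are not both even, so (r - 1)(s - 1) is even and halving it loses nothing. *)
have : ~~ (odd r.-1 && odd s.-1).
  apply/andP => -[o1 o2]; have : (2 %| gcdn r s)%N by rewrite dvdn_gcd !dvdn2; lia.
  by rewrite (eqP crs).
case: r r0 {crs} => // r _; case: s s0 => // s _ /=.
rewrite -oddM => /negPf o; have := odd_double_half (r * s); rewrite o add0n; lia.
Qed.

Lemma eqns_origin (K : comNzRingType) : sol (nseq 5 (0 : K)).
Proof.
have z : all (fun P => peq (psubst (nseq 5 p0) P) p0) eqns_nf by vm_compute.
move=> i; have [il|il] := ltnP i (size eqns_nf); last by rewrite nth_default // ev0.
have := all_nthP p0 z i il => /(ev_eq ([::] : seq K)).
by rewrite ev_subst ev0.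
Qed.

Lemma hmult_ext (K : pzRingType) (C : K) (f g : nat -> K) : f =1 g -> hmult C f -> hmult C g.
Proof. by move=> fg h r s r0 s0 c; rewrite -!fg; apply: h. Qed.

Section SmallCoefs.
Variables (K : numClosedFieldType) (T : K) (a : nat -> K).
Hypotheses (T0 : T != 0) (a1 : a 1%N = 1) (am : mult a) (bm : mult (next 1 T a))
  (dm : mult (next 2 T (next 1 T a))).
Let n2 : 2%:R != 0 :> K. Proof. by rewrite pnatr_eq0. Qed.
Let n3 : 3%:R != 0 :> K. Proof. by rewrite pnatr_eq0. Qed.
Let n6 : 6%:R != 0 :> K. Proof. by rewrite pnatr_eq0. Qed.

(** The twist of [a] by e satisfies the relations with e T for T and e^2/2 for C. The value e = 0 is
    checked directly, because the elimination divides by T. *)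
Lemma mult_hsol : hsol T (a 2 / 6%:R) (a 3 / 6%:R) (a 7 / 6%:R) 2%:R^-1.
Proof.
move=> e; have [->|e0] := eqVneq e 0.
  by rewrite ?expr0n /= ?mul0r; exact: eqns_origin.
move=> i; rewrite -eqnsE; pose a' := twist e a.
have C2 : 2%:R * (e ^+ 2 * 2%:R^-1) = e ^+ 2 by rewrite mulrCA divff ?mulr1.
have eT0 : e * T != 0 by rewrite mulf_neq0.
have h := @eqns_vanish K (e * T) (e ^+ 2 * 2%:R^-1) a' n2 n3 eT0 _ _ _ _ i.
have -> : [:: e * T; e * (a 2 / 6%:R); e ^+ 2 * (a 3 / 6%:R); e ^+ 6 * (a 7 / 6%:R); e ^+ 2 * 2%:R^-1] =
  env (e * T) (e ^+ 2 * 2%:R^-1) a' by rewrite /env /a' /twist /= expr1 !mulrA.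
have bt := next_twist e 1 T a.
have dt : forall n, twist e (next 2 T (next 1 T a)) n = next 2 (e * T) (next 1 (e * T) a') n.
  move=> n; rewrite -next_twist /next /conv -bt; congr (_ + _ * _).
  by apply: eq_bigr => j _; rewrite -!bt.
apply: h; rewrite ?C2; first by rewrite /a' /twist expr0 mul1r.
- exact: hmult_twist.
- by apply: (hmult_ext _ (hmult_twist e bm)) => n; rewrite bt.
- by apply: (hmult_ext _ (hmult_twist e dm)) => n; rewrite dt.
Qed.

Lemma small_coefs : exists2 s : K, s ^+ 2 = 1 &
  [\/ [/\ T = s, a 2 = 0, a 3 = 0 & a 7 = 0],
      [/\ T = 2%:R * s, a 2 = s, a 3 = 0 & a 7 = 0] |
      [/\ T = 3%:R * s, a 2 = 0, a 3 = 1 & a 7 = 2%:R]].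
Proof.
have c0 : 2%:R^-1 != 0 :> K by rewrite invr_neq0.
have d6 x : x / 6%:R = 0 -> x = 0 :> K.
  by move=> /eqP; rewrite mulf_eq0 invr_eq0 (negPf n6) orbF => /eqP.
case: (homogeneous_solutions T0 c0 mult_hsol) => -[x0 y0 w0 cT].
- exists T; first by rewrite -cT divff.
  by constructor 1; split=> //; apply: d6.
- exists (T / 2%:R).
    by rewrite expr_div_n -cT; field.
  constructor 2; split; [by rewrite mulrC divfK| |exact: d6|exact: d6].
  by rewrite -x0; field.
- have T2 : T ^+ 2 = 9%:R by rewrite -cT; field.
  exists (T / 3%:R); first by rewrite expr_div_n T2; field.
  constructor 3; split; [by rewrite mulrC divfK|exact: d6| |].
    have -> : a 3 = 54%:R * (a 3 / 6%:R) / 9%:R by field.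
    by rewrite y0 T2 divff // pnatr_eq0.
  have -> : a 7 = 2187%:R * (a 7 / 6%:R) * 6%:R / 2187%:R by field.
  by rewrite w0 -[6%N]/(2 * 3)%N exprM T2; field.
Qed.
End SmallCoefs.

(** * Prime powers near a power of 2 *)

Definition splits n := ~~ (pdiv n).-nat n.

Lemma splitsE n : (1 < n)%N -> splits n ->
  exists r s, [/\ (1 < r)%N, (1 < s)%N, coprime r s & n = (r * s)%N].
Proof.
move=> n1 sn; have n0 := ltnW n1; exists (n`_(pdiv n))%N, (n`_(pdiv n)^')%N; split.
- by rewrite p_part -(exp1n (logn (pdiv n) n)) ltn_exp2r ?prime_gt1 ?pdiv_prime // -pfactor_dvdn ?pdiv_prime // expn1 pdiv_dvd.
- rewrite ltn_neqAle part_gt0 andbT; apply: contra sn => /eqP e1.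
  rewrite -[X in _.-nat X](partnC (pdiv n) n0) -e1 muln1; exact: part_pnat.
- exact: coprime_partC.
- by rewrite partnC.
Qed.

Lemma nonsplit p n : prime p -> (p %| n)%N -> (0 < n)%N -> ~~ splits n -> exists k, n = (p ^ k)%N.
Proof.
move=> pp pn n0 /negPn sn; have [m ->] := p_natP sn; exists m.
have := pnatPpi sn (p := p); rewrite mem_primes pp n0 pn => /(_ isT).
by rewrite !inE => /eqP ->.
Qed.

Lemma splitsI p q n : (0 < n)%N -> prime p -> prime q -> p != q -> (p %| n)%N -> (q %| n)%N -> splits n.
Proof.
move=> n0 pp pq pnq pn qn; apply/negP => sn.
have h r : prime r -> (r %| n)%N -> r = pdiv n.
  by move=> pr rn; have := pnatPpi sn (p := r); rewrite mem_primes pr n0 rn => /(_ isT); rewrite !inE => /eqP.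
by case/eqP: pnq; rewrite (h p pp pn) -(h q pq qn).
Qed.

Lemma splits_double m : odd m -> (1 < m)%N -> forall k, (0 < k)%N -> splits (2 ^ k * m)%N.
Proof.
move=> om m1 k k0; apply: (@splitsI 2 (pdiv m)) => //.
- by rewrite muln_gt0 expn_gt0 /= ltnW.
- exact: pdiv_prime.
- by apply/eqP => e; have := pdiv_dvd m; rewrite -e dvdn2 om.
- by rewrite dvdn_mulr // dvdn_exp.
- by rewrite dvdn_mull // pdiv_dvd.
Qed.

Lemma pow3_mod8 m : ((3 ^ m) %% 8 = 1 \/ (3 ^ m) %% 8 = 3)%N.
Proof. by elim: m => [|m IH]; [left|rewrite expnS -modnMmr; case: IH => ->; [right|left]]. Qed.

Lemma pow2_mod k j : (j <= k)%N -> (2 ^ j %| 2 ^ k)%N.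
Proof. exact: dvdn_exp2l. Qed.

(* 3 ^ m = 1 modulo 16 forces 4 | m, hence 3 ^ m = 1 modulo 5. *)
Lemma pow2S_not_pow3 k m : (3 < k)%N -> (2 ^ k).+1 <> (3 ^ m)%N.
Proof.
move=> k4; have p16 j : (3 ^ (4 * j) %% 16 = 1)%N by rewrite expnM -modnXm exp1n.
have p5 j : (3 ^ (4 * j) %% 5 = 1)%N by rewrite expnM -modnXm exp1n.
have [q [r [r4 ->]]] : exists q r, (r < 4)%N /\ m = (4 * q + r)%N.
  by exists (m %/ 4)%N, (m %% 4)%N; rewrite ltn_pmod // mulnC -divn_eq.
rewrite expnD => e; have h16 : ((2 ^ k).+1 %% 16 = 1)%N.
  by rewrite -addn1 -modnDml; move: (@pow2_mod k 4 k4) => /eqP ->.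
move: h16; rewrite e -modnMml p16 mul1n => h16.
have r0 : r = 0%N by case: r r4 h16 {e} => [|[|[|[|]]]].
have h5 : ((2 ^ k).+1 %% 5 = 1)%N by rewrite e r0 muln1 p5.
have : (5 %| 2 ^ k)%N by move: h5; clear; lia.
by rewrite Euclid_dvdX.
Qed.

Lemma nonsplit_even n : (1 < n)%N -> ~~ odd n -> ~~ splits n -> exists k, n = (2 ^ k)%N.
Proof. by move=> n1 ev; apply: nonsplit => //; rewrite ?dvdn2 // ltnW. Qed.

Lemma pow2_mod3 k : ((2 ^ k) %% 3 = 1 \/ (2 ^ k) %% 3 = 2)%N.
Proof. by elim: k => [|k IH]; [left|rewrite expnS -modnMmr; case: IH => ->; [right|left]]. Qed.

Lemma pow2_eq0_mod8 k : (2 < k)%N -> ((2 ^ k) %% 8 = 0)%N.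
Proof. by move=> k2; apply/eqP; exact: (@pow2_mod k 3 k2). Qed.

Lemma nonsplit_dvd3 n : (3 %| n)%N -> (0 < n)%N -> ~~ splits n -> exists m, n = (3 ^ m)%N.
Proof. exact: nonsplit. Qed.

(** One of 2^k - 1 and 2^k + 1 is divisible by 3; a prime power divisible by 3 is a power of 3. The
    first is 7 modulo 8, the second is excluded by [pow2S_not_pow3]. *)
Lemma splits_pow2S k : (3 < k)%N -> ~~ splits (2 ^ k).-1 -> splits (2 ^ k).+1.
Proof.
move=> k4 s1; apply: contraT => s2; have h8 := pow2_eq0_mod8 (ltnW k4).
have k16 : (2 ^ 4 <= 2 ^ k)%N by rewrite leq_exp2l.
case: (pow2_mod3 k) => h3.
  have d3 : (3 %| (2 ^ k).-1)%N by move: h3 k16; clear; lia.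
  have [|m e] := nonsplit_dvd3 d3 _ s1; first by move: k16; clear; lia.
  by have := pow3_mod8 m; rewrite -e; move: h8 k16; clear; lia.
have d3 : (3 %| (2 ^ k).+1)%N by move: h3 k16; clear; lia.
have [m e] := nonsplit_dvd3 d3 isT s2.
by case: (pow2S_not_pow3 k4 e).
Qed.

(** Same argument with 2^k + 1 and 2^k + 5, the latter being 5 modulo 8. *)
Lemma splits_pow2D5 k : (3 < k)%N -> ~~ splits (2 ^ k).+1 -> splits (2 ^ k + 5)%N.
Proof.
move=> k4 s1; apply: contraT => s2; have h8 := pow2_eq0_mod8 (ltnW k4).
have k16 : (2 ^ 4 <= 2 ^ k)%N by rewrite leq_exp2l.
case: (pow2_mod3 k) => h3.
  have d3 : (3 %| (2 ^ k + 5))%N by move: h3 k16; clear; lia.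
  have [|m e] := nonsplit_dvd3 d3 _ s2; first by move: k16; clear; lia.
  by have := pow3_mod8 m; rewrite -e; move: h8 k16; clear; lia.
have d3 : (3 %| (2 ^ k).+1)%N by move: h3 k16; clear; lia.
have [m e] := nonsplit_dvd3 d3 isT s1.
by case: (pow2S_not_pow3 k4 e).
Qed.

Lemma splits_pow2D k j : (3 < k)%N -> (j \in [:: 2; 4; 6])%N -> splits (2 ^ k + j)%N.
Proof.
case: k => [|[|[|k]]] // k0.
have k0' : (0 < k)%N by [].
have e : (2 ^ k = (2 ^ k.-1) * 2)%N by rewrite -expnSr prednK.
have p0 : (0 < 2 ^ k.-1)%N by rewrite expn_gt0.
have s m i : odd m -> (1 < m)%N -> (0 < i)%N -> (2 ^ k.+3 + j = 2 ^ i * m)%N -> splits (2 ^ k.+3 + j).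
  by move=> o m1 i0 ->; exact: splits_double.
rewrite !inE => /or3P[] /eqP ej; [apply: (s (2 ^ k.+2 + 1)%N 1%N)|apply: (s (2 ^ k.+1 + 1)%N 2%N)|apply: (s (2 ^ k.+2 + 3)%N 1%N)] => //;
  rewrite ?expnS ?ej ?e; lia.
Qed.

(** In a product of terms with indices adding up to q + j < 2 q at most one index reaches q, so the
    difference is linear in the discrepancies from q on; the factor 2 comes from symmetry. *)
Lemma conv_sub (K : comPzRingType) (f g : nat -> K) q j : (j < q)%N ->
    (forall i, (0 < i < q)%N -> f i = g i) ->
  conv f (q + j) - conv g (q + j) = 2%:R * \sum_(i < j) (f (q + i)%N - g (q + i)%N) * g (j - i)%N.
Proof.
move=> jq fg; pose n := (q + j)%N; pose S := \sum_(1 <= i < n) (f i - g i) * g (n - i)%N.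
have -> : \sum_(i < j) (f (q + i)%N - g (q + i)%N) * g (j - i)%N = S.
  rewrite /S (@big_cat_nat _ _ _ q) ?leq_addr //=; last by lia.
  rewrite [X in X + _]big_nat_cond [X in X + _]big1 ?add0r; last first.
    by move=> i /andP[i_q _]; rewrite fg // subrr mul0r.
  rewrite -[X in \sum_(X <= _ < _) _]add0n big_addn /n addKn big_mkord; apply: eq_bigr => i _.
  by rewrite [(i + q)%N]addnC subnDl.
have -> : 2%:R * S = S + \sum_(1 <= i < n) g i * (f (n - i)%N - g (n - i)%N).
  rewrite mulr_natl mulr2n; congr (_ + _); rewrite /S big_nat_rev /=.
  apply: eq_big_nat => i i_n; rewrite mulrC; congr (g _ * (f _ - g _)); lia.
rewrite -sumrB -big_split /=; apply: eq_big_nat => i i_n.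
have [iq|qi] := ltnP i q; first by rewrite fg; [ring|lia].
rewrite (fg (n - i)%N); [ring|lia].
Qed.

(** * Two sequences that agree below q agree at q *)

Section Recursion.
Variables (K : numFieldType) (T : K).
Hypothesis T0 : T != 0.

Lemma mult_splits (g g' : nat -> K) q j : mult g -> mult g' -> (forall i, (0 < i < q)%N -> g i = g' i) ->
  (j < q)%N -> splits (q + j) -> g (q + j)%N = g' (q + j)%N.
Proof.
move=> gm gm' gg jq sp; have qj : (1 < q + j)%N.
  by rewrite ltnNge; apply: contraL sp => le1; have -> : (q + j = 1)%N by lia.
case: (splitsE qj sp) => r [s [r1 s1 crs e]].
by rewrite e gm ?gm' // 1?ltnW // !gg //; nia.
Qed.

(** If q + j splits, its factors lie below q, so the values of both sequences and of their [next]
    there are already equal. What remains is a linear relation between the discrepancies at q, ...,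
    q + j - 1. *)
Lemma mult_next_splits k (g g' : nat -> K) q j : (0 < k)%N -> mult g -> mult g' ->
  mult (next k T g) -> mult (next k T g') -> (forall i, (0 < i < q)%N -> g i = g' i) ->
  (j < q)%N -> splits (q + j) -> \sum_(i < j) (g (q + i)%N - g' (q + i)%N) * g' (j - i)%N = 0.
Proof.
move=> k0 gm gm' hm hm' gg jq sp.
have hh i : (0 < i < q)%N -> next k T g i = next k T g' i.
  by move=> i_q; apply: next_ext => [l l_i|]; [apply: gg|]; lia.
have := mult_splits hm hm' hh jq sp; rewrite /next (mult_splits gm gm' gg jq sp).
move/addrI/(mulfI _) => /(_ _)/eqP; rewrite mulf_neq0 ?pnatr_eq0 -?lt0n // => /(_ isT).
rewrite -subr_eq0 conv_sub // mulf_eq0 pnatr_eq0 /= => /eqP; exact.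
Qed.

Variables a a' : nat -> K.
Hypotheses (am : mult a) (am' : mult a') (bm : mult (next 1 T a)) (bm' : mult (next 1 T a')).
Hypotheses (a1 : a' 1%N = 1) (small : forall i, (0 < i < 23)%N -> a i = a' i).

Let agree q := forall i, (0 < i < q)%N -> a i = a' i.

(** If q or q + 1 splits, a_q is determined at once. Otherwise both are prime powers and the even
    one is a power of 2: either q + 1 = 2^k, and q + 2, q + 3 split, or q = 2^k, and q + 2, q + 4, q
    + 5, q + 6 split. *)
Let recursion :
  (forall q, (23 <= q)%N -> agree q -> splits (q + 2) ->
    splits (q + 3) \/ [/\ splits (q + 4), splits (q + 5) & splits (q + 6)] -> a q = a' q) ->
  forall n, (0 < n)%N -> a n = a' n.
Proof.
move=> P; elim/ltn_ind => q IH q0; have [q23|q23] := ltnP q 23; first by rewrite small ?q0.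
have ag : agree q by move=> i /andP[i0 iq]; exact: IH.
have [sq|sq] := boolP (splits q).
  by rewrite -[q]addn0; apply: mult_splits; rewrite ?addn0.
have [sq1|sq1] := boolP (splits (q + 1)).
  have := @mult_next_splits 1 a a' q 1%N isT am am' bm bm' ag.
  rewrite big_ord1 addn0 subn0 a1 mulr1 => /(_ _ sq1)/eqP; rewrite subr_eq0 => H.
  by apply/eqP/H; lia.
have [o|o] := boolP (odd q).
  have [||k e] := nonsplit_even _ _ sq1; rewrite ?oddD ?o //; first by lia.
  have k4 : (4 < k)%N by rewrite -(ltn_exp2l 4 k (isT : 1 < 2)%N) -e; lia.
  apply: P => //.
    have -> : (q + 2)%N = (2 ^ k).+1 by lia.
    apply: splits_pow2S; first by lia.
    by rewrite -e addn1.
  left; have -> : (q + 3)%N = (2 ^ k + 2)%N by lia.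
  by apply: splits_pow2D; first by lia.
have [||k e] := nonsplit_even _ _ sq => //; first by lia.
have k4 : (4 < k)%N by rewrite -(ltn_exp2l 4 k (isT : 1 < 2)%N) -e; lia.
have k3 : (3 < k)%N by apply: ltnW.
apply: (P q q23 ag); first by rewrite e splits_pow2D.
right; split; rewrite e; [exact: splits_pow2D| |exact: splits_pow2D].
by apply: splits_pow2D5 => //; rewrite -e -addn1.
Qed.

Let rel q j (ag : agree q) (q23 : (23 <= q)%N) (j7 : (j < 7)%N) (s : splits (q + j)) :
  \sum_(i < j) (a (q + i)%N - a' (q + i)%N) * a' (j - i)%N = 0.
Proof.
by apply: (@mult_next_splits 1 a a') => //; apply: leq_trans j7 (leq_trans _ q23).
Qed.

Let same q j (ag : agree q) (q23 : (23 <= q)%N) (j7 : (j < 7)%N) (s : splits (q + j)) :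
  a (q + j)%N - a' (q + j)%N = 0.
Proof.
apply/eqP; rewrite subr_eq0; apply/eqP.
by apply: mult_splits => //; apply: leq_trans j7 (leq_trans _ q23).
Qed.

Ltac sums := rewrite ?big_ord_recr ?big_ord0 /= ?add0r ?addn0 ?subn0.

(** With v_i the discrepancy at q + i, the relation for f^2 at q + 2 gives only v_1 = 0, as a_2 = 0.
    The one for f^4 at q + 2 gives T v_0 + 2 T v_0 = 0. *)
Lemma recursion_Z : mult (next 2 T (next 1 T a)) -> mult (next 2 T (next 1 T a')) ->
  a' 2 = 0 -> forall n, (0 < n)%N -> a n = a' n.
Proof.
move=> dm dm' a2; apply: recursion => q q23 ag s2 _.
have h := @rel q 2 ag q23 isT s2; move: h; sums; rewrite a2 a1 mulr0 mulr1 add0r => v0.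
have bb i : (0 < i < q)%N -> next 1 T a i = next 1 T a' i.
  by move=> i_q; apply: next_ext => [l l_i|]; [apply: ag|]; lia.
have j2 : (2 < q)%N by lia.
have := @mult_next_splits 2 _ _ q 2%N isT bm bm' dm dm' bb j2 s2; sums.
have b1 : next 1 T a' 1 = 1 by rewrite /next /conv big_geq // mulr0 addr0.
have b2 : next 1 T a' 2 = T by rewrite /next /conv big_nat1 a1 a2; ring.
have e0 : next 1 T a q - next 1 T a' q = a q - a' q.
  by rewrite /next (@conv_ext _ a a' q) //; ring.
have q1 : (1 < q)%N by lia.
have e1 : next 1 T a (q + 1) - next 1 T a' (q + 1) = 2%:R * T * (a q - a' q).
  have -> : next 1 T a (q + 1) - next 1 T a' (q + 1) =
     (a (q + 1)%N - a' (q + 1)%N) + T * (conv a (q + 1) - conv a' (q + 1)) by rewrite /next; ring.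
  by rewrite v0 (conv_sub q1 ag); sums; rewrite a1; ring.
rewrite b1 b2 e0 e1 => /eqP.
have -> : (a q - a' q) * T + 2%:R * T * (a q - a' q) * 1 = 3%:R * T * (a q - a' q) by ring.
by rewrite mulf_eq0 mulf_eq0 pnatr_eq0 (negPf T0) subr_eq0 => /eqP.
Qed.

(** With v_i as above, q + 2 gives v_0 + v_1 = 0. Then v_1 = 0 follows from q + 3, or else from q +
    6, where 2 v_1 = 0 because a_5 = 2. *)
Lemma recursion_Zi : [/\ a' 2 = 1, a' 3 = 0, a' 4 = 1, a' 5 = 2%:R & a' 6 = 0] ->
  forall n, (0 < n)%N -> a n = a' n.
Proof.
case=> a2 a3 a4 a5 a6; apply: recursion => q q23 ag s2 alt; apply/eqP; rewrite -subr_eq0.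
have := @rel q 2 ag q23 isT s2; sums; rewrite a2 a1 ?mulr1 => r2.
case: alt => [s3|[s4 s5 s6]].
  have := @rel q 3 ag q23 isT s3; sums; rewrite (same ag q23 _ s2) // a3 a2 a1 ?mulr1 ?mulr0 ?add0r addr0.
  by move=> v0; move: r2; rewrite v0 addr0 => ->.
have := @rel q 4 ag q23 isT s4; sums; rewrite (same ag q23 _ s2) // a4 a3 a2 a1 ?mulr1 ?mulr0 ?mul0r ?addr0.
have := @rel q 6 ag q23 isT s6; sums.
rewrite (same ag q23 _ s2) // (same ag q23 _ s4) // (same ag q23 _ s5) // a6 a5 a4 a3 ?mulr0 ?mul0r ?addr0 ?add0r.
by move=> /eqP; rewrite mulf_eq0 pnatr_eq0 orbF => /eqP v0; move: r2; rewrite v0 addr0 => ->.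
Qed.

(** Here q + 2 gives v_1 = 0. Then q + 3 gives v_0 = 0, or else q + 4 gives v_0 + v_3 = 0 and q + 6
    gives v_3 = 0. *)
Lemma recursion_Zzeta3 : [/\ a' 2 = 0, a' 3 = 1, a' 4 = 1, a' 5 = 0 & a' 6 = 0] ->
  forall n, (0 < n)%N -> a n = a' n.
Proof.
case=> a2 a3 a4 a5 a6; apply: recursion => q q23 ag s2 alt; apply/eqP; rewrite -subr_eq0.
have := @rel q 2 ag q23 isT s2; sums; rewrite a2 a1 ?mulr1 ?mulr0 ?add0r => v0.
case: alt => [s3|[s4 s5 s6]].
  by have := @rel q 3 ag q23 isT s3; sums; rewrite (same ag q23 _ s2) // v0 a3 ?mul0r ?addr0 ?mulr1 => ->.
have := @rel q 4 ag q23 isT s4; sums; rewrite (same ag q23 _ s2) // v0 a4 a1 ?mulr1 ?mul0r ?addr0 => r4.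
have := @rel q 6 ag q23 isT s6; sums.
rewrite (same ag q23 _ s2) // (same ag q23 _ s4) // (same ag q23 _ s5) // a6 a5 v0 a3 ?mulr0 ?mul0r ?addr0 ?add0r ?mulr1.
by move=> w0; move: r4; rewrite w0 addr0 => ->.
Qed.
End Recursion.

(** * The first 22 coefficients *)

Definition mult3 (K : pzRingType) (T : K) a :=
  [/\ a 1%N = 1, mult a, mult (next 1 T a) & mult (next 2 T (next 1 T a))].

Definition values_Z := [:: 0; 1; 0; 0; 1; 0; 0; 0; 0; 1; 0; 0; 0; 0; 0; 0; 1; 0; 0; 0; 0; 0; 0]%N.
Definition values_Zi := [:: 0; 1; 1; 0; 1; 2; 0; 0; 1; 1; 2; 0; 0; 2; 0; 0; 1; 2; 1; 0; 2; 0; 0]%N.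
Definition values_Zzeta3 := [:: 0; 1; 0; 1; 1; 0; 0; 2; 0; 1; 0; 0; 1; 2; 0; 0; 1; 0; 0; 2; 0; 2; 0]%N.

Definition has_values (K : pzRingType) (g : nat -> K) (l : seq nat) :=
  forall n, (0 < n < 23)%N -> g n = (nth 0%N l n)%:R.

(** The twist by e = 6 clears the denominators: T becomes 6 T, the variables a_2/6, a_3/6, a_7/6
    become a_2, 6 a_3, 6^5 a_7, and C = 36/2 = 18. *)
Definition prefix_check (T : nat) (l : seq nat) :=
  let e := [:: pnat (6 * T); pnat (nth 0 l 2); pnat (6 * nth 0 l 3); pnat (7776 * nth 0 l 7); pnat 18]%N in
  all (fun n => peq (psubst e (nth p0 (coefs qs9) n)) (pmul (ppow (pnat 6) n.-1) (pnat (nth 0%N l n))))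
    (iota 1 22).

Lemma prefix_check_Z : prefix_check 1 values_Z. Proof. by vm_compute. Qed.
Lemma prefix_check_Zi : prefix_check 2 values_Zi. Proof. by vm_compute. Qed.
Lemma prefix_check_Zzeta3 : prefix_check 3 values_Zzeta3. Proof. by vm_compute. Qed.

Lemma mult_ext (K : pzRingType) (f g : nat -> K) : f =1 g -> mult f -> mult g.
Proof. by move=> fg fm r s r0 s0 c; rewrite -!fg; exact: fm. Qed.

Lemma mult3_values (K : numFieldType) (T : nat) l (a : nat -> K) : (0 < T)%N -> prefix_check T l ->
  mult3 T%:R a -> a 2 = (nth 0%N l 2)%:R -> a 3 = (nth 0%N l 3)%:R -> a 7 = (nth 0%N l 7)%:R ->
  has_values a l.
Proof.
move=> T0 chk [a1 am bm dm] e2 e3 e7 n n_23.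
have n_in : n \in iota 1 22 by rewrite mem_iota; move: n_23; lia.
have := allP chk n n_in => /(ev_eq ([::] : seq K)); rewrite ev_subst evM evX !ev_nat /= !ev_nat => check.
have n2 : 2%:R != 0 :> K by rewrite pnatr_eq0.
have n3 : 3%:R != 0 :> K by rewrite pnatr_eq0.
have n6 : 6%:R != 0 :> K by rewrite pnatr_eq0.
have T6 : 6%:R * T%:R != 0 :> K by rewrite mulf_neq0 // pnatr_eq0 -lt0n.
pose a' := twist 6%:R a.
have m6 g : mult g -> hmult (2%:R * 18%:R) (twist (6%:R : K) g).
  by move=> gm; rewrite -natrM -[(2 * 18)%N]/(6 * 6)%N natrM -expr2; exact: hmult_twist.
have nt := next_twist (6%:R : K).
have := @coefs_eval K (6%:R * T%:R) 18%:R a' n2 n3 T6 _ _ _ _ n n_23.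
have -> : env (6%:R * T%:R) 18%:R a' = [:: (6 * T)%:R; (nth 0%N l 2)%:R; (6 * nth 0%N l 3)%:R; (7776 * nth 0%N l 7)%:R; 18%:R].
  have d6 x : 6%:R * x / 6%:R = x :> K by rewrite mulrC mulKf.
  have e6 : 7776%:R = 6%:R ^+ 5 :> K by rewrite -natrX; congr _%:R; vm_compute.
  rewrite /env /a' /twist e2 e3 e7 !natrM e6; congr [:: _; _; _; _; _]; rewrite ?expr1.
  - exact: d6.
  - by rewrite expr2 -mulrA d6.
  by rewrite (exprS _ 5) -mulrA d6.
rewrite check => H; apply: (mulfI (expf_neq0 n.-1 n6)); rewrite H //.
- by rewrite /a' /twist expr0 mul1r.
- exact: m6.
- apply: (hmult_ext _ (m6 _ bm)) => k; by rewrite nt.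
apply: (hmult_ext _ (m6 _ dm)) => k; rewrite -nt /next /conv -/(next 1 T%:R a k) -nt.
congr (_ + _ * _); apply: eq_bigr => i _.
by rewrite -/(next 1 T%:R a i) -/(next 1 T%:R a (k - i)) -!nt.
Qed.

(** Twisting by the sign s replaces T by s T, which is 1, 2 or 3, and a second twist restores [a].
    Agreement up to 22 then starts the recursion. *)
Theorem sequence_cases (K : numClosedFieldType) (T : K) (a z i h : nat -> K) : T != 0 ->
  mult3 T a -> mult3 1 z -> mult i -> mult (next 1 2%:R i) -> mult h -> mult (next 1 3%:R h) ->
  has_values z values_Z -> has_values i values_Zi -> has_values h values_Zzeta3 ->
  exists2 s, s ^+ 2 = 1 & [\/ T = s /\ (forall n, (0 < n)%N -> a n = twist s z n),
    T = 2%:R * s /\ (forall n, (0 < n)%N -> a n = twist s i n) |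
    T = 3%:R * s /\ (forall n, (0 < n)%N -> a n = twist s h n)].
Proof.
move=> T0 ma [_ zm zm2 zm3] im im2 hm hm2 zv iv hv.
case: (ma) => a1 am bm dm; have [s s2 cases] := small_coefs T0 a1 am bm dm.
exists s => //; pose a' := twist s a.
have sn k n : s ^+ (2 * k + n)%N = s ^+ n by rewrite exprD exprM s2 expr1n mul1r.
have aE n : a n = twist s a' n by rewrite /a' /twist mulrA -exprMn -expr2 s2 expr1n mul1r.
have m1 g : mult g -> mult (twist s g).
  move=> gm r t r0 t0 c; have := hmult_twist s gm r0 t0 c.
  by rewrite s2 expr1n mul1r.
have ma' : mult3 (s * T) a'.
  split; [by rewrite /a' /twist expr0 mul1r|exact: m1| |].
    by apply: (mult_ext _ (m1 _ bm)) => n; rewrite next_twist.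
  apply: (mult_ext _ (m1 _ dm)) => n; rewrite -next_twist /next /conv -/(next 1 T a n) -next_twist.
  congr (_ + _ * _); apply: eq_bigr => j _.
  by rewrite -/(next 1 T a j) -/(next 1 T a (n - j)) -!next_twist.
have a'2 : a' 2 = s * a 2 by rewrite /a' /twist expr1.
have a'3 : a' 3 = a 3 by rewrite /a' /twist s2 mul1r.
have a'7 : a' 7 = a 7 by rewrite /a' /twist (sn 3 0)%N expr0 mul1r.
have same (g : nat -> K) l : has_values a' l -> has_values g l -> forall n, (0 < n < 23)%N -> a' n = g n.
  by move=> va vg n n_23; rewrite va // vg.
case: cases => -[eT a2 a3 a7]; rewrite ?a2 ?a3 ?a7 in a'2 a'3 a'7.
- constructor 1; split=> // n n0; rewrite aE; congr (_ * _).
  rewrite eT -expr2 s2 in ma'; rewrite mulr0 in a'2.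
  have n1 : 1 != 0 :> K by rewrite oner_eq0.
  have va := @mult3_values K 1 values_Z a' isT prefix_check_Z ma' a'2 a'3 a'7.
  case: ma' => _ am' bm' dm'.
  exact: (recursion_Z n1 am' zm bm' zm2 (zv 1%N isT) (same _ _ va zv) dm' zm3 (zv 2%N isT)).
- constructor 2; split=> // n n0; rewrite aE; congr (_ * _).
  rewrite eT mulrCA -expr2 s2 mulr1 in ma'; rewrite -expr2 s2 in a'2.
  have n1 : 2%:R != 0 :> K by rewrite pnatr_eq0.
  have va := @mult3_values K 2 values_Zi a' isT prefix_check_Zi ma' a'2 a'3 a'7.
  case: ma' => _ am' bm' dm'.
  apply: (recursion_Zi n1 am' im bm' im2 (iv 1%N isT) (same _ _ va iv)) => //.
  by split; rewrite iv.
- constructor 3; split=> // n n0; rewrite aE; congr (_ * _).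
  rewrite eT mulrCA -expr2 s2 mulr1 in ma'; rewrite mulr0 in a'2.
  have n1 : 3%:R != 0 :> K by rewrite pnatr_eq0.
  have va := @mult3_values K 3 values_Zzeta3 a' isT prefix_check_Zzeta3 ma' a'2 a'3 a'7.
  case: ma' => _ am' bm' dm'.
  apply: (recursion_Zzeta3 n1 am' hm bm' hm2 (hv 1%N isT) (same _ _ va hv)) => //.
  by split; rewrite hv.
Qed.

End Coefficients.

(** * Multiplicativity of the numbers of elements of given norm *)

Module Orders.
Import all_boot all_order all_algebra ring zify lra.
Import Order.TTheory GRing.Theory Num.Theory.
Local Open Scope ring_scope.
Import Elimination Valuation Certificates Data Charts Coefficients.

Section NormRing.
Variables (O : pzRingType) (conj : O -> O) (N : O -> int) (fib : nat -> seq O).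

Definition norm_ring : Prop :=
  [/\ [/\ forall x, x * conj x = (N x)%:~R, forall x, conj x * x = (N x)%:~R,
          forall x y, conj (x * y) = conj y * conj x & forall x y, conj (x + y) = conj x + conj y],
      [/\ forall x, N (conj x) = N x, forall x y, N (x * y) = N x * N y & forall m : int, N m%:~R = m ^+ 2],
      forall x, 0 <= N x,
      forall x, N x = 0 -> x = 0 &
      (forall n, uniq (fib n)) /\ forall n x, (x \in fib n) = (N x == n%:Z)].

Hypothesis O_norm : norm_ring.

Let xcj x : x * conj x = (N x)%:~R. Proof. by case: O_norm => -[]. Qed.
Let cjx x : conj x * x = (N x)%:~R. Proof. by case: O_norm => -[]. Qed.
Let cjM x y : conj (x * y) = conj y * conj x. Proof. by case: O_norm => -[]. Qed.
Let cjD x y : conj (x + y) = conj x + conj y. Proof. by case: O_norm => -[]. Qed.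
Let Ncj x : N (conj x) = N x. Proof. by case: O_norm => _ []. Qed.
Let NM x y : N (x * y) = N x * N y. Proof. by case: O_norm => _ []. Qed.
Let Nint m : N m%:~R = m ^+ 2. Proof. by case: O_norm => _ []. Qed.
Let N_ge0 x : 0 <= N x. Proof. by case: O_norm. Qed.
Let N_eq0 x : N x = 0 -> x = 0. Proof. by case: O_norm => _ _ _ /(_ x). Qed.
Let fib_uniq n : uniq (fib n). Proof. by case: O_norm => _ _ _ _ []. Qed.
Let mem_fib n x : (x \in fib n) = (N x == n%:Z). Proof. by case: O_norm => _ _ _ _ []. Qed.

Let N0 : N 0 = 0. Proof. by have := Nint 0; rewrite expr0n. Qed.
Let N1 : N 1 = 1. Proof. by have := Nint 1; rewrite expr1n. Qed.

Let int_comm (m : int) (x : O) : x * m%:~R = m%:~R * x.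
Proof. by rewrite !mulrzr !mulrzl mulr1 mul1r || rewrite mulrzr mulrzl. Qed.

Lemma norm_lreg (x y z : O) : N x != 0 -> x * y = x * z -> y = z.
Proof.
move=> x0 e; apply/eqP; rewrite -subr_eq0; apply/eqP/N_eq0/eqP.
have : N (x * (y - z)) == 0 by rewrite mulrBr e subrr N0.
by rewrite NM mulf_eq0 (negPf x0).
Qed.

Lemma norm_unit x : N x = 1 -> x * conj x = 1 /\ conj x * x = 1.
Proof. by move=> e; rewrite xcj cjx e. Qed.

Let cjint (m : int) : conj m%:~R = m%:~R.
Proof.
have [->|m0] := eqVneq m 0; first by apply: N_eq0; rewrite Ncj Nint expr0n.
by apply: (@norm_lreg m%:~R); rewrite ?xcj Nint ?expf_neq0 // expr2 intrM.
Qed.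

Let dvd_int (m k : int) (w : O) : k%:~R = m%:~R * w -> (m %| k)%Z.
Proof.
by move/(congr1 N); rewrite NM !Nint => e; rewrite -(@dvdz_pexp2r m k 2) // e dvdz_mulr.
Qed.

Section Factorization.
Variables (m n : nat) (z : O).
Hypotheses (m0 : (0 < m)%N) (cmn : coprime m n) (Nz : N z = (m * n)%N%:Z).

Let inI b := exists r s, b = z * r + m%:~R * s.

(* A generator b of the right ideal (z, m) has norm gcd (N z, m ^ 2) = m. *)
Let factor_of_generator b : inI b -> (exists x, z = b * x) -> (exists y, m%:~R = b * y) ->
  exists x y, [/\ z = x * y, N x = m & N y = n].
Proof.
move=> [r [s eb]] [x zx] [y my]; have Nb : N b = m.
  have d1 : (m %| N b)%Z.
    apply: (@dvd_int _ _ (n%:~R * (N r)%:~R + z * r * conj s + s * conj b)).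
    rewrite -xcj {1}eb mulrDl [in RHS]mulrDr mulrA; congr (_ + _).
    rewrite eb cjD !cjM cjint !mulrDr mulrA -(mulrA z) xcj int_comm -mulrA xcj Nz PoszM intrM.
    by rewrite -int_comm !mulrA; congr (_ + _); rewrite int_comm !mulrA.
  have d2 : (N b %| m%:Z)%Z.
    have : (N b %| gcdz (N z) (m%:Z ^+ 2))%Z by rewrite dvdz_gcd {1}zx -Nint my !NM !dvdz_mulr.
    rewrite Nz expr2; suff -> : gcdz (m * n)%N (m%:Z * m%:Z) = m by [].
    by rewrite -PoszM /gcdz /= -muln_gcdr gcdnC (eqP cmn) muln1.
  have := N_ge0 b; move: d1 d2; case: (N b) => // k; rewrite !dvdzE /= => d1 d2 _; congr Posz.
  by apply/eqP; rewrite eqn_dvd d2 d1.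
exists b, x; split=> //; have := Nz; rewrite zx NM Nb PoszM; apply: mulfI; lia.
Qed.

(** Euclid's algorithm in the right ideal generated by z and m, started at m. Only m and z are ever
    divided, and z only by divisors of m: these weak hypotheses also hold for Lipschitz quaternions,
    which are not Euclidean. *)
Lemma factorization :
    (forall b, b != 0 -> exists q, N (m%:~R - b * q) < N b) ->
    (forall b, b != 0 -> (exists y, m%:~R = b * y) -> exists q, N (z - b * q) < N b) ->
  exists x y, [/\ z = x * y, N x = m & N y = n].
Proof.
move=> div_m div_z.
have : inI m%:~R by exists 0, 1; rewrite mulr0 add0r mulr1.
have : m%:~R != 0 :> O.
  by apply/eqP => /(congr1 N)/eqP; rewrite Nint N0 expf_eq0 /=; lia.
have [k] := ubnP `|N (m%:~R : O)|%N; elim: k (m%:~R : O) => // k IH b Nk b0 bI.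
have inI_sub t q : inI t -> inI (t - b * q).
  move: bI => [r [s ->]] [r' [s' ->]]; exists (r' - r * q), (s' - s * q).
  by rewrite !mulrBr mulrDl !mulrA addrACA opprD.
have step t : inI t -> (exists q, N (t - b * q) < N b) -> (forall q, t != b * q) ->
    exists x y, [/\ z = x * y, N x = m & N y = n].
  move=> tI [q lt] nd; apply: (IH (t - b * q)); [|by rewrite subr_eq0|exact: inI_sub].
  have := N_ge0 (t - b * q); have := N_ge0 b; lia.
have dvdP t q : (N (t - b * q) < N b) -> (exists x, t = b * x) \/ (t - b * q != 0).
  by move=> _; have [/eqP|] := eqVneq (t - b * q) 0; [rewrite subr_eq0 => /eqP ->; left; exists q|right].
have small t q : N (t - b * q) < N b -> (`|N (t - b * q)| < k)%N.
  have := N_ge0 (t - b * q); have := N_ge0 b; lia.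
have mI : inI m%:~R by exists 0, 1; rewrite mulr0 add0r mulr1.
have zI : inI z by exists 1, 0; rewrite mulr0 addr0 mulr1.
have [q lt] := div_m b b0; have [md|nd] := dvdP _ _ lt; last first.
  by apply: (IH _ (small _ _ lt) nd); exact: inI_sub.
have [q' lt'] := div_z b b0 md; have [zd|nd] := dvdP _ _ lt'; last first.
  by apply: (IH _ (small _ _ lt') nd); exact: inI_sub.
exact: factor_of_generator bI zd md.
Qed.
End Factorization.

(** Conjugation reverses products, so the norm used for the left factor can be chosen. *)
Lemma factorization_conj m n (z : O) : (exists x y, [/\ conj z = x * y, N x = m & N y = n]) ->
  exists x y, [/\ z = x * y, N x = n & N y = m].
Proof.
have cjK x : conj (conj x) = x.
  have [x0|x0] := eqVneq (N x) 0.
    by rewrite (N_eq0 x0) -[0]/(0%:~R) !cjint.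
  by apply: (@norm_lreg (conj x)); rewrite ?Ncj // xcj cjx Ncj.
move=> [x [y [e Nx Ny]]]; exists (conj y), (conj x); split; rewrite ?Ncj //.
by rewrite -cjM -e cjK.
Qed.

(* Bezout: if x y = x' y' with norms m, n on both sides, then x' = x u for
   u = a x^* x' + b y y'^*, where a m + b n = 1. *)
Lemma factorization_unique (m n : nat) x y x' y' : coprime m n -> (0 < m)%N -> N x = m -> N x' = m ->
  N y = n -> N y' = n -> x * y = x' * y' -> exists u, [/\ N u = 1, x' = x * u & y' = conj u * y].
Proof.
move=> cmn m0 Nx Nx' Ny Ny' e; have x0 : N x != 0 by rewrite Nx; lia.
have [a [b ab]] : exists a b : int, a * m + b * n = 1.
  by have [a [b ab]] := Bezoutz m n; exists a, b; rewrite ab /gcdz /= (eqP cmn).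
pose u := a%:~R * (conj x * x') + b%:~R * (y * conj y').
have xu : x' = x * u.
  rewrite mulrDr !mulrA !int_comm -!mulrA [x * (conj x * _)]mulrA xcj Nx.
  rewrite [x * (y * _)]mulrA e -[x' * y' * _]mulrA xcj Ny' int_comm !mulrA -mulrDl -!intrM -intrD.
  by rewrite ab mul1r.
have Nu : N u = 1.
  by have := Nx'; rewrite xu NM Nx -[in RHS](mulr1 m%:Z); apply: mulfI; rewrite -Nx.
exists u; split=> //; have [_ cu] := norm_unit Nu.
have -> : y = u * y' by apply: (norm_lreg x0); rewrite e xu mulrA.
by rewrite mulrA cu mul1r.
Qed.

(** With a factorization z = x y chosen for each z of norm m n, the map from (u, z) to (x u, conj u
    y) is a bijection onto the pairs of norms m and n; it is onto by [factorization_unique]. *)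
Theorem card_fib_mul (m n : nat) : coprime m n -> (0 < m)%N -> (0 < n)%N ->
    (forall z, N z = (m * n)%N -> exists x y, [/\ z = x * y, N x = m & N y = n]) ->
  (size (fib m) * size (fib n) = size (fib 1) * size (fib (m * n)))%N.
Proof.
move=> cmn m0 n0 fac.
pose L := [seq (x, y) | x <- fib m, y <- fib n].
pose M := [seq (u, z) | u <- fib 1, z <- fib (m * n)].
have memL p : (p \in L) = (N p.1 == m) && (N p.2 == n).
  case: p => x y /=; apply/allpairsP/andP => [[[x' y'] /= [+ + [-> ->]]]|[Nx Ny]].
    by rewrite !mem_fib.
  by exists (x, y); rewrite /= !mem_fib.
have memM p : (p \in M) = (N p.1 == 1) && (N p.2 == (m * n)%N).
  case: p => x y /=; apply/allpairsP/andP => [[[x' y'] /= [+ + [-> ->]]]|[Nx Ny]].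
    by rewrite !mem_fib.
  by exists (x, y); rewrite /= !mem_fib.
have uL : uniq L by apply: allpairs_uniq => // -[? ?] [? ?].
have uM : uniq M by apply: allpairs_uniq => // -[? ?] [? ?].
pose g z := nth (0, 0) L (find (fun p => p.1 * p.2 == z) L).
have gP z : N z = (m * n)%N -> [/\ N (g z).1 = m, N (g z).2 = n & (g z).1 * (g z).2 = z].
  move=> Nz; have h : has (fun p => p.1 * p.2 == z) L.
    have [x [y [e Nx Ny]]] := fac z Nz.
    by apply/hasP; exists (x, y); rewrite ?memL /= ?Nx ?Ny ?eqxx //= e eqxx.
  have := mem_nth (0, 0) (etrans (esym (has_find _ _)) h).
  by rewrite memL => /andP[/eqP ? /eqP ?]; split=> //; apply/eqP; exact: (nth_find (0, 0) h).
pose F (p : O * O) := ((g p.2).1 * p.1, conj p.1 * (g p.2).2).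
have FP p : p \in M -> (F p).1 * (F p).2 = p.2.
  rewrite memM => /andP[/eqP Nu /eqP Nz]; have [_ _ gz] := gP _ Nz.
  by rewrite /= mulrA -[_ * p.1 * _]mulrA (proj1 (norm_unit Nu)) mulr1 gz.
rewrite -[LHS](size_allpairs pair) -[RHS](size_allpairs pair) -/L -/M -(size_map F M).
apply/perm_size/uniq_perm => //.
  rewrite map_inj_in_uniq // => p p' pM p'M e.
  have e2 : p.2 = p'.2 by rewrite -(FP p) // -(FP p') // e.
  move: pM p'M; rewrite !memM => /andP[_ /eqP Nz] _; have [Nx _ _] := gP _ Nz.
  case: e => + _; rewrite -e2 => /norm_lreg e1; apply/eqP; rewrite -pair_eqE /= e2 eqxx andbT.
  by apply/eqP/e1; rewrite Nx; lia.
move=> p; apply/idP/mapP => [|[[u z] + ->]]; last first.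
  rewrite memM => /andP[/eqP /= Nu /eqP Nz]; have [Nx Ny _] := gP _ Nz.
  by rewrite memL /= !NM Ncj Nu Nx Ny mulr1 mul1r !eqxx.
rewrite memL => /andP[/eqP Nx' /eqP Ny']; set z := p.1 * p.2.
have Nz : N z = (m * n)%N by rewrite NM Nx' Ny' PoszM.
have [Nx Ny gz] := gP _ Nz; have [u [Nu e1 e2]] := factorization_unique cmn m0 Nx Nx' Ny Ny' gz.
by exists (u, z); rewrite ?memM /= ?Nu ?Nz ?eqxx // /F /= -e1 -e2; case: (p).
Qed.
End NormRing.

(* x + y alpha with alpha ^ 2 = tau alpha - 1. *)
Definition quad (tau : int) : Type := (int * int)%type.
HB.instance Definition _ tau := GRing.Zmodule.on (quad tau).

(** * The orders Z[i], for [tau] = 0, and Z[zeta3], for [tau] = -1, and their doubles *)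

Section Quad.
Variable tau : int.
Implicit Types x y z : quad tau.

Definition quad_one : quad tau := (1, 0).
Definition quad_mul x y : quad tau :=
  (x.1 * y.1 - x.2 * y.2, x.1 * y.2 + x.2 * y.1 + tau * x.2 * y.2).
Definition quad_conj x : quad tau := (x.1 + tau * x.2, - x.2).
Definition quad_norm x : int := x.1 ^+ 2 + tau * x.1 * x.2 + x.2 ^+ 2.

Fact quad_mulA : associative quad_mul.
Proof. by move=> [a b] [c d] [e f]; congr (_, _) => /=; ring. Qed.
Fact quad_mulC : commutative quad_mul.
Proof. by move=> [a b] [c d]; congr (_, _) => /=; ring. Qed.
Fact quad_mul1 : left_id quad_one quad_mul.
Proof. by move=> [a b]; congr (_, _) => /=; ring. Qed.
Fact quad_mulD : left_distributive quad_mul +%R.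
Proof. by move=> [a b] [c d] [e f]; congr (_, _) => /=; ring. Qed.
HB.instance Definition _ :=
  GRing.Zmodule_isComPzRing.Build (quad tau) quad_mulA quad_mulC quad_mul1 quad_mulD.

Lemma quad_int (m : int) : m%:~R = (m, 0) :> quad tau.
Proof.
elim/int_ind: m => [//|n IH|n IH]; first by rewrite intS intrD IH.
by rewrite intS opprD intrD IH; congr (_, _).
Qed.
End Quad.

(* The Cayley-Dickson double of [quad tau]. *)
Definition quat (tau : int) : Type := (quad tau * quad tau)%type.
HB.instance Definition _ tau := GRing.Zmodule.on (quat tau).

Section Quat.
Variable tau : int.
Implicit Types x y z : quat tau.

Definition quat_one : quat tau := (1, 0).
Definition quat_mul x y : quat tau :=
  (quad_mul x.1 y.1 - quad_mul (quad_conj y.2) x.2, quad_mul y.2 x.1 + quad_mul x.2 (quad_conj y.1)).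
Definition quat_conj x : quat tau := (quad_conj x.1, - x.2).
Definition quat_norm x : int := quad_norm x.1 + quad_norm x.2.

Fact quat_mulA : associative quat_mul.
Proof. by move=> [[a b] [c d]] [[e f] [g h]] [[i j] [k l]]; congr ((_, _), (_, _)) => /=; ring. Qed.
Fact quat_mul1 : left_id quat_one quat_mul.
Proof. by move=> [[a b] [c d]]; congr ((_, _), (_, _)) => /=; ring. Qed.
Fact quat_mulr1 : right_id quat_one quat_mul.
Proof. by move=> [[a b] [c d]]; congr ((_, _), (_, _)) => /=; ring. Qed.
Fact quat_mulDl : left_distributive quat_mul +%R.
Proof. by move=> [[a b] [c d]] [[e f] [g h]] [[i j] [k l]]; congr ((_, _), (_, _)) => /=; ring. Qed.
Fact quat_mulDr : right_distributive quat_mul +%R.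
Proof. by move=> [[a b] [c d]] [[e f] [g h]] [[i j] [k l]]; congr ((_, _), (_, _)) => /=; ring. Qed.
HB.instance Definition _ :=
  GRing.Zmodule_isPzRing.Build (quat tau) quat_mulA quat_mul1 quat_mulr1 quat_mulDl quat_mulDr.

Lemma quat_int (m : int) : m%:~R = ((m, 0), (0, 0)) :> quat tau.
Proof.
elim/int_ind: m => [//|n IH|n IH]; first by rewrite intS intrD IH.
by rewrite intS opprD intrD IH; congr ((_, _), (_, _)).
Qed.
End Quat.

(** * Finite lists of the elements of given norm *)

Definition enumerates (T : eqType) (N : T -> int) (f : nat -> seq T) :=
  (forall n, uniq (f n)) /\ forall n x, (x \in f n) = (N x == n%:Z).

Lemma uniq_flatten_map (S T : eqType) (L : S -> seq T) s : uniq s -> (forall k, uniq (L k)) ->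
  (forall k l p, p \in L k -> p \in L l -> k = l) -> uniq (flatten (map L s)).
Proof.
move=> us uL disj; elim: s us => //= k s IH /andP[ks us]; rewrite cat_uniq uL IH // andbT.
apply/hasPn => p /flatten_mapP[l ls pl]; apply: contra ks => pk.
by rewrite (disj _ _ _ pk pl).
Qed.

Definition double (T : Type) (f : nat -> seq T) n : seq (T * T) :=
  flatten [seq [seq (x, y) | x <- f k, y <- f (n - k)%N] | k <- iota 0 n.+1].

Lemma enumerates_double (T : eqType) (N : T -> int) f : (forall x, 0 <= N x) -> enumerates N f ->
  enumerates (fun p => N p.1 + N p.2) (double f).
Proof.
move=> N0 [fu fm]; split=> [n|n [x y]].
  apply: uniq_flatten_map => [|k|k l [x y]]; first exact: iota_uniq.
    by apply: allpairs_uniq => // -[? ?] [? ?].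
  move=> /allpairsP[[x1 y1] /= [x1k _ [-> _]]] /allpairsP[[x2 y2] /= [x2k _ [e _]]].
  by move: x1k x2k; rewrite -e !fm => /eqP-> /eqP[].
apply/flatten_mapP/eqP => [[k + /allpairsP[[x' y'] /=]]|Nxy].
  rewrite mem_iota add0n ltnS !fm => /= kn [/eqP Nx /eqP Ny [-> ->]] /=.
  by rewrite Nx Ny -PoszD subnKC.
rewrite [X in N X]/= [X in _ + N X]/= in Nxy; have := N0 x; have := N0 y => y0 x0.
exists `|N x|%N; first by rewrite mem_iota; lia.
by apply/allpairsP; exists (x, y); rewrite !fm; split=> //=; apply/eqP; lia.
Qed.

Lemma size_double (T : Type) (f : nat -> seq T) n :
  size (double f n) = (\sum_(k < n.+1) size (f k) * size (f (n - k)))%N.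
Proof.
rewrite size_flatten /shape -map_comp sumnE big_map -[iota _ _]/(index_iota 0 n.+1) big_mkord.
by apply: eq_bigr => k _; rewrite /= size_allpairs.
Qed.

Definition irange n := [seq i%:Z - n%:Z | i <- iota 0 (n + n).+1].

Lemma irange_uniq n : uniq (irange n).
Proof. by rewrite map_inj_uniq ?iota_uniq // => i j /addIr[]. Qed.

Lemma mem_irange n (x : int) : (x \in irange n) = (- n%:Z <= x <= n%:Z).
Proof.
apply/mapP/idP => [[i + ->]|h]; first by rewrite mem_iota; lia.
by exists (absz (x + n%:Z)); [rewrite mem_iota|]; lia.
Qed.

Definition int_fib n := [seq x <- irange n | x ^+ 2 == n%:Z].
(* The coordinates of an element of norm n satisfy 3 c ^ 2 <= 4 n. *)
Definition coord_bound n := find (fun k => 4 * n < 3 * k.+1 ^ 2)%N (iota 0 n).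

Lemma coord_boundP n (c : int) : 3 * c ^+ 2 <= 4 * n%:Z ->
  - (coord_bound n)%:Z <= c <= (coord_bound n)%:Z.
Proof.
have : (4 * n < 3 * (coord_bound n).+1 ^ 2)%N.
  have [h|] := boolP (has (fun k => 4 * n < 3 * k.+1 ^ 2)%N (iota 0 n)).
    have := nth_find 0%N h; rewrite nth_iota ?add0n //.
    by rewrite has_find size_iota in h.
  (* Without a hit [find] returns n, and 4 n < 3 (n + 1)^2 always holds. *)
  by move=> /hasNfind; rewrite size_iota /coord_bound => ->; rewrite expnS expn1; nia.
move: (coord_bound n) => k; rewrite expnS expn1 => nk hc; apply/andP; split; rewrite leNgt; apply/negP => lt.
  have : 0 <= (- c - k%:Z - 1) * (- c + k%:Z + 1) by rewrite mulr_ge0 //; lia.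
  by nia.
have : 0 <= (c - k%:Z - 1) * (c + k%:Z + 1) by rewrite mulr_ge0 //; lia.
by nia.
Qed.

Definition quad_fib tau n : seq (quad tau) :=
  [seq x <- [seq (i, j) | i <- irange (coord_bound n), j <- irange (coord_bound n)] | quad_norm (x : quad tau) == n%:Z].
Definition quat_fib tau n : seq (quat tau) := double (@quad_fib tau) n.

Lemma int_fib_enum : enumerates (fun x : int => x ^+ 2) int_fib.
Proof.
split=> n; first by rewrite filter_uniq ?irange_uniq.
move=> x; rewrite mem_filter mem_irange; case: eqP => //= e; nia.
Qed.

Section Orders.
Variable tau : int.
Hypothesis tau01 : (tau == 0) || (tau == -1).

Lemma quad_norm_ge0 (x : quad tau) : 0 <= quad_norm x.
Proof. by rewrite /quad_norm; case/orP: tau01 => /eqP ->; nia. Qed.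

Lemma quad_norm_eq0 (x : quad tau) : quad_norm x = 0 -> x = 0.
Proof.
case: x => a b; rewrite /quad_norm /= => h.
have b0 : b = 0 by move: h; case/orP: tau01 => /eqP -> h; nia.
have a0 : a = 0 by move: h; rewrite b0; case/orP: tau01 => /eqP -> h; nia.
by rewrite a0 b0.
Qed.

Lemma quad_fib_enum : enumerates (@quad_norm tau) (@quad_fib tau).
Proof.
split=> n; first by rewrite filter_uniq ?allpairs_uniq ?irange_uniq // => -[? ?] [? ?].
move=> [a b]; rewrite mem_filter; case: eqP => // e.
suff : ((a, b) : int * int) \in [seq (i, j) | i <- irange (coord_bound n), j <- irange (coord_bound n)] by [].
(* Completing the square; 4 - tau^2 is 4 or 3, which gives the bound 3 c^2 <= 4 n for either
   coordinate. *)
have e1 : (2 * a + tau * b) ^+ 2 + (4 - tau ^+ 2) * b ^+ 2 = 4 * n%:Z.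
  by rewrite -e /quad_norm /=; ring.
have e2 : (2 * b + tau * a) ^+ 2 + (4 - tau ^+ 2) * a ^+ 2 = 4 * n%:Z.
  by rewrite -e /quad_norm /=; ring.
have := sqr_ge0 (2 * a + tau * b); have := sqr_ge0 (2 * b + tau * a) => s2 s1.
have := sqr_ge0 a; have := sqr_ge0 b => b2 a2.
apply/allpairsP; exists (a, b); rewrite !mem_irange !coord_boundP //=.
  by move: e1 s1 b2; clear -tau01; case/orP: tau01 => /eqP ->; rewrite ?sqrrN ?expr1n ?expr0n /=; lia.
by move: e2 s2 a2; clear -tau01; case/orP: tau01 => /eqP ->; rewrite ?sqrrN ?expr1n ?expr0n /=; lia.
Qed.

Lemma quad_norm_ring : norm_ring (@quad_conj tau) (@quad_norm tau) (@quad_fib tau).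
Proof.
split; [split|split|exact: quad_norm_ge0|exact: quad_norm_eq0|exact: quad_fib_enum].
- by move=> [a b]; rewrite quad_int; congr (_, _); rewrite /quad_norm /=; ring.
- by move=> [a b]; rewrite quad_int; congr (_, _); rewrite /quad_norm /=; ring.
- by move=> [a b] [c d]; congr (_, _) => /=; ring.
- by move=> [a b] [c d]; congr (_, _) => /=; ring.
- by move=> [a b]; rewrite /quad_norm /=; ring.
- by move=> [a b] [c d]; rewrite /quad_norm /=; ring.
- by move=> m; rewrite quad_int /quad_norm /=; ring.
Qed.

Lemma quat_norm_ring : norm_ring (@quat_conj tau) (@quat_norm tau) (@quat_fib tau).
Proof.
have N0 x : 0 <= quat_norm (x : quat tau) by rewrite addr_ge0 ?quad_norm_ge0.
split; [split|split|exact: N0| |exact: enumerates_double quad_norm_ge0 quad_fib_enum].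
- by move=> [[a b] [c d]]; rewrite quat_int; congr ((_, _), (_, _)); rewrite /quat_norm /quad_norm /=; ring.
- by move=> [[a b] [c d]]; rewrite quat_int; congr ((_, _), (_, _)); rewrite /quat_norm /quad_norm /=; ring.
- by move=> [[a b] [c d]] [[e f] [g h]]; congr ((_, _), (_, _)) => /=; ring.
- by move=> [[a b] [c d]] [[e f] [g h]]; congr ((_, _), (_, _)) => /=; ring.
- by move=> [[a b] [c d]]; rewrite /quat_norm /quad_norm /=; ring.
- by move=> [[a b] [c d]] [[e f] [g h]]; rewrite /quat_norm /quad_norm /=; ring.
- by move=> m; rewrite quat_int /quat_norm /quad_norm /=; ring.
move=> [x y]; rewrite /quat_norm /= => e; have := quad_norm_ge0 x; have := quad_norm_ge0 y => y0 x0.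
have ex : quad_norm x = 0 by move: e x0 y0; clear; lia.
have ey : quad_norm y = 0 by move: e x0 y0; clear; lia.
by rewrite (quad_norm_eq0 ex) (quad_norm_eq0 ey).
Qed.
End Orders.

Lemma int_norm_ring : norm_ring id (fun x : int => x ^+ 2) int_fib.
Proof.
split; [split|split|exact: sqr_ge0|by move=> x /eqP; rewrite sqrf_eq0 => /eqP|exact: int_fib_enum] => //.
- by move=> x; rewrite intz expr2.
- by move=> x; rewrite intz expr2.
- by move=> x y; rewrite mulrC.
- by move=> x y; rewrite exprMn.
- by move=> m; rewrite intz.
Qed.

(** * Division with remainder *)

Lemma round_int (c n : int) : 0 < n -> exists q, - n <= 2 * (c - n * q) <= n.
Proof.
move=> n0; exists ((2 * c + n) %/ (2 * n))%Z; set q := (_ %/ _)%Z.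
have := divz_eq (2 * c + n) (2 * n); rewrite -/q.
have n2 : 0 < 2 * n by lia.
have := modz_ge0 (2 * c + n) (lt0r_neq0 n2); have := ltz_pmod (2 * c + n) n2.
have -> : q * (2 * n) = 2 * (n * q) by ring.
have -> : 2 * (c - n * q) = 2 * c - 2 * (n * q) by ring.
lia.
Qed.

(* The fundamental triangle of the hexagonal lattice containing the reduced
   point p: the barycentric average of the squared distances of p to the
   vertices is l0 l1 + l0 l2 + l1 l2 <= 1 / 3. *)
Lemma round_hex (c : quad (-1)) (n : int) : 0 < n ->
  exists q, 3 * quad_norm (c - n%:~R * q) <= n ^+ 2.
Proof.
move=> n0; case: c => c d.
pose x := (c %% n)%Z; pose y := (d %% n)%Z; pose k := (c %/ n)%Z; pose l := (d %/ n)%Z.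
have ec : c = k * n + x := divz_eq c n; have ed : d = l * n + y := divz_eq d n.
have x0 : 0 <= x by rewrite modz_ge0 // lt0r_neq0.
have y0 : 0 <= y by rewrite modz_ge0 // lt0r_neq0.
have xn : x < n by exact: ltz_pmod.
have yn : y < n by exact: ltz_pmod.
have cand i j : 3 * ((x - n * i) ^+ 2 - (x - n * i) * (y - n * j) + (y - n * j) ^+ 2) <= n ^+ 2 ->
    exists q, 3 * quad_norm (((c, d) : quad (-1)) - n%:~R * q) <= n ^+ 2.
  move=> h; exists (k + i, l + j); rewrite quad_int /quad_norm /= ec ed; move: h.
  by congr (_ <= _); ring.
have avg (p0 p1 p2 l0 l1 l2 : int) : 0 <= l0 -> 0 <= l1 -> 0 <= l2 -> l0 + l1 + l2 = n ->
    l0 * p0 + l1 * p1 + l2 * p2 = n * (l0 * l1 + l0 * l2 + l1 * l2) ->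
    [\/ 3 * p0 <= n ^+ 2, 3 * p1 <= n ^+ 2 | 3 * p2 <= n ^+ 2].
  move=> h0 h1 h2 hn e.
  have [|g0] := leP (3 * p0) (n ^+ 2); first by constructor 1.
  have [|g1] := leP (3 * p1) (n ^+ 2); first by constructor 2.
  have [|g2] := leP (3 * p2) (n ^+ 2); first by constructor 3.
  exfalso; have b : 3 * (l0 * l1 + l0 * l2 + l1 * l2) <= n ^+ 2.
    have := sqr_ge0 (l0 - l1); have := sqr_ge0 (l0 - l2); have := sqr_ge0 (l1 - l2).
    rewrite -hn => *; nra.
  have : n * (3 * (l0 * l1 + l0 * l2 + l1 * l2)) <= n * n ^+ 2 by rewrite ler_pM2l.
  have -> : n * (3 * (l0 * l1 + l0 * l2 + l1 * l2)) = l0 * (3 * p0) + l1 * (3 * p1) + l2 * (3 * p2).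
    by rewrite mulrCA -e; ring.
  have a0 : l0 * (n ^+ 2 + 1) <= l0 * (3 * p0) by rewrite ler_wpM2l //; lia.
  have a1 : l1 * (n ^+ 2 + 1) <= l1 * (3 * p1) by rewrite ler_wpM2l //; lia.
  have a2 : l2 * (n ^+ 2 + 1) <= l2 * (3 * p2) by rewrite ler_wpM2l //; lia.
  have : l0 * (n ^+ 2 + 1) + l1 * (n ^+ 2 + 1) + l2 * (n ^+ 2 + 1) = n * n ^+ 2 + n by rewrite -hn; ring.
  lia.
(* The diagonal cuts the cell into two triangles with sides of length n; the weights are n times the
   barycentric coordinates of (x, y). *)
have [yx|xy] := leP y x.
  have [] := avg (x ^+ 2 - x * y + y ^+ 2) ((x - n) ^+ 2 - (x - n) * y + y ^+ 2)
     ((x - n) ^+ 2 - (x - n) * (y - n) + (y - n) ^+ 2) (n - x) (x - y) y; try lia; try ring.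
  - by move=> h; apply: (cand 0 0); rewrite !mulr0 !subr0.
  - by move=> h; apply: (cand 1 0); rewrite mulr1 !mulr0 !subr0.
  - by move=> h; apply: (cand 1 1); rewrite !mulr1.
have [] := avg (x ^+ 2 - x * y + y ^+ 2) (x ^+ 2 - x * (y - n) + (y - n) ^+ 2)
   ((x - n) ^+ 2 - (x - n) * (y - n) + (y - n) ^+ 2) (n - y) (y - x) x; try lia; try ring.
- by move=> h; apply: (cand 0 0); rewrite !mulr0 !subr0.
- by move=> h; apply: (cand 0 1); rewrite mulr1 !mulr0 !subr0.
- by move=> h; apply: (cand 1 1); rewrite !mulr1.
Qed.

(** Multiplying by the conjugate of b makes the divisor an integer: the norm of conj b t - N(b) q is
    N(b) times that of t - b q. *)
Lemma euclid_of_round (O : pzRingType) conj (N : O -> int) fib (b t : O) : norm_ring conj N fib ->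
  b != 0 -> (exists q, N (conj b * t - (N b)%:~R * q) < N b ^+ 2) -> exists q, N (t - b * q) < N b.
Proof.
move=> [[_ cjx _ _] [Ncj NM _] N0 N_eq0 _] b0 [q].
have Nb : 0 < N b by rewrite lt0r N0 andbT; apply: contra b0 => /eqP /N_eq0 ->.
rewrite -cjx -mulrA -mulrBr NM Ncj expr2 ltr_pM2l // => lt; by exists q.
Qed.

Definition mult_fib (O : pzRingType) (fib : nat -> seq O) := forall m n, (0 < m)%N -> (0 < n)%N ->
  coprime m n -> (size (fib m) * size (fib n) = size (fib 1) * size (fib (m * n)))%N.

Lemma mult_fib_euclid (O : pzRingType) conj (N : O -> int) fib : norm_ring conj N fib ->
  (forall (n : int) c, 0 < n -> exists q, N (c - n%:~R * q) < n ^+ 2) -> mult_fib fib.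
Proof.
move=> nr round m n m0 n0 cmn; apply: (card_fib_mul nr) => // z Nz.
have euclid b t : b != 0 -> exists q, N (t - b * q) < N b.
  move=> b0; apply: (euclid_of_round nr b0); apply: round.
  case: nr => _ _ N0 N_eq0 _.
  by rewrite lt0r N0 andbT; apply: contra b0 => /eqP /N_eq0 ->.
by apply: (factorization nr) => // b b0 *; exact: euclid.
Qed.

Lemma int_mult_fib : mult_fib int_fib.
Proof.
apply: (mult_fib_euclid int_norm_ring) => n c n0; have [q h] := round_int c n0.
exists q; rewrite intz; nia.
Qed.

Lemma gauss_mult_fib : mult_fib (@quad_fib 0).
Proof.
apply: (mult_fib_euclid (@quad_norm_ring 0 isT)) => n [c d] n0.
have [q hq] := round_int c n0; have [r hr] := round_int d n0.
exists (q, r).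
rewrite [X in X < _](_ : _ = (c - n * q) ^+ 2 + (d - n * r) ^+ 2); last first.
  by rewrite quad_int /quad_norm /=; ring.
move: (c - n * q) (d - n * r) hq hr => u v hq hr; nia.
Qed.

Lemma hex_mult_fib : mult_fib (@quad_fib (-1)).
Proof.
apply: (mult_fib_euclid (@quad_norm_ring (-1) isT)) => n c n0.
have [q hq] := round_hex c n0; exists q.
have third (k l : int) : 0 < l -> 0 <= k -> 3 * k <= l -> k < l by lia.
exact: third (exprn_gt0 2 n0) (@quad_norm_ge0 (-1) isT _) hq.
Qed.

(** Each of the two coordinates contributes at most n^2/3 to the norm of the remainder. *)
Lemma hex_quat_mult_fib : mult_fib (@quat_fib (-1)).
Proof.
apply: (mult_fib_euclid (@quat_norm_ring (-1) isT)) => n [c d] n0.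
have [q hq] := round_hex c n0; have [r hr] := round_hex d n0; exists (q, r).
rewrite [X in X < _](_ : _ = quad_norm (c - n%:~R * q) + quad_norm (d - n%:~R * r)); last first.
  case: c d q r {hq hr} => [c1 c2] [d1 d2] [q1 q2] [r1 r2].
  by rewrite quat_int !quad_int /quat_norm /quad_norm /=; ring.
have thirds (k k' l : int) : 0 < l -> 3 * k <= l -> 3 * k' <= l -> k + k' < l by lia.
exact: thirds (exprn_gt0 2 n0) hq hr.
Qed.

(* Lipschitz quaternions: rounding fails only when 2 c / n has four odd
   coordinates. *)
Definition all_odd (p : quat 0) := [/\ (2 %| p.1.1 - 1)%Z, (2 %| p.1.2 - 1)%Z,
  (2 %| p.2.1 - 1)%Z & (2 %| p.2.2 - 1)%Z].

Lemma round_lipschitz (c : quat 0) (n : int) : 0 < n ->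
  (exists q, quat_norm (c - n%:~R * q) < n ^+ 2) \/ (exists2 p, all_odd p & c *+ 2 = n%:~R * p).
Proof.
case: c => [[c1 c2] [c3 c4]] n0.
have [q1 h1] := round_int c1 n0; have [q2 h2] := round_int c2 n0.
have [q3 h3] := round_int c3 n0; have [q4 h4] := round_int c4 n0.
(* The four squared remainders are at most n^2/4, so their sum reaches n^2 only if every one equals
   n^2/4, that is, every remainder is plus or minus n/2. *)
have sq i q : - n <= 2 * (i - n * q) <= n -> 4 * (i - n * q) ^+ 2 <= n ^+ 2 /\
    (4 * (i - n * q) ^+ 2 = n ^+ 2 -> exists2 p, (2 %| p - 1)%Z & i *+ 2 = n * p).
  have : i = (i - n * q) + n * q by rewrite subrK.
  move: (i - n * q) => u -> hu; split; first by nia.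
  move=> eq; have : (2 * u - n) * (2 * u + n) == 0.
    by have -> : (2 * u - n) * (2 * u + n) = 4 * u ^+ 2 - n ^+ 2; [ring|rewrite eq subrr].
  rewrite mulf_eq0 => /orP[/eqP h|/eqP h]; [exists (2 * q + 1)|exists (2 * q - 1)].
  - by rewrite addrK dvdz_mulr.
  - by have -> : n = 2 * u; [lia|ring].
  - by have -> : 2 * q - 1 - 1 = 2 * (q - 1); [ring|rewrite dvdz_mulr].
  by have -> : n = - (2 * u); [lia|ring].
have [l1 o1] := sq _ _ h1; have [l2 o2] := sq _ _ h2; have [l3 o3] := sq _ _ h3; have [l4 o4] := sq _ _ h4.
pose q : quat 0 := ((q1, q2), (q3, q4)).
have [lt|ge] := ltP (quat_norm ((((c1, c2), (c3, c4)) : quat 0) - n%:~R * q)) (n ^+ 2).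
  by left; exists q.
right; have Nq : quat_norm ((((c1, c2), (c3, c4)) : quat 0) - n%:~R * q) =
    (c1 - n * q1) ^+ 2 + (c2 - n * q2) ^+ 2 + (c3 - n * q3) ^+ 2 + (c4 - n * q4) ^+ 2.
  by rewrite quat_int /quat_norm /quad_norm /=; ring.
rewrite Nq in ge.
have [|p1 d1 e1] := o1; first by move: l1 l2 l3 l4 ge; clear; lia.
have [|p2 d2 e2] := o2; first by move: l1 l2 l3 l4 ge; clear; lia.
have [|p3 d3 e3] := o3; first by move: l1 l2 l3 l4 ge; clear; lia.
have [|p4 d4 e4] := o4; first by move: l1 l2 l3 l4 ge; clear; lia.
exists ((p1, p2), (p3, p4)) => //; rewrite quat_int.
have -> : (((c1, c2), (c3, c4)) : quat 0) *+ 2 = ((c1 *+ 2, c2 *+ 2), (c3 *+ 2, c4 *+ 2)) by [].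
by rewrite e1 e2 e3 e4; congr ((_, _), (_, _)) => /=; ring.
Qed.

(** Odd squares are 1 modulo 8, so the sum of four is 4 modulo 8. *)
Lemma all_odd_norm p : all_odd p -> exists k, quat_norm p = 4 * (2 * k + 1).
Proof.
have sq i : (2 %| i - 1)%Z -> exists k, i ^+ 2 = 8 * k + 1.
  case/dvdzP => j e; have ei : i = 2 * j + 1 by move: e; clear; lia.
  have [l [el|el]] : exists l, j = 2 * l \/ j = 2 * l + 1.
  - exists (j %/ 2)%Z; have := divz_eq j 2; have := modz_ge0 j (isT : 2 != 0 :> int).
    by have := ltz_pmod j (isT : 0 < 2 :> int); clear; lia.
  - by exists (l * (2 * l + 1)); rewrite ei el; ring.
  by exists ((2 * l + 1) * (l + 1)); rewrite ei el; ring.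
case: p => [[a b] [c d]] [/= /sq[i ei] /sq[j ej] /sq[k ek] /sq[l el]].
by exists (i + j + k + l); rewrite /quat_norm /quad_norm /= ei ej ek el; ring.
Qed.

Lemma all_odd_double (w p : quat 0) (n : int) : all_odd p -> w *+ 2 = n%:~R * p -> (2 %| n)%Z.
Proof.
case=> /dvdzP[j e] _ _ _ /(congr1 (fun x : quat 0 => x.1.1)).
have -> : (w *+ 2).1.1 = w.1.1 *+ 2 by [].
have -> : (n%:~R * p).1.1 = n * p.1.1 by rewrite quat_int /=; ring.
have -> : p.1.1 = j * 2 + 1 by rewrite -e subrK.
by move=> h; apply/dvdzP; exists (w.1.1 - n * j); move: h; rewrite mulrDr mulr1 => h; lia.
Qed.

(** A failed division by b forces N(b) to be even. But N(b) divides m^2, which is odd: for the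
    division of z because b divides m, and for the division of m because comparing norms gives m^2 =
    N(b) (2 k + 1). *)
Lemma lipschitz_factorization m n (z : quat 0) : odd m -> coprime m n -> quat_norm z = (m * n)%N ->
  exists x y, [/\ z = x * y, quat_norm x = m & quat_norm y = n].
Proof.
move=> om cmn Nz; have m0 : (0 < m)%N by case: (m) om.
have nr := @quat_norm_ring 0 isT.
have NM (x y : quat 0) : quat_norm (x * y) = quat_norm x * quat_norm y by case: nr => _ [].
have Nint (k : int) : quat_norm (k%:~R : quat 0) = k ^+ 2 by case: nr => _ [].
have Ncj (x : quat 0) : quat_norm (quat_conj x) = quat_norm x by case: nr => _ [].
have Npos (b : quat 0) : b != 0 -> 0 < quat_norm b.
  case: nr => _ _ N0 N_eq0 _ b0.
  by rewrite lt0r N0 andbT; apply: contra b0 => /eqP /N_eq0 ->.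
have odd_m2 (k l : int) : m%:Z ^+ 2 = k * l -> ~~ (2 %| k)%Z.
  move=> e; apply/negP => k2; have : (2 %| m%:Z ^+ 2)%Z by rewrite e dvdz_mulr.
  by rewrite dvdzE abszX dvdn2 oddX om.
have div b t : b != 0 -> (forall p, all_odd p -> (quat_conj b * t) *+ 2 = (quat_norm b)%:~R * p ->
    ~~ (2 %| quat_norm b)%Z) -> exists q, quat_norm (t - b * q) < quat_norm b.
  move=> b0 no; apply: (euclid_of_round nr b0).
  have [//|[p op ep]] := round_lipschitz (quat_conj b * t) (Npos b b0).
  by have := no p op ep; rewrite (all_odd_double op ep).
apply: (factorization nr m0 cmn Nz) => b b0; last first.
  move=> [y my]; apply: (div b z b0) => *; apply: (odd_m2 _ (quat_norm y)).
  by rewrite -NM -my Nint.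
apply: (div b _ b0) => p op /(congr1 (@quat_norm 0)).
have [k ek] := all_odd_norm op; rewrite -mulr_natl -[2%:R]/(2%:~R) !NM Ncj !Nint ek.
move=> e; apply: (odd_m2 _ (2 * k + 1)); apply: (@mulfI _ (4 * quat_norm b)).
  by have := Npos b b0; lia.
by move: e; rewrite mulrCA mulrA => e; nia.
Qed.

Lemma lipschitz_mult_fib : mult_fib (@quat_fib 0).
Proof.
move=> m n m0 n0 cmn; have nr := @quat_norm_ring 0 isT; apply: (card_fib_mul nr) => // z Nz.
have [om|em] := boolP (odd m); first exact: lipschitz_factorization.
(* For even m the coprime n is odd; conjugation puts n in the place of m. *)
apply: (factorization_conj nr); apply: lipschitz_factorization; last 2 first.
- by rewrite coprime_sym.
- by case: nr => _ [-> _ _]; rewrite mulnC.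
apply: contraT => en; have : (2 %| gcdn m n)%N by rewrite dvdn_gcd !dvdn2 em.
by rewrite (eqP cmn).
Qed.

(** * Normalized counting sequences *)

Definition ratio (K : fieldType) (T : Type) (fib : nat -> seq T) (n : nat) : K :=
  (size (fib n))%:R / (size (fib 1))%:R.

Lemma mult_ext_pos (K : pzRingType) (f g : nat -> K) : (forall n, (0 < n)%N -> f n = g n) -> mult f -> mult g.
Proof. by move=> fg fm r s r0 s0 c; rewrite -!fg ?muln_gt0 ?r0 //; exact: fm. Qed.

Section Ratio.
Variable K : numFieldType.

Lemma mult_ratio (O : pzRingType) (fib : nat -> seq O) : (0 < size (fib 1))%N -> mult_fib fib ->
  mult (ratio K fib).
Proof.
move=> w0 fm r s r0 s0 crs; have n0 : (size (fib 1))%:R != 0 :> K by rewrite pnatr_eq0 -lt0n.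
have := fm r s r0 s0 crs => /(congr1 (fun n => n%:R : K)); rewrite !natrM => e.
by rewrite /ratio [RHS]mulrACA e [RHS]mulrACA divff // mul1r.
Qed.

(** Zero is the only element of norm 0, so the two extreme terms of the convolution give 2 r(n).
    With w units there are 2 w in the double, whence the factor w/2 = k t after normalization. *)
Lemma next_ratio (S T : Type) (fib : nat -> seq S) (fib' : nat -> seq T) k (t : K) n :
  (forall n, size (fib' n) = size (double fib n)) -> size (fib 0) = 1%N -> (0 < size (fib 1))%N ->
  k%:R * t = (size (fib 1))%:R / 2%:R -> (0 < n)%N -> next k t (ratio K fib) n = ratio K fib' n.
Proof.
move=> e f0 w0 kt n0; have w : (size (fib 1))%:R != 0 :> K by rewrite pnatr_eq0 -lt0n.
have full m : (0 < m)%N -> (size (fib' m))%:R = 2%:R * (size (fib m))%:R +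
    \sum_(1 <= i < m) (size (fib i))%:R * (size (fib (m - i)%N))%:R :> K.
  case: m => // m _; rewrite e size_double -(big_mkord xpredT (fun i => (size (fib i) * size (fib (m.+1 - i)%N))%N)).
  rewrite big_nat_recr // big_ltn //= subn0 subnn f0 mul1n muln1 !natrD natr_sum.
  under [X in _ + X + _]eq_bigr do rewrite natrM.
  by ring.
have f1 : (size (fib' 1%N))%:R = 2%:R * (size (fib 1%N))%:R :> K by rewrite full // big_geq // addr0.
rewrite /next /conv kt /ratio (full _ n0) f1.
under [X in _ + _ * X]eq_bigr do rewrite mulrACA -invfM.
by rewrite -mulr_suml; field.
Qed.
End Ratio.

Lemma size_quad_fib0 n : size (quad_fib 0 n) = size (double int_fib n).
Proof.
have [du dm] := enumerates_double (@sqr_ge0 _) int_fib_enum.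
have [qu qm] := @quad_fib_enum 0 isT.
apply/perm_size/uniq_perm => // -[a b]; rewrite [RHS]dm [LHS]qm /quad_norm /=.
by rewrite mul0r mul0r addr0.
Qed.

Definition z_seq (K : fieldType) : nat -> K := ratio K int_fib.
Definition i_seq (K : fieldType) : nat -> K := ratio K (@quad_fib 0).
Definition h_seq (K : fieldType) : nat -> K := ratio K (@quad_fib (-1)).

Section ThetaSequences.
Variable K : numFieldType.

(** Doubling leads from Z to Z[i] and on to the Lipschitz quaternions, whose counts are those of the
    square and the fourth power. *)
Lemma mult_z : mult3 1 (z_seq K).
Proof.
have nz : forall n, (0 < n)%N -> ratio K (@quad_fib 0) n = next 1 1 (z_seq K) n.
  move=> n n0; rewrite (next_ratio (fib' := @quad_fib 0)) ?mulr1 ?divff ?pnatr_eq0 //.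
  exact: size_quad_fib0.
split.
- by rewrite /z_seq /ratio divff // pnatr_eq0.
- exact: mult_ratio int_mult_fib.
- exact: mult_ext_pos nz (mult_ratio K (fib := @quad_fib 0) isT gauss_mult_fib).
apply: (mult_ext_pos _ (mult_ratio K (fib := @quat_fib 0) isT lipschitz_mult_fib)) => n n0.
rewrite -(next_ratio (fib := @quad_fib 0) (k := 2) (t := 1)) //; last first.
  by rewrite mulr1 -[size _]/(2 * 2)%N natrM mulfK // pnatr_eq0.
by apply: next_ext => // i /andP[i0 _]; exact: nz.
Qed.

Lemma mult_i : mult (i_seq K) /\ mult (next 1 2%:R (i_seq K)).
Proof.
split; first exact: mult_ratio gauss_mult_fib.
apply: (mult_ext_pos _ (mult_ratio K (fib := @quat_fib 0) isT lipschitz_mult_fib)) => n n0.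
rewrite -(next_ratio (fib := @quad_fib 0) (k := 1) (t := 2%:R)) //.
by rewrite mul1r -[size _]/(2 * 2)%N natrM mulfK // pnatr_eq0.
Qed.

Lemma mult_h : mult (h_seq K) /\ mult (next 1 3%:R (h_seq K)).
Proof.
split; first exact: mult_ratio hex_mult_fib.
apply: (mult_ext_pos _ (mult_ratio K (fib := @quat_fib (-1)) isT hex_quat_mult_fib)) => n n0.
rewrite -(next_ratio (fib := @quad_fib (-1)) (k := 1) (t := 3%:R)) //.
by rewrite mul1r -[size _]/(3 * 2)%N natrM mulfK // pnatr_eq0.
Qed.

Lemma ratio_values (T : Type) (fib : nat -> seq T) w l : (0 < w)%N ->
  all (fun n => size (fib n) == w * nth 0 l n)%N (iota 1 22) -> nth 0%N l 1 = 1%N ->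
  has_values (ratio K fib) l.
Proof.
move=> w0 /allP chk l1 n n_23; rewrite /ratio.
have n_in : n \in iota 1 22 by rewrite mem_iota; move: n_23; lia.
rewrite (eqP (chk n n_in)) (eqP (chk 1%N isT)) l1 muln1 natrM mulrC mulKf //.
by rewrite pnatr_eq0 -lt0n.
Qed.

Lemma values_z : has_values (z_seq K) values_Z.
Proof. refine (@ratio_values _ int_fib 2 values_Z isT _ erefl); vm_compute; reflexivity. Qed.

Lemma values_i : has_values (i_seq K) values_Zi.
Proof. refine (@ratio_values _ (@quad_fib 0) 4 values_Zi isT _ erefl); vm_compute; reflexivity. Qed.

Lemma values_h : has_values (h_seq K) values_Zzeta3.
Proof. refine (@ratio_values _ (@quad_fib (-1)) 6 values_Zzeta3 isT _ erefl); vm_compute; reflexivity. Qed.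
End ThetaSequences.

End Orders.

(** * The theta functions as counting sequences *)

Module Theta.
Import all_boot all_order all_algebra finmap mathcomp_extra boolp classical_sets functions.
Import cardinality fsbigop reals trigo complex ring zify lra.
Import Order.TTheory GRing.Theory Num.Theory.
Local Open Scope classical_set_scope.
Local Open Scope complex_scope.
Local Open Scope ring_scope.
Import Elimination Valuation Certificates Data Charts Coefficients Orders.

Section ThetaOrders.
Variable R : realType.
Local Notation C := R[i].

(** The map [phi] is an injective ring morphism that turns N into the squared modulus, so units are
    the elements of norm 1 and both finite counts are sizes of lists. *)
Lemma theta_order (O : pzRingType) conj (N : O -> int) fib (phi : O -> C) (A : set C) n :
  norm_ring conj N fib -> phi 1 = 1 -> {morph phi : x y / x - y} -> {morph phi : x y / x * y} ->
  (forall x, `|phi x| ^+ 2 = (N x)%:~R) -> A = [set phi x | x in setT] ->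
  theta A n = (size (fib n))%:R / (size (fib 1))%:R.
Proof.
move=> [[xcj _ _ _] [_ NM Nint] N0 N_eq0 [fu fm]] phi1 phiB phiM phiN ->.
have inj : injective phi.
  move=> x y e; apply/eqP; rewrite -subr_eq0; apply/eqP/N_eq0/eqP.
  by rewrite -(intr_eq0 C) -phiN phiB e subrr normr0 expr0n.
have uA k : uniq (map phi (fib k)) by rewrite map_inj_uniq.
have units : units_of [set phi x | x in setT] = [set` [fset x in map phi (fib 1)]%fset].
  rewrite eqEsubset; split=> z /=.
    move=> [[x _ <-]] [_ [y _ <-]] e; rewrite !inE mem_map // fm.
    have xy : x * y = 1 by apply: inj; rewrite phiM e phi1.
    have := congr1 N xy; rewrite NM; have := Nint 1; rewrite expr1n /= => -> e1.
    move: e1 (N0 x) (N0 y); move: (N x) (N y) => [k|//] [l|//] e1 _ _.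
    have : (k * l == 1)%N by rewrite -eqz_nat PoszM; apply/eqP.
    by rewrite muln_eq1 => /andP[/eqP ->].
  rewrite !inE => /mapP[x + ->]; rewrite fm => /eqP Nx; split; first by exists x.
  exists (phi (conj x)); first by exists (conj x).
  by rewrite -phiM xcj Nx phi1.
rewrite /theta units set_fsetK card_fseq undup_id // size_map mulrC; congr (_ / _).
rewrite -(@fsbig_widen _ _ _ _ [set` map phi (fib n)]).
- rewrite -fsbig_seq // big_map (eq_big_seq (fun=> 1)) => [|x]; last first.
    by rewrite fm => /eqP Nx; rewrite phiN Nx eqxx.
  by rewrite big_const_seq count_predT iter_addr_0.
- by move=> z /= /mapP[x _ ->]; exists x.
move=> z /= [[x _ <-] nz]; case: eqP => // e; case: nz; apply/mapP; exists x => //.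
rewrite fm; apply/eqP; move: e; rewrite phiN => /eqP; rewrite -[n%:R]/(n%:Z%:~R) eqr_int.
by move=> /eqP.
Qed.

Lemma theta_Z_ratio n : theta_Z n = (size (int_fib n))%:R / (size (int_fib 1))%:R :> C.
Proof.
rewrite /theta_Z; apply: (theta_order (phi := fun x : int => x%:~R) n int_norm_ring) => //.
- by move=> x y; rewrite intrB.
- by move=> x y; rewrite intrM.
- by move=> x; rewrite -intr_norm -rmorphXn /= real_normK ?num_real.
Qed.

Lemma theta_quad_ratio tau (alpha : C) n : (tau == 0) || (tau == -1) ->
  alpha + alpha^* = tau%:~R -> alpha * alpha^* = 1 ->
  theta (Zadjoin alpha) n = (size (quad_fib tau n))%:R / (size (quad_fib tau 1))%:R.
Proof.
move=> tau01 tr nm; have cj : alpha^* = tau%:~R - alpha by rewrite -tr addrC addKr.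
have a2 : alpha * alpha = tau%:~R * alpha - 1 by rewrite -[X in _ - X]nm -tr; ring.
pose phi (x : quad tau) : C := x.1%:~R + x.2%:~R * alpha.
have cji (m : int) : (m%:~R : C)^* = m%:~R by exact: (rmorph_int (@conjc R)).
apply: (@theta_order (quad tau) _ _ _ phi _ n (quad_norm_ring tau01)).
- by rewrite /phi /= mul0r addr0.
- move=> [a b] [c d]; transitivity ((a - c)%:~R + (b - d)%:~R * alpha); first by [].
  by rewrite /phi /= !intrB; ring.
- move=> [a b] [c d].
  transitivity ((a * c - b * d)%:~R + (a * d + b * c + tau * b * d)%:~R * alpha); first by [].
  rewrite /phi /= !(intrD, intrB, intrM).
  transitivity (a%:~R * c%:~R + (a%:~R * d%:~R + b%:~R * c%:~R) * alpha + b%:~R * d%:~R * (tau%:~R * alpha - 1)).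
    by ring.
  by rewrite -a2; ring.
- move=> [a b]; rewrite normCK -[Num.conj _]/(_^*) /phi /= rmorphD rmorphM /= !cji.
  rewrite /quad_norm /= ?expr2 !(intrD, intrM).
  transitivity (a%:~R * a%:~R + a%:~R * b%:~R * (alpha + alpha^*) + b%:~R * b%:~R * (alpha * alpha^*)).
    by ring.
  by rewrite tr nm; ring.
rewrite /Zadjoin eqEsubset; split=> z /= [x _ <-]; last first.
  exists (x.2%:P * 'X + x.1%:P) => //.
  by rewrite rmorphD rmorphM /= !map_polyC map_polyX !hornerE /phi addrC.
elim/poly_ind: x => [|p c [[a b] _ IH]].
  by exists 0; rewrite // map_poly0 horner0 /phi /= mul0r addr0.
(* Horner step: (a + b alpha) alpha + c, with alpha^2 = tau alpha - 1. *)
exists (c - b, a + tau * b) => //.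
rewrite rmorphD rmorphM /= map_polyC map_polyX !hornerE /= -IH /phi /= !(intrD, intrB, intrM).
transitivity (a%:~R * alpha + b%:~R * (tau%:~R * alpha - 1) + c%:~R); first by ring.
by rewrite -a2; ring.
Qed.

Lemma theta_Zi_ratio n : theta_Zi n = (size (quad_fib 0 n))%:R / (size (quad_fib 0 1))%:R :> C.
Proof.
apply: theta_quad_ratio => //; apply/eqP; rewrite eq_complex /=; apply/andP; split; apply/eqP; ring.
Qed.

Lemma theta_Zzeta3_ratio n :
  theta_Zzeta3 n = (size (quad_fib (-1) n))%:R / (size (quad_fib (-1) 1))%:R :> C.
Proof.
pose c : R := cos (2 * pi / 3); pose s : R := sin (2 * pi / 3).
have cs : c ^+ 2 + s ^+ 2 = 1 := cos2Dsin2 _.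
have s0 : 0 < s.
  by apply: sin_gt0_pi; have := pi_gt0 R; lra.
(* The cosine of three times the angle is 1. This cubic in c factors as (c - 1)(2 c + 1)^2, and s >
   0 rules out c = 1. *)
have c3 : c * (c ^+ 2 *+ 2 - 1) - s * ((c * s) *+ 2) = 1.
  rewrite -cos_mulr2n -sin_mulr2n -cosD.
  have -> : 2 * pi / 3 + (2 * pi / 3) *+ 2 = 0 + pi *+ 2 :> R by field.
  by rewrite cosD2pi cos0.
have c12 : c = - 2^-1.
  have : (c - 1) * (2 * c + 1) ^+ 2 = 0.
    have s2 : s ^+ 2 = 1 - c ^+ 2 by rewrite -cs addrC addKr.
    have c3' : c * (2 * c ^+ 2 - 1) - 2 * c * s ^+ 2 = 1 by rewrite -[RHS]c3; ring.
    rewrite s2 in c3'.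
    transitivity (c * (2 * c ^+ 2 - 1) - 2 * c * (1 - c ^+ 2) - 1); first by ring.
    by rewrite c3' subrr.
  move/eqP; rewrite mulf_eq0 expf_eq0 /= => /orP[|/eqP h]; last by lra.
  rewrite subr_eq0 => /eqP c1; move: cs; rewrite c1 expr1n => /eqP.
  by rewrite -subr_eq0 addrC addKr expf_eq0 /= => /eqP s00; move: s0; rewrite s00 ltxx.
apply: theta_quad_ratio => //; apply/eqP; rewrite eq_complex /= -/c -/s; apply/andP; split; apply/eqP.
- by rewrite c12; field.
- by ring.
- by rewrite -cs; ring.
- by ring.
Qed.
End ThetaOrders.

End Theta.

Import Elimination Coefficients Orders Theta.
Import ring zify lra.
Import Order.TTheory GRing.Theory Num.Theory.
Import Pilot.Defs.
Local Open Scope ring_scope.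

(** * Powers of a series and their normalization *)

Section PowerSeriesProducts.
Variable K : fieldType.
Implicit Types f g h : pseries K.

Lemma ps_mulE N f g n : (n < N)%N -> ps_mul f g n = ((\poly_(i < N) f i) * (\poly_(i < N) g i))`_n.
Proof.
move=> nN; rewrite coefM; apply: eq_bigr => i _; rewrite !coef_poly.
by rewrite (leq_trans (ltn_ord i) nN) (leq_ltn_trans (leq_subr _ _) nN).
Qed.

Lemma ps_mul_poly N f g (P : {poly K}) n : (n < N)%N -> (forall i, (i < N)%N -> g i = P`_i) ->
  ps_mul f g n = ((\poly_(i < N) f i) * P)`_n.
Proof.
move=> nN gP; rewrite coefM; apply: eq_bigr => i _; rewrite coef_poly (leq_trans (ltn_ord i) nN).
by rewrite gP // (leq_ltn_trans (leq_subr _ _) nN).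
Qed.

Lemma ps_mul_ext f g f' g' n : f =1 f' -> g =1 g' -> ps_mul f g n = ps_mul f' g' n.
Proof. by move=> ff gg; apply: eq_bigr => i _; rewrite ff gg. Qed.

Lemma ps_mul1 f : ps_mul f (ps_one K) =1 f.
Proof.
move=> n; rewrite /ps_mul big_ord_recr /= /ps_one subnn mulr1 big1 ?add0r // => i _.
by rewrite subn_eq0 leqNgt ltn_ord mulr0.
Qed.

Lemma ps_exp2 f : ps_exp f 2 =1 ps_mul f f.
Proof. by move=> n; apply: ps_mul_ext => //; exact: ps_mul1. Qed.

(** Associativity is inherited from the polynomials obtained by truncating after degree n. *)
Lemma ps_exp4 f : ps_exp f 4 =1 ps_mul (ps_exp f 2) (ps_exp f 2).
Proof.
move=> n; pose P := \poly_(i < n.+1) f i.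
have e2 i : (i < n.+1)%N -> ps_exp f 2 i = (P * P)`_i by move=> iN; rewrite ps_exp2 (ps_mulE _ _ iN).
have e3 i : (i < n.+1)%N -> ps_exp f 3 i = (P * (P * P))`_i.
  by move=> iN; rewrite -(ps_mul_poly f iN e2).
rewrite [LHS](ps_mul_poly f (ltnSn n) e3) [RHS](ps_mul_poly _ (ltnSn n) e2) mulrA coefM [RHS]coefM.
by apply: eq_bigr => i _; rewrite coef_poly ltn_ord e2.
Qed.

(** The coefficient of q in r g^2 is 2 r g_0, and it must be 1; the same product 2 r g_0 multiplies
    g_n in every later coefficient. *)
Lemma normalized_square (g u : pseries K) r : g 1%N = 1 -> u 1%N = 1 ->
  (forall n, u n = r * ps_mul g g n) ->
  r * 2%:R * g 0%N = 1 /\ forall n, (0 < n)%N -> u n = g n + r * conv g n.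
Proof.
move=> g1 u1 uE; have full n : (0 < n)%N -> ps_mul g g n = 2%:R * g 0%N * g n + conv g n.
  case: n => // n _; rewrite /ps_mul -(big_mkord xpredT (fun i => g i * g (n.+1 - i)%N)).
  by rewrite big_nat_recr // big_ltn //= subn0 subnn /conv; ring.
have r1 : r * 2%:R * g 0%N = 1.
  have := u1; rewrite uE full // g1 /conv big_geq // addr0 mulr1 mulrA; exact.
by split=> // n n0; rewrite uE full // mulrDr !mulrA r1 mul1r.
Qed.
End PowerSeriesProducts.

Section Normalization.
Variables (K : numFieldType) (f : pseries K).

(** The constant term 1/(2 T) of g makes the factor of g^2 equal to T. The normalized square then
    has constant term T/(2 T)^2 = 1/(4 T), so the factor of its own square is 2 T. *)
Lemma normalization : multiplicative f -> multiplicative (ps_exp f 2) -> multiplicative (ps_exp f 4) ->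
  exists l T, [/\ l != 0, T != 0, l * f 0%N = (2%:R * T)^-1 & mult3 T (ps_scale l f)].
Proof.
move=> [l [[T T0 g0] g1 gm]] [m [_ h1 hm]] [k [_ u1 um]].
have l0 : l != 0.
  by apply/eqP => l0; move: g1; rewrite /ps_scale l0 mul0r => /eqP; rewrite eq_sym oner_eq0.
have m0 : m != 0.
  by apply/eqP => m0; move: h1; rewrite /ps_scale m0 mul0r => /eqP; rewrite eq_sym oner_eq0.
pose g := ps_scale l f; pose h := ps_scale m (ps_exp f 2); pose u := ps_scale k (ps_exp f 4).
have n2 : 2%:R != 0 :> K by rewrite pnatr_eq0.
have hE n : h n = m / l ^+ 2 * ps_mul g g n.
  rewrite /h /ps_scale ps_exp2 /ps_mul !mulr_sumr; apply: eq_bigr => i _.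
  by rewrite /g /ps_scale; field.
have uE n : u n = k / m ^+ 2 * ps_mul h h n.
  rewrite /u /ps_scale ps_exp4 /ps_mul !mulr_sumr; apply: eq_bigr => i _.
  by rewrite /h /ps_scale; field.
have [r1 hn] := @normalized_square K g h _ g1 h1 hE.
have [r2 un] := @normalized_square K h u _ h1 u1 uE.
have g0' : g 0%N = (2%:R * T)^-1 by rewrite /g g0 div1r.
have rT : m / l ^+ 2 = T.
  have : m / l ^+ 2 / T = 1 by rewrite -[RHS]r1 g0'; field; rewrite ?T0 ?l0 ?n2.
  by move/divr1_eq.
have h0 : h 0%N = (4%:R * T)^-1.
  have -> : h 0%N = T * (g 0%N * g 0%N) by rewrite hE rT /ps_mul big_ord1.
  by rewrite g0'; field.
have kT : k / m ^+ 2 = 2%:R * T.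
  have : k / m ^+ 2 / (2%:R * T) = 1 by rewrite -[RHS]r2 h0; field; rewrite ?T0 ?m0 ?n2.
  by move/divr1_eq.
have hnext n : (0 < n)%N -> h n = next 1 T g n by move=> n0; rewrite hn // rT /next mul1r.
exists l, T; split=> //; split=> //.
  by apply: (mult_ext_pos hnext) => r s r0 s0 c; exact: hm.
have unext n : (0 < n)%N -> u n = next 2 T (next 1 T g) n.
  move=> n0; rewrite un // kT /next -/(next 1 T g n) -hnext //; congr (_ + _ * _).
  by apply: conv_ext => i /andP[i0 _]; exact: hnext.
by apply: (mult_ext_pos unext) => r s r0 s0 c; exact: um.
Qed.
End Normalization.

(** * Back to the series f *)

Section Conclusion.
Variables (K : numFieldType) (f th : pseries K) (T0 : Type) (fib : nat -> seq T0) (l T s : K).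
Hypotheses (l0 : l != 0) (f0 : l * f 0%N = (2%:R * T)^-1) (s2 : s ^+ 2 = 1)
  (fib0 : size (fib 0) = 1%N)
  (thE : forall n, th n = ratio K fib n)
  (eT : 2%:R * T = (size (fib 1))%:R * s)
  (fE : forall n, (0 < n)%N -> l * f n = twist s (ratio K fib) n).

Lemma multiple_of_twist : constant_multiple f th \/ constant_multiple f (ps_alt th).
Proof.
have s0 : s != 0 by apply/eqP => e; move/eqP: s2; rewrite e expr0n eq_sym oner_eq0.
have sV : s^-1 = s by apply: (mulfI s0); rewrite divff // -expr2.
have fn n : l * f n = s * (s ^+ n * th n).
  case: n => [|n]; last by rewrite fE // thE /twist /= [RHS]mulrA -exprS (exprD s 2 n) s2 mul1r.
  (* The constant term: with w units, 1/(2 T) = 1/(w s) = s/w, which is s times the constant term of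
     [th]. *)
  by rewrite f0 eT thE /ratio fib0 expr0 !mul1r invfM sV mulrC.
have fc n : f n = l^-1 * s * (s ^+ n * th n) by rewrite -mulrA -fn mulKf.
move/eqP: s2; rewrite sqrf_eq1 => /orP[/eqP s1|/eqP s1]; [left|right]; exists (l^-1 * s) => n.
  by rewrite {1}fc s1 expr1n mul1r.
by rewrite {1}fc /ps_alt s1.
Qed.
End Conclusion.

Theorem theorem1p2 (R : realType) (f : pseries R[i]) :
  multiplicative f ->
  multiplicative (ps_exp f 2) ->
  multiplicative (ps_exp f 4) ->
  constant_multiple f theta_Z \/
  constant_multiple f (ps_alt theta_Z) \/
  constant_multiple f theta_Zi \/
  constant_multiple f (ps_alt theta_Zi) \/
  constant_multiple f theta_Zzeta3 \/
  constant_multiple f (ps_alt theta_Zzeta3).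
Proof.
move=> f1 f2 f4; have [l [T [l0 T0 lf0 m3]]] := normalization f1 f2 f4.
have [im im2] := mult_i R[i]; have [hm hm2] := mult_h R[i].
have [s s2] := sequence_cases T0 m3 (mult_z _) im im2 hm hm2 (values_z _) (values_i _) (values_h _).
case=> -[eT fE].
- have [] := @multiple_of_twist _ f theta_Z _ int_fib l T s l0 lf0 s2 erefl (@theta_Z_ratio R) _ fE.
  + by rewrite eT.
  + by left.
  + by right; left.
- have [] := @multiple_of_twist _ f theta_Zi _ (@quad_fib 0) l T s l0 lf0 s2 erefl (@theta_Zi_ratio R) _ fE.
  + by rewrite eT mulrA -natrM.
  + by right; right; left.
  + by right; right; right; left.
have [] := @multiple_of_twist _ f theta_Zzeta3 _ (@quad_fib (-1)) l T s l0 lf0 s2 erefl (@theta_Zzeta3_ratio R) _ fE.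
- by rewrite eT mulrA -natrM.
- by do 4!right; left.
by do 5!right.
Qed.
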